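(* $Z_{\mathcal{L}}(N)\to\infty$ as $N\to\infty$, where $Z_{\mathcal{L}}(N)$ denotes the minimum number of unimodular zeros of a reciprocal Littlewood polynomial of degree $N$.
   Context: A Littlewood polynomial of degree $N$ is a polynomial $P(z)=\sum_{n=0}^N\varepsilon_n z^n$ with $\varepsilon_n\in\{-1,1\}$ for all $0\le n\le N$; $\mathcal{L}_N$ denotes the set of all of these. A polynomial $P(z)=\sum_{n=0}^N a_nz^n$ is reciprocal if $P(z)=z^NP(1/z)$, equivalently $a_j=a_{N-j}$ for all $0\le j\le N$. For a polynomial $P$, let $Z(P)=\left|\{\rho\in\mathbf{C}:|\rho|=1,\ P(\rho)=0\}\right|$ be the number of (distinct) zeros of modulus $1$. Define $$Z_{\mathcal{L}}(N)=\min\{Z(P): P\in\mathcal{L}_N,\ P\text{ reciprocal}\}.$$ *)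

(* Defs.v *)
From HB Require Import structures.
From mathcomp Require Import all_boot all_order all_algebra finmap.
From mathcomp Require Import all_classical all_reals all_analysis.
From mathcomp Require Import complex.

Set Implicit Arguments.
Unset Strict Implicit.
Unset Printing Implicit Defensive.

Import Order.TTheory GRing.Theory Num.Theory.
Import numFieldNormedType.Exports.

Local Open Scope classical_set_scope.
Local Open Scope ring_scope.
Local Open Scope complex_scope.

Definition littlewood (R : realType) (N : nat) (P : {poly R[i]}) : Prop :=
  size P = N.+1 /\ forall n, (n <= N)%N -> P`_n = -1 \/ P`_n = 1.

(* P(z) = z^N P(1/z), as an identity of rational functions. *)
Definition reciprocal (R : realType) (N : nat) (P : {poly R[i]}) : Prop :=
  forall z : R[i], z != 0 -> P.[z] = z ^+ N * P.[z^-1].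

Definition unimodular_zeros (R : realType) (P : {poly R[i]}) : set R[i] :=
  [set rho | `|rho| = 1 /\ P.[rho] = 0].

(* fset_set sends infinite sets to the empty set; this only happens for P = 0,
   see finite_unimodular_zeros. *)
Definition num_unimodular_zeros (R : realType) (P : {poly R[i]}) : nat :=
  #|` fset_set (unimodular_zeros P)|%fset.

Lemma finite_unimodular_zeros (R : realType) (P : {poly R[i]}) :
  P != 0 -> finite_set (unimodular_zeros P).
Proof.
move=> P0; have [r rP] := closed_field_poly_normal P.
apply: (@sub_finite_set _ _ [set` r]); last exact: finite_seq.
move=> x [_ Px] /=; have : root P x by apply/rootP.
by rewrite rP rootZ ?lead_coef_eq0// root_prod_XsubC.
Qed.

Lemma reciprocal_coef (R : realType) (N : nat) (P : {poly R[i]}) :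
  (size P <= N.+1)%N ->
  reciprocal N P <-> forall j, (j <= N)%N -> P`_j = P`_(N - j).
Proof.
move=> sP; pose Q := \poly_(j < N.+1) P`_(N - j).
have QE z : z != 0 -> Q.[z] = z ^+ N * P.[z^-1].
  move=> z0; rewrite horner_poly (horner_coef_wide _ sP) mulr_sumr.
  rewrite (reindex_inj rev_ord_inj) /=; apply: eq_bigr => i _.
  have iN : (i <= N)%N by rewrite -ltnS.
  rewrite subSS subKn// mulrCA exprVn; congr (_ * _).
  have -> : z ^+ N = z ^+ (N - i) * z ^+ i by rewrite -exprD subnK.
  by rewrite mulfK// expf_neq0.
split=> [rP j jN|cP z z0].
  suff QP : Q = P by rewrite -[in LHS]QP coef_poly ltnS jN.
  apply/eqP; rewrite -subr_eq0; apply/negPn/negP => QP0.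
  pose r : seq R[i] := [seq k.+1%:R | k <- iota 0 (size (Q - P))].
  have /(max_poly_roots QP0) : all (root (Q - P)) r.
    apply/allP => _ /mapP[k _ ->]; rewrite /root hornerD hornerN subr_eq0.
    by rewrite QE ?pnatr_eq0// -rP ?pnatr_eq0.
  rewrite map_inj_uniq ?iota_uniq; last first.
    by move=> a b /eqP; rewrite eqr_nat => /eqP[].
  by move=> /(_ isT); rewrite size_map size_iota ltnn.
rewrite -QE//; congr (_.[_]); apply/polyP => j; rewrite coef_poly.
case: ifPn => [|Nj]; first by rewrite ltnS => /cP.
by rewrite nth_default// (leq_trans sP)// leqNgt.
Qed.

Lemma exists_num_reciprocal_littlewood (R : realType) (N : nat) :
  exists m, `[< exists P : {poly R[i]},
    [/\ littlewood N P, reciprocal N P & num_unimodular_zeros P = m] >].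
Proof.
pose P : {poly R[i]} := \poly_(j < N.+1) 1.
have PE j : (j <= N)%N -> P`_j = 1 by move=> jN; rewrite coef_poly ltnS jN.
have sP : size P = N.+1 by rewrite size_poly_eq ?oner_neq0.
exists (num_unimodular_zeros P); apply/asboolP; exists P; split => //.
  by split=> // n /PE; right.
by apply/reciprocal_coef => [|j jN]; rewrite ?sP// !PE// leq_subr.
Qed.

(* Z_L(N): ex_minn returns the least element of a nonempty set of naturals. *)
Definition ZL (R : realType) (N : nat) : nat :=
  ex_minn (exists_num_reciprocal_littlewood R N).

(* Main.v *)
(** Suppose that reciprocal Littlewood polynomials P of unbounded degree N have at
    most K unimodular zeros. Multiplying P by the product Q of the zeros of odd
    multiplicity among these gives P Q = W W^* with W^*(z) = z^M conj(W(1/conj z)),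
    so the coefficients of P Q are correlations of W, and those of P Q D D^* are
    correlations of W D: twice the modulus of a coefficient far from the middle
    is at most the middle one. Pass to an ultralimit, in which Q converges, and
    let eta and e be the limits of the coefficient sequence of P at its low end
    and around the degree M.

    The coefficients of Q eta tend to 0, because W is bounded in l2, and they take
    finitely many values; so Q eta is a polynomial V and eta is eventually
    periodic. Testing the correlation inequality with Fejer kernels at roots of
    unity shows that far values of e on opposite sides of the middle and in the
    same residue class are opposite. Then Q e is a Laurent polynomial too, and
    Parseval turns the inequality |Q e| >= 2 |V| on the unit circle into an
    equality. Being extremal, W must be small away from both of its ends, so the
    coefficients of P Q are exactly V at the low end, Q e around M, the reverse of V
    at the high end, and 0 elsewhere. On the unit circle this reads
    z^-M P Q = 2 |V| + 2 Re (z^-M V), which vanishes wherever z^-M V = - |V|, that is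
    at about M points, contradicting the bound K. *)
Require Import Defs.
From mathcomp Require Import all_boot all_order all_algebra.
From mathcomp Require Import all_classical all_reals all_analysis.
From mathcomp Require Import all_solvable separable cyclotomic.
From mathcomp Require Import complex ring lra zify.

Set Implicit Arguments.
Unset Strict Implicit.
Unset Printing Implicit Defensive.

Import Order.TTheory GRing.Theory Num.Theory.
Import numFieldNormedType.Exports.

Local Open Scope classical_set_scope.
Local Open Scope ring_scope.

(** * Complex norms, convolution and reversed conjugates *)

Local Notation nc := ComplexField.Normc.normc.
Local Notation cj := conjc.

Section Norm.
Context {R : realType}.
Local Notation C := R[i].
Implicit Types (x y z : C).

(** Rigidity is possible because the constants match exactly. The factor 2 in the correlation
    inequality comes from two disjoint ranges of [W] and the AM-GM inequality; on the other side the
    squared twisted means of the signs [eta] sum to 1, while two signs differ by at most 2.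

    The obstacle is a test at a zero of [Q] on the circle, where both sides lose the factor [Q].
    Such factors are removed in pairs by an approximate division. If their number is even, the mean
    of [eta] at this point must vanish; if one is left over, it turns the test on [e] into a
    difference of two adjacent blocks, that is, of the two halves.

    Along an ultrafilter only [Q] genuinely converges: each fixed sign of [P] is eventually equal to
    its limit. A combination of signs with the fixed coefficients of the limit of [Q] takes finitely
    many values, so that smallness means vanishing. This is why the final exact identity concerns
    [P] times the limit of [Q], whose few zeros are discarded at the end. *)

Lemma ncE x : `|x| = (nc x)%:C%C. Proof. by case: x. Qed.

Lemma nc_ge0 x : 0 <= nc x.
Proof. by rewrite -(lecR (0 : R)) -ncE normr_ge0. Qed.

Lemma nc0 : nc (0 : C) = 0. Proof. exact: ComplexField.Normc.normc0. Qed.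
Lemma nc1 : nc (1 : C) = 1. Proof. exact: ComplexField.Normc.normc1. Qed.
Lemma ncM x y : nc (x * y) = nc x * nc y.
Proof. exact: ComplexField.Normc.normcM. Qed.
Lemma ncV x : nc x^-1 = (nc x)^-1.
Proof. exact: ComplexField.Normc.normcV. Qed.
Lemma ncN x : nc (- x) = nc x. Proof. exact: normcN. Qed.
Lemma ncX x n : nc (x ^+ n) = nc x ^+ n.
Proof. by elim: n => [|n IH]; rewrite ?expr0 ?nc1// !exprS ncM IH. Qed.
Lemma ncXz x (n : int) : nc (x ^ n) = nc x ^ n.
Proof. by case: n => n; rewrite ?NegzE -?exprnN ?ncV -?exprnP ncX. Qed.
Lemma ncD x y : nc (x + y) <= nc x + nc y. Proof. exact: le_normcD. Qed.
Lemma ncB x y : nc (x - y) <= nc x + nc y.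
Proof. by rewrite -(ncN y); exact: ncD. Qed.
Lemma ncBC x y : nc (x - y) = nc (y - x).
Proof. by rewrite -ncN opprB. Qed.
Lemma ncDB x y : nc x - nc y <= nc (x + y).
Proof. have := ncD (x + y) (- y); rewrite addrK ncN; lra. Qed.
Lemma ncBB x y : nc x - nc y <= nc (x - y).
Proof. by rewrite -(ncN y); exact: ncDB. Qed.
Lemma nc_cj x : nc (cj x) = nc x.
Proof. by apply/complexI; rewrite -!ncE normcJ. Qed.
Lemma nc_eq0 x : (nc x == 0) = (x == 0).
Proof.
apply/eqP/eqP => [|->]; last exact: nc0.
exact: ComplexField.Normc.eq0_normc.
Qed.
Lemma nc_gt0 x : (0 < nc x) = (x != 0).
Proof. by rewrite lt_def nc_ge0 andbT nc_eq0. Qed.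
Lemma nc_real (r : R) : nc (r%:C%C) = `|r|.
Proof. by rewrite /= expr0n /= addr0 sqrtr_sqr. Qed.
Lemma nc_nat n : nc (n%:R : C) = n%:R.
Proof. by rewrite -(rmorph_nat (real_complex R)) nc_real normr_nat. Qed.
Lemma Re_le x : complex.Re x <= nc x.
Proof.
have := normc_ge_Re x; rewrite ncE lecR; exact/le_trans/ler_norm.
Qed.
Lemma nReLe x : - nc x <= complex.Re x.
Proof. by have := Re_le (- x); rewrite ncN raddfN /=; lra. Qed.
Lemma Re_mulcj x : complex.Re (x * cj x) = nc x ^+ 2.
Proof. by rewrite -sqr_normc ncE -rmorphXn /=. Qed.
Lemma mulcj x : x * cj x = (nc x ^+ 2)%:C%C.
Proof. by rewrite -sqr_normc ncE -rmorphXn. Qed.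
Lemma nc_sq x : nc x ^+ 2 = complex.Re x ^+ 2 + complex.Im x ^+ 2.
Proof. by case: x => a b; rewrite /= sqr_sqrtr // addr_ge0 ?sqr_ge0. Qed.
Lemma nc_par x y :
  nc (x - y) ^+ 2 + nc (x + y) ^+ 2 = 2 * nc x ^+ 2 + 2 * nc y ^+ 2.
Proof. by case: x y => a b [c d]; rewrite !nc_sq /=; ring. Qed.

Lemma nc_sum (I : Type) (r : seq I) (P : pred I) (F : I -> C) :
  nc (\sum_(i <- r | P i) F i) <= \sum_(i <- r | P i) nc (F i).
Proof.
elim/big_rec2: _ => [|i y x _ IH]; first by rewrite nc0.
by apply: le_trans (ncD _ _) _; rewrite lerD2l.
Qed.

Lemma unim_neq0 x : nc x = 1 -> x != 0.
Proof. by move=> h; rewrite -nc_gt0 h ltr01. Qed.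
Lemma unim_cj x : nc x = 1 -> cj x = x^-1.
Proof.
move=> h; apply: (mulfI (unim_neq0 h)); rewrite mulcj h expr1n.
by rewrite divff ?unim_neq0.
Qed.
Lemma unim_inv x : nc x = 1 -> nc x^-1 = 1.
Proof. by rewrite ncV => ->; rewrite invr1. Qed.
Lemma unim_expz x (n : int) : nc x = 1 -> nc (x ^ n) = 1.
Proof. by rewrite ncXz => ->; rewrite exp1rz. Qed.
Lemma unim_exp x n : nc x = 1 -> nc (x ^+ n) = 1.
Proof. by rewrite ncX => ->; rewrite expr1n. Qed.

End Norm.

Section Act.
Context {R : realType}.
Local Notation C := R[i].
Implicit Types (p q : {poly C}) (a b : int -> C).

(* The coefficients of p(z) (sum_i a_i z^i), for a bi-infinite sequence a. *)
Definition act p a (i : int) : C := \sum_(j < size p) p`_j * a (i - j%:Z).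

Lemma act_widen p a i n : (size p <= n)%N ->
  act p a i = \sum_(j < n) p`_j * a (i - j%:Z).
Proof.
move=> pn; rewrite /act (big_ord_widen n (fun j => p`_j * a (i - j%:Z))) //.
rewrite big_mkcond /=; apply: eq_bigr => j _; case: ifP => // /negbT.
by rewrite -leqNgt => h; rewrite nth_default ?mul0r.
Qed.

Lemma eq_act p a b i : a =1 b -> act p a i = act p b i.
Proof. by move=> h; apply: eq_bigr => j _; rewrite h. Qed.

Lemma actD p q a i : act (p + q) a i = act p a i + act q a i.
Proof.
rewrite (act_widen _ _ (size_polyD p q)).
rewrite (act_widen (p := p) _ _ (leq_maxl _ (size q))).
rewrite (act_widen (p := q) _ _ (leq_maxr (size p) _)).
by rewrite -big_split; apply: eq_bigr => j _; rewrite coefD mulrDl.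
Qed.

Lemma actZ (c : C) p a i : act (c *: p) a i = c * act p a i.
Proof.
rewrite (act_widen _ _ (size_scale_leq c p)) /act mulr_sumr.
by apply: eq_bigr => j _; rewrite coefZ mulrA.
Qed.

Lemma actN p a i : act (- p) a i = - act p a i.
Proof. by rewrite -scaleN1r actZ mulN1r. Qed.

Lemma actB p q a i : act (p - q) a i = act p a i - act q a i.
Proof. by rewrite actD actN. Qed.

Lemma act0 a i : act 0 a i = 0.
Proof. by rewrite /act size_poly0 big_ord0. Qed.

Lemma actC (c : C) a i : act c%:P a i = c * a i.
Proof.
by rewrite (act_widen _ _ (size_polyC_leq1 c)) big_ord1 coefC subr0.
Qed.

Lemma act1 a i : act 1 a i = a i.
Proof. by rewrite -[1]/(1%:P) actC mul1r. Qed.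

Lemma act_sum I (r : seq I) (P : pred I) (F : I -> {poly C}) a i :
  act (\sum_(j <- r | P j) F j) a i = \sum_(j <- r | P j) act (F j) a i.
Proof.
by elim/big_rec2: _ => [|j y x _ <-]; rewrite ?act0 ?actD.
Qed.

Lemma actXM p a i : act ('X * p) a i = act p a (i - 1).
Proof.
rewrite (@act_widen _ _ _ (size p).+1); last first.
  by apply: leq_trans (size_polyMleq _ _) _; rewrite size_polyX.
rewrite big_ord_recl coefXM mul0r add0r; apply: eq_bigr => j _.
by rewrite coefXM /= /bump /= add1n; congr (_ * a _); lia.
Qed.

Lemma actXnM n p a i : act ('X^n * p) a i = act p a (i - n%:Z).
Proof.
elim: n i => [|n IH] i; first by rewrite expr0 mul1r subr0.
by rewrite exprS -mulrA actXM IH; congr (act _ _ _); lia.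
Qed.

Lemma actXn n a i : act 'X^n a i = a (i - n%:Z).
Proof. by rewrite -[in LHS](mulr1 'X^n) actXnM act1. Qed.

Lemma actM p q a i : act (p * q) a i = act p (act q a) i.
Proof.
elim/poly_ind: p i => [|p c IH] i; first by rewrite mul0r !act0.
rewrite mulrDl -!(mulrC 'X) -mulrA !actD !actXM IH actC mul_polyC actZ.
by [].
Qed.

Lemma actMC p q a i : act (p * q) a i = act q (act p a) i.
Proof. by rewrite mulrC actM. Qed.

Lemma act_seqD p a b i :
  act p (fun j => a j + b j) i = act p a i + act p b i.
Proof. by rewrite -big_split; apply: eq_bigr => j _; rewrite mulrDr. Qed.

Lemma act_seqN p a i : act p (fun j => - a j) i = - act p a i.
Proof. by rewrite -sumrN; apply: eq_bigr => j _; rewrite mulrN. Qed.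

Lemma act_seqB p a b i :
  act p (fun j => a j - b j) i = act p a i - act p b i.
Proof. by rewrite act_seqD act_seqN. Qed.

Lemma act_shift p a t i : act p (fun j => a (j + t)) i = act p a (i + t).
Proof. by apply: eq_bigr => j _; congr (_ * a _); lia. Qed.

Definition pseq p (i : int) : C := if i is Posz n then p`_n else 0.

Lemma act_pseq p q i : act p (pseq q) i = pseq (p * q) i.
Proof.
elim/poly_ind: p i => [|p c IH] i.
  by rewrite mul0r act0; case: i => // n; rewrite /= coef0.
rewrite actD actC -(mulrC 'X) actXM IH mulrDl -mulrA mul_polyC.
case: i => [[|n]|n].
- by rewrite /= coefD coefZ coefXM.
- have -> : n.+1%:Z - 1 = n%:Z by lia.
  by rewrite /= coefD coefZ coefXM addrC.
by rewrite /= mulr0 addr0.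
Qed.

(** The l1 norm on coefficients is submultiplicative and bounds [act p] on sequences bounded by 1;
    all error terms below are measured in it. *)
Definition nrm1 p : R := \sum_(j < size p) nc p`_j.

Lemma nrm1_widen p n : (size p <= n)%N -> nrm1 p = \sum_(j < n) nc p`_j.
Proof.
move=> pn; rewrite /nrm1 (big_ord_widen n (fun j => nc p`_j)) //.
rewrite big_mkcond /=; apply: eq_bigr => j _; case: ifP => // /negbT.
by rewrite -leqNgt => h; rewrite nth_default ?nc0.
Qed.

Lemma nrm1_ge0 p : 0 <= nrm1 p.
Proof. by apply: sumr_ge0 => j _; apply: nc_ge0. Qed.

Lemma nrm1D p q : nrm1 (p + q) <= nrm1 p + nrm1 q.
Proof.
rewrite (nrm1_widen (size_polyD p q)).
rewrite (nrm1_widen (p := p) (leq_maxl _ (size q))).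
rewrite (nrm1_widen (p := q) (leq_maxr (size p) _)).
by rewrite -big_split; apply: ler_sum => j _; rewrite coefD ncD.
Qed.

Lemma nrm1Z (c : C) p : nrm1 (c *: p) = nc c * nrm1 p.
Proof.
rewrite (nrm1_widen (size_scale_leq c p)) /nrm1 mulr_sumr.
by apply: eq_bigr => j _; rewrite coefZ ncM.
Qed.

Lemma nrm1N p : nrm1 (- p) = nrm1 p.
Proof. by rewrite -scaleN1r nrm1Z ncN nc1 mul1r. Qed.

Lemma nrm1B p q : nrm1 (p - q) <= nrm1 p + nrm1 q.
Proof. by rewrite -(nrm1N q) nrm1D. Qed.

Lemma nrm1C (c : C) : nrm1 c%:P = nc c.
Proof. by rewrite (nrm1_widen (size_polyC_leq1 c)) big_ord1 coefC. Qed.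

Lemma nrm1_0 : nrm1 0 = 0.
Proof. by rewrite /nrm1 size_poly0 big_ord0. Qed.

Lemma nrm1_1 : nrm1 1 = 1. Proof. by rewrite nrm1C nc1. Qed.

Lemma nrm1XM p : nrm1 ('X * p) = nrm1 p.
Proof.
rewrite (@nrm1_widen _ (size p).+1); last first.
  by apply: leq_trans (size_polyMleq _ _) _; rewrite size_polyX.
rewrite big_ord_recl coefXM nc0 add0r; apply: eq_bigr => j _.
by rewrite coefXM.
Qed.

Lemma nrm1XnM n p : nrm1 ('X^n * p) = nrm1 p.
Proof. by elim: n => [|n IH]; rewrite ?mul1r// exprS -mulrA nrm1XM. Qed.

Lemma nrm1Xn n : nrm1 'X^n = 1.
Proof. by rewrite -['X^n]mulr1 nrm1XnM nrm1_1. Qed.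

Lemma nrm1M p q : nrm1 (p * q) <= nrm1 p * nrm1 q.
Proof.
have nrmXC p' c : nrm1 (p' * 'X + c%:P) = nrm1 p' + nc c.
  rewrite (@nrm1_widen _ (size p').+1); last first.
    by rewrite size_MXaddC; case: ifP.
  rewrite big_ord_recl coefD coefMX coefC add0r addrC; congr (_ + _).
  by apply: eq_bigr => j _; rewrite coefD coefMX coefC /= addr0.
elim/poly_ind: p => [|p c IH]; first by rewrite mul0r nrm1_0 mul0r.
rewrite nrmXC mulrDl -(mulrC 'X) -mulrA mul_polyC.
by apply: le_trans (nrm1D _ _) _; rewrite nrm1XM nrm1Z mulrDl lerD2r.
Qed.

Lemma nrm1_sum I (r : seq I) (P : pred I) (F : I -> {poly C}) :
  nrm1 (\sum_(j <- r | P j) F j) <= \sum_(j <- r | P j) nrm1 (F j).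
Proof.
elim/big_rec2: _ => [|i y x _ IH]; first by rewrite nrm1_0.
by apply: le_trans (nrm1D _ _) _; rewrite lerD2l.
Qed.

Lemma act_bound p a (B : R) i : (forall j, nc (a j) <= B) ->
  nc (act p a i) <= nrm1 p * B.
Proof.
move=> h; apply: le_trans (nc_sum _ _ _) _; rewrite /nrm1 mulr_suml.
by apply: ler_sum => j _; rewrite ncM ler_wpM2l ?nc_ge0.
Qed.

End Act.

Section Star.
Context {R : realType}.
Local Notation C := R[i].
Implicit Types (p q : {poly C}).

(* z^n conj(p(1/conj z)) *)
Definition star n p : {poly C} := \poly_(i < n.+1) cj p`_(n - i).

Lemma coef_star n p i : (i <= n)%N -> (star n p)`_i = cj p`_(n - i).
Proof. by move=> h; rewrite coef_poly ltnS h. Qed.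

Lemma size_star n p : (size (star n p) <= n.+1)%N.
Proof. exact: size_poly. Qed.

Lemma starD n p q : star n (p + q) = star n p + star n q.
Proof.
apply/polyP => i; rewrite coefD !coef_poly; case: ifP => _.
  by rewrite coefD rmorphD.
by rewrite addr0.
Qed.

Lemma starZ n (c : C) p : star n (c *: p) = cj c *: star n p.
Proof.
apply/polyP => i; rewrite coefZ !coef_poly; case: ifP => _.
  by rewrite coefZ rmorphM.
by rewrite mulr0.
Qed.

Lemma starN n p : star n (- p) = - star n p.
Proof. by rewrite -scaleN1r starZ rmorphN1 scaleN1r. Qed.

Lemma starB n p q : star n (p - q) = star n p - star n q.
Proof. by rewrite starD starN. Qed.

Lemma star0 n : star n 0 = 0.
Proof.
by apply/polyP => i; rewrite coef_poly !coef0 rmorph0; case: ifP.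
Qed.

Lemma star_sum n I (r : seq I) (P : pred I) (F : I -> {poly C}) :
  star n (\sum_(j <- r | P j) F j) = \sum_(j <- r | P j) star n (F j).
Proof.
by elim/big_rec2: _ => [|j y x _ <-]; rewrite ?star0 ?starD.
Qed.

Lemma starXn n i : (i <= n)%N -> star n 'X^i = 'X^(n - i).
Proof.
move=> h; apply/polyP => j; rewrite coef_poly !coefXn; case: ltnP => hj.
  have -> : (n - j == i)%N = (j == n - i)%N.
    by apply/eqP/eqP; lia.
  by case: (j == n - i)%N; rewrite ?rmorph1 ?rmorph0.
by have -> : (j == n - i)%N = false by apply/eqP; lia.
Qed.

Lemma starC (c : C) : star 0 c%:P = (cj c)%:P.
Proof.
by rewrite -[c%:P]mulr1 mul_polyC starZ -[1]/('X^0) starXn // -mul_polyC mulr1.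
Qed.

Lemma star1 : star 0 1 = 1.
Proof. by rewrite -[1]/((1:C)%:P) starC rmorph1. Qed.

Lemma starM n m p q : (size p <= n.+1)%N -> (size q <= m.+1)%N ->
  star (n + m) (p * q) = star n p * star m q.
Proof.
move=> hp hq.
have E k (r : {poly C}) : (size r <= k.+1)%N -> r = \sum_(i < k.+1) r`_i *: 'X^i.
  move=> hr; rewrite -poly_def; apply/polyP => i; rewrite coef_poly.
  by case: ltnP => // h; rewrite nth_default ?(leq_trans hr).
rewrite [in LHS](E _ _ hp) [in RHS](E _ _ hp) [in LHS](E _ _ hq) [in RHS](E _ _ hq).
rewrite !star_sum !mulr_suml star_sum; apply: eq_bigr => i _.
rewrite !mulr_sumr star_sum; apply: eq_bigr => j _.
have hi : (i <= n)%N by rewrite -ltnS.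
have hj : (j <= m)%N by rewrite -ltnS.
rewrite !starZ !starXn // -!scalerAl -!scalerAr -!exprD !starZ.
by rewrite starXn ?leq_add // !scalerA; congr (_ *: 'X^_); lia.
Qed.

Lemma starX n m p k : (size p <= n.+1)%N -> m = (n * k)%N ->
  star m (p ^+ k) = star n p ^+ k.
Proof.
move=> hp ->; elim: k => [|k IH]; first by rewrite !expr0 muln0 star1.
rewrite !exprS mulnS starM // ?IH //.
by apply: leq_trans (size_poly_exp_leq _ _) _; rewrite ltnS leq_mul2r; lia.
Qed.

Lemma starK n p : (size p <= n.+1)%N -> star n (star n p) = p.
Proof.
move=> h; apply/polyP => i; rewrite coef_poly; case: ltnP => hi.
  by rewrite coef_star ?leq_subr // conjcK subKn.
by rewrite nth_default ?(leq_trans h).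
Qed.

Lemma nrm1_star n p : (size p <= n.+1)%N -> nrm1 (star n p) = nrm1 p.
Proof.
move=> h; rewrite (nrm1_widen (size_star n p)) (nrm1_widen h).
rewrite (reindex_inj rev_ord_inj) /=; apply: eq_bigr => i _.
have hi : (i <= n)%N by rewrite -ltnS.
by rewrite subSS coef_star ?leq_subr // nc_cj subKn.
Qed.

Lemma horner_star n p x : nc x = 1 -> (size p <= n.+1)%N ->
  (star n p).[x] = x ^+ n * cj p.[x].
Proof.
move=> ux hp; rewrite horner_poly (horner_coef_wide _ hp) rmorph_sum mulr_sumr.
rewrite (reindex_inj rev_ord_inj) /=; apply: eq_bigr => i _.
have hi : (i <= n)%N by rewrite -ltnS.
rewrite subSS subKn // rmorphM rmorphXn /= (unim_cj ux) mulrCA; congr (_ * _).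
have -> : x ^+ n = x ^+ (n - i) * x ^+ i by rewrite -exprD subnK.
by rewrite exprVn mulfK // expf_neq0 // unim_neq0.
Qed.

(* The coefficient at l only sees the p_i with i <= l or i >= m - l, two
   disjoint ranges as 2l < m. *)
Lemma star_corr p m l : (size p <= m.+1)%N -> (2 * l < m)%N ->
  2 * nc (p * star m p)`_l + \sum_(l.+1 <= i < m - l) nc p`_i ^+ 2 <=
  complex.Re (p * star m p)`_m
  /\ complex.Re (p * star m p)`_m = \sum_(i < m.+1) nc p`_i ^+ 2.
Proof.
move=> hp hl.
have E : complex.Re (p * star m p)`_m = \sum_(i < m.+1) nc p`_i ^+ 2.
  rewrite coefM raddf_sum; apply: eq_bigr => i _.
  have hi : (i <= m)%N by rewrite -ltnS.
  by rewrite coef_star ?leq_subr // subKn //; exact: Re_mulcj.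
split=> //; rewrite E -(big_mkord predT (fun i => nc p`_i ^+ 2)).
rewrite (@big_cat_nat _ _ _ l.+1 0 m.+1) /=; [|lia|lia].
rewrite (@big_cat_nat _ _ _ (m - l) l.+1 m.+1) /=; [|lia|lia].
have -> : \sum_(m - l <= i < m.+1) nc p`_i ^+ 2 =
          \sum_(0 <= i < l.+1) nc p`_(m - l + i) ^+ 2.
  rewrite -{1}(add0n (m - l)%N) big_addn; have -> : (m.+1 - (m - l) = l.+1)%N by lia.
  by apply: eq_bigr => i _; rewrite addnC.
suff : 2 * nc (p * star m p)`_l <= \sum_(0 <= i < l.+1) nc p`_i ^+ 2 +
     \sum_(0 <= i < l.+1) nc p`_(m - l + i) ^+ 2 by lra.
rewrite -big_split /= coefM big_mkord.
apply: le_trans (_ : 2 * \sum_(i < l.+1) nc (p`_i * (star m p)`_(l - i)) <= _).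
  by rewrite ler_wpM2l // nc_sum.
rewrite mulr_sumr; apply: ler_sum => i _.
have hi : (i <= l)%N by rewrite -ltnS.
rewrite ncM coef_star; last lia.
rewrite nc_cj; have -> : (m - (l - i) = m - l + i)%N by lia.
by have := sqr_ge0 (nc p`_i - nc p`_(m - l + i)); rewrite sqrrB; lra.
Qed.

End Star.

(** * The limiting correlation inequality *)

Section Pos.
Context {R : realType}.
Local Notation C := R[i].
Implicit Types (p q Q D : {poly C}) (a b e eta : int -> C) (rho : C).

Lemma le_arch (x y c : R) :
  (forall H : nat, x <= y + c / H.+1%:R) -> x <= y.
Proof.
move=> h; rewrite leNgt; apply/negP => yx.
have := archi_boundP (normr_ge0 (c / (x - y))).
set m := Num.bound _ => hm; have := h m.
have m1 : 0 < m.+1%:R :> R by rewrite ltr0n.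
rewrite -lerBlDl ler_pdivlMr //.
have : `|c / (x - y)| < m.+1%:R by rewrite (lt_le_trans hm) // ler_nat.
rewrite normrM normfV ltr_pdivrMr ?normr_gt0 ?subr_eq0; last lra.
rewrite (gtr0_norm (_ : 0 < x - y)); last lra.
move=> h1 h2; have := ler_norm c; lra.
Qed.

Definition tw rho a (i : int) : C := rho ^ i * a i.

Definition dil rho p := p \Po (rho *: 'X).

Lemma dilXM rho p (c : C) : dil rho (p * 'X + c%:P) = rho *: (dil rho p * 'X) + c%:P.
Proof.
by rewrite /dil comp_polyD comp_polyM comp_polyX comp_polyC scalerAr.
Qed.

Lemma coef_dil rho p i : (dil rho p)`_i = rho ^+ i * p`_i.
Proof.
elim/poly_ind: p i => [|p c IH] i; first by rewrite /dil comp_poly0 !coef0 mulr0.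
rewrite dilXM !coefD coefZ !coefMX !coefC.
case: i => [|i] /=; first by rewrite mulr0 expr0 mul1r.
by rewrite IH !addr0 mulrA exprS.
Qed.

Lemma size_dil rho p : (size (dil rho p) <= size p)%N.
Proof. by apply/leq_sizeP => j h; rewrite coef_dil nth_default ?mulr0. Qed.

Lemma dilM rho p q : dil rho (p * q) = dil rho p * dil rho q.
Proof. exact: comp_polyM. Qed.

Lemma dilK rho p : rho != 0 -> dil rho (dil rho^-1 p) = p.
Proof.
move=> h; apply/polyP => i; rewrite !coef_dil mulrA exprVn divff ?mul1r //.
by rewrite expf_neq0.
Qed.

Lemma dil_horner rho p x : (dil rho p).[x] = p.[rho * x].
Proof. by rewrite horner_comp hornerZ hornerX. Qed.

Lemma act_dil rho p a i : rho != 0 ->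
  act (dil rho p) (tw rho a) i = rho ^ i * act p a i.
Proof.
move=> h; elim/poly_ind: p i => [|p c IH] i.
  by rewrite /dil comp_poly0 !act0 mulr0.
rewrite dilXM !actD actZ !actC -!(mulrC 'X) !actXM IH /tw mulrDr.
rewrite mulrA -{1}[rho]expr1z -expfzDr //; have -> : 1 + (i - 1) = i by lia.
by rewrite (mulrCA c).
Qed.

Lemma star_dil rho d D : nc rho = 1 ->
  dil rho (star d (dil rho^-1 D)) = rho ^+ d *: star d D.
Proof.
move=> u; apply/polyP => i; rewrite coef_dil coefZ !coef_poly.
case: ltnP => hi; last by rewrite !mulr0.
rewrite coef_dil rmorphM rmorphXn /= unim_cj ?unim_inv // invrK mulrA -exprD.
by rewrite subnKC.
Qed.

(* What [star_corr] leaves in the limit, where e and eta are the coefficients of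
   P around the middle and at the low end, and P Q is a square W W^*. *)
Definition Pos Q (s : int) e eta := forall D d (l : int), (size D <= d.+1)%N ->
  2 * nc (act (Q * D * star d D) eta l) <=
  complex.Re (act (Q * D * star d D) e (s + d%:Z)).

(** Moves a test at [rho] to the point 1. Rotating [D] by [rho^-1] costs only unimodular factors;
    the scalar [rho ^ (- s)] makes them cancel at the index [s + d] where [e] is read, so that the
    real part is unchanged. *)
Lemma pos_twist Q s e eta rho : nc rho = 1 -> Pos Q s e eta ->
  Pos (rho ^ (- s) *: dil rho Q) s (tw rho e) (tw rho eta).
Proof.
move=> u hP D d l hD; have r0 := unim_neq0 u.
have E : rho ^ (- s) *: dil rho Q * D * star d D = rho ^ (- (s + d%:Z)) *:
    dil rho (Q * dil rho^-1 D * star d (dil rho^-1 D)).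
  rewrite !dilM dilK // star_dil // -scalerAr scalerA -!scalerAl.
  congr (_ *: _); rewrite opprD expfzDr // -exprnN -mulrA mulVf ?mulr1 //.
  by rewrite expf_neq0.
rewrite E !actZ !act_dil // !ncM !unim_expz // !mul1r mulrA -expfzDr //.
rewrite addNr expr0z mul1r; apply: hP.
exact: leq_trans (size_dil _ _) hD.
Qed.

Definition geo L : {poly C} := \sum_(i < L) 'X^i.

Lemma geo_mul L : (1 - 'X) * geo L = 1 - 'X^L.
Proof.
by rewrite -opprB mulNr -subrX1 opprB.
Qed.

Lemma coef_geo L i : (geo L)`_i = (i < L)%N%:R.
Proof.
rewrite coef_sum; case: ltnP => h.
  rewrite (bigD1 (Ordinal h)) //= coefXn eqxx big1 ?addr0 // => j /eqP hj.
  rewrite coefXn; case: eqP => // e; case: hj; exact: val_inj.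
rewrite big1 // => j _; rewrite coefXn; case: eqP => // e.
by have := ltn_ord j; rewrite -e ltnNge h.
Qed.

Lemma size_geo L : (size (geo L) <= L)%N.
Proof. by apply/leq_sizeP => j h; rewrite coef_geo ltnNge h. Qed.

Lemma star_geo L : star L (geo L.+1) = geo L.+1.
Proof.
apply/polyP => i; rewrite coef_poly !coef_geo; case: ltnP => // h.
by rewrite ltnS leq_subr rmorph1.
Qed.

Lemma act_geo L a i : act (geo L) a i = \sum_(r < L) a (i - r%:Z).
Proof. by rewrite act_sum; apply: eq_bigr => r _; rewrite actXn. Qed.

Lemma geo1 L : (geo L).[1] = L%:R.
Proof.
rewrite horner_sum (eq_bigr (fun=> 1)) ?sumr_const ?card_ord // => i _.
by rewrite hornerXn expr1n.
Qed.

(* An approximate inverse of 1 - z. *)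
Definition cesaro H : {poly C} := H.+1%:R^-1 *: \sum_(m < H.+1) geo m.+1.
Definition pmean H : {poly C} := H.+1%:R^-1 *: \sum_(m < H.+1) 'X^(m.+1).

Lemma natC_neq0 n : (n.+1%:R : C) != 0. Proof. by rewrite pnatr_eq0. Qed.

Lemma cesaro_mul H : (1 - 'X) * cesaro H = 1 - pmean H.
Proof.
rewrite /cesaro /pmean -scalerAr mulr_sumr; under eq_bigr do rewrite geo_mul.
rewrite sumrB sumr_const card_ord scalerBr; congr (_ - _).
by rewrite -(scaler_nat H.+1 (1 : {poly C})) scalerA mulVf ?scale1r ?natC_neq0.
Qed.

Lemma size_cesaro H : (size (cesaro H) <= H.+1)%N.
Proof.
apply: leq_trans (size_scale_leq _ _) _; apply: leq_trans (size_sum _ _ _) _.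
by apply/bigmax_leqP => i _; apply: leq_trans (size_geo _) _.
Qed.

Lemma star_pmean H : star H.+1 (pmean H) = H.+1%:R^-1 *: geo H.+1.
Proof.
rewrite starZ fmorphV rmorph_nat star_sum; congr (_ *: _).
rewrite /geo (reindex_inj rev_ord_inj) /=; apply: eq_bigr => i _.
by rewrite starXn ?subSS //; [congr 'X^_|]; have := ltn_ord i; lia.
Qed.

Lemma nrm1_pmean H : nrm1 (pmean H) <= 1.
Proof.
rewrite nrm1Z ncV nc_nat mulrC ler_pdivrMr ?ltr0n // mul1r.
apply: le_trans (nrm1_sum _ _ _) _; under eq_bigr do rewrite nrm1Xn.
by rewrite sumr_const card_ord.
Qed.

(** The sum telescopes against 1 - z: [pmean H] itself need not be small, but it is small on
    multiples of 1 - z. *)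
Lemma nrm1_pmean1 H : nrm1 ((1 - 'X) * pmean H) <= 2 / H.+1%:R.
Proof.
rewrite -scalerAr nrm1Z ncV nc_nat mulrC ler_pM2r ?invr_gt0 ?ltr0n //.
have -> : \sum_(m < H.+1) 'X^(m.+1) = 'X * geo H.+1.
  by rewrite mulr_sumr; apply: eq_bigr => m _; rewrite exprS.
rewrite mulrCA geo_mul nrm1XM; apply: le_trans (nrm1B _ _) _.
by rewrite nrm1_1 nrm1Xn.
Qed.

Lemma nrm1_star_pmean1 H : nrm1 ((1 - 'X) * star H.+1 (pmean H)) <= 2 / H.+1%:R.
Proof.
rewrite star_pmean -scalerAr nrm1Z ncV nc_nat mulrC ler_pM2r ?invr_gt0 ?ltr0n //.
rewrite geo_mul; apply: le_trans (nrm1B _ _) _.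
by rewrite nrm1_1 nrm1Xn.
Qed.

Lemma star_1mX : star 1 (1 - 'X) = 'X - 1 :> {poly C}.
Proof.
by rewrite starB -[X in star 1 X - _]/('X^0) -[X in _ - star 1 X]/('X^1) !starXn.
Qed.

Lemma size_1mX : (size (1 - 'X : {poly C})%R <= 2)%N.
Proof. by rewrite -opprB size_polyN -[1%R]/(1%:P) size_XsubC. Qed.

(** By [defectE] this is the factor (z - 1)(1 - z) to be removed times what a Cesaro mean in the
    test polynomial contributes; by [defectE2] it is z^(H+1) up to terms containing [pmean H] or its
    star. *)
Definition defect H : {poly C} := (1 - pmean H) * star H.+1 (1 - pmean H).

Lemma defectE H : defect H = (('X - 1) * (1 - 'X)) * (cesaro H * star H (cesaro H)).
Proof.
rewrite /defect -cesaro_mul -[H.+1]add1n starM ?size_1mX ?size_cesaro // star_1mX.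
by ring.
Qed.

Lemma defectE2 H : defect H = 'X^(H.+1) -
  (pmean H * 'X^(H.+1) + star H.+1 (pmean H) - pmean H * star H.+1 (pmean H)).
Proof.
by rewrite /defect starB -[X in _ * (star _ X - _)]/('X^0) starXn // subn0; ring.
Qed.

Lemma nrm1_defect H : nrm1 (defect H) <= 4.
Proof.
apply: le_trans (nrm1M _ _) _.
have h1 : nrm1 (1 - pmean H) <= 2.
  by apply: le_trans (nrm1B _ _) _; rewrite nrm1_1; have := nrm1_pmean H; lra.
have h2 : nrm1 (star H.+1 (1 - pmean H)) <= 2.
  rewrite nrm1_star // -cesaro_mul.
  by apply: leq_trans (size_polyMleq _ _) _; have := size_1mX;
     have := size_cesaro H; lia.
have := ler_pM (nrm1_ge0 _) (nrm1_ge0 _) h1 h2; lra.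
Qed.

(** On multiples of 1 - z each [defect H] acts as the shift by H + 1, up to O(1/H). In the constant
    of the induction step, 4 is the norm bound of [defect H], and 6 collects the three error terms
    of [defectE2], each at most [2 * nrm1 Z / H.+1]. *)
Lemma defect_conv j (Z : {poly C}) : exists c : R, forall H,
  nrm1 ((1 - 'X) * Z * defect H ^+ j - 'X^(H.+1 * j) * ((1 - 'X) * Z)) <= c / H.+1%:R.
Proof.
elim: j => [|j [c IH]].
  by exists 0 => H; rewrite muln0 !expr0 mulr1 mul1r subrr nrm1_0 mul0r.
exists (4 * c + 6 * nrm1 Z) => H.
set E := (1 - 'X) * Z * defect H ^+ j - 'X^(H.+1 * j) * ((1 - 'X) * Z).
have -> : (1 - 'X) * Z * defect H ^+ j.+1 - 'X^(H.+1 * j.+1) * ((1 - 'X) * Z) =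
    defect H * E - 'X^(H.+1 * j) * (Z * ((1 - 'X) * pmean H) * 'X^(H.+1) +
    Z * ((1 - 'X) * star H.+1 (pmean H)) -
    pmean H * (Z * ((1 - 'X) * star H.+1 (pmean H)))).
  transitivity (defect H * E + 'X^(H.+1 * j) * ((1 - 'X) * Z) * (defect H - 'X^(H.+1))).
    by rewrite /E mulnS exprD (exprS (defect H)); ring.
  by rewrite [defect H - _]addrC {2}defectE2 addKr; ring.
apply: le_trans (nrm1B _ _) _; rewrite nrm1XnM.
have h1 : nrm1 (defect H * E) <= 4 * (c / H.+1%:R).
  apply: le_trans (nrm1M _ _) _.
  exact: ler_pM (nrm1_ge0 _) (nrm1_ge0 _) (nrm1_defect _) (IH _).
have h2 : nrm1 (Z * ((1 - 'X) * pmean H) * 'X^(H.+1)) <= nrm1 Z * (2 / H.+1%:R).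
  rewrite mulrC nrm1XnM; apply: le_trans (nrm1M _ _) _.
  by rewrite ler_wpM2l ?nrm1_ge0 ?nrm1_pmean1.
have h3 : nrm1 (Z * ((1 - 'X) * star H.+1 (pmean H))) <= nrm1 Z * (2 / H.+1%:R).
  apply: le_trans (nrm1M _ _) _.
  by rewrite ler_wpM2l ?nrm1_ge0 ?nrm1_star_pmean1.
have h4 : nrm1 (pmean H * (Z * ((1 - 'X) * star H.+1 (pmean H)))) <=
    1 * (nrm1 Z * (2 / H.+1%:R)).
  apply: le_trans (nrm1M _ _) _.
  exact: ler_pM (nrm1_ge0 _) (nrm1_ge0 _) (nrm1_pmean _) h3.
have h5 (p1 p2 p3 : {poly C}) : nrm1 (p1 + p2 - p3) <= nrm1 p1 + nrm1 p2 + nrm1 p3.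
  by apply: le_trans (nrm1B _ _) _; rewrite lerD2r nrm1D.
apply: le_trans (lerD h1 (le_trans (h5 _ _ _) (lerD (lerD h2 h3) h4))) _.
by set t := _^-1; rewrite le_eqVlt; apply/orP; left; apply/eqP; ring.
Qed.

(* A factor ((z - 1)(1 - z))^j of Q, nonnegative on the circle up to a power
   of z, may be dropped: multiply D by the j-th power of a Cesaro mean h with
   (1 - z) h = 1 - u, where u is small against multiples of 1 - z. *)
Lemma pos_quot Q Q1 s e eta j D (Y : {poly C}) d (l : int) : Pos Q s e eta ->
  Q = Q1 * (('X - 1) * (1 - 'X)) ^+ j ->
  (forall i, nc (e i) <= 1) -> (forall i, nc (eta i) <= 1) ->
  (size D <= d.+1)%N -> Q1 * D = (1 - 'X) * Y ->
  2 * nc (act (Q1 * D * star d D) eta l) <=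
  complex.Re (act (Q1 * D * star d D) e (s - j%:Z + d%:Z)).
Proof.
move=> hP hQ be beta hD hY.
have [c hc] := defect_conv j (Y * star d D).
(* The error polynomial [E] costs twice its norm on the [eta] side and once on the [e] side. *)
apply: (@le_arch _ _ (3 * c)) => H; have {hc} := hc H.
rewrite mulrA -hY; set C1 := Q1 * D * star d D; set E := (X in nrm1 X) => hE.
have EE : Q * (D * cesaro H ^+ j) * star (d + H * j) (D * cesaro H ^+ j) =
    'X^(H.+1 * j) * C1 + E.
  have hs : (size (cesaro H ^+ j)%R <= (H * j).+1)%N.
    apply: leq_trans (size_poly_exp_leq _ _) _.
    by rewrite ltnS leq_mul2r; have := size_cesaro H; lia.
  transitivity (C1 * defect H ^+ j); last by rewrite /E; ring.
  rewrite starM // (starX (size_cesaro H)) // hQ defectE.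
  by rewrite /C1 !exprMn; ring.
clearbody E.
have hsz : (size (D * cesaro H ^+ j)%R <= (d + H * j).+1)%N.
  apply: leq_trans (size_polyMleq _ _) _.
  have hs : (size (cesaro H ^+ j)%R <= (H * j).+1)%N.
    apply: leq_trans (size_poly_exp_leq _ _) _.
    by rewrite ltnS leq_mul2r; have := size_cesaro H; lia.
  by lia.
(* The shift by [H.+1 * j] is undone on the low side. On the middle side the test polynomial
   supplies the degree [H * j] only, which is why [s] drops by [j]. *)
have := hP _ _ (l + (H.+1 * j)%:Z) hsz.
rewrite EE !actD !actXnM raddfD /=.
have -> : l + (H.+1 * j)%:Z - (H.+1 * j)%:Z = l by lia.
have -> : s + (d + H * j)%:Z - (H.+1 * j)%:Z = s - j%:Z + d%:Z by lia.
move: (l + (H.+1 * j)%:Z) (s + (d + H * j)%:Z) => l' i' h.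
have b1 := act_bound E l' beta.
have b2 := act_bound E i' be.
have b3 := Re_le (act E e i').
have b4 := ncDB (act C1 eta l) (act E eta l').
rewrite -mulrA; move: hE b1 b2; set t := c / _; lra.
Qed.

End Pos.

(** * Fejer means of bounded real sequences *)

Section Fejer.
Context {R : realType}.
Implicit Types (f : int -> R).

Lemma shift_sumR f (K : R) (t : int) (s : nat) Y : (forall i, `|f i| <= K) ->
  `|\sum_(n < Y) f (t + s%:Z + n%:Z) - \sum_(n < Y) f (t + n%:Z)| <= 2 * K * s%:R.
Proof.
move=> hf; elim: s => [|s IH].
  by rewrite mulr0; under eq_bigr do rewrite addr0; rewrite subrr normr0.
have E : \sum_(n < Y) f (t + s.+1%:Z + n%:Z) =
   \sum_(n < Y) f (t + s%:Z + n%:Z) + f (t + s%:Z + Y%:Z) - f (t + s%:Z).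
  have /= <- := @big_ord_recr _ 0 +%R Y (fun n => f (t + s%:Z + n%:Z)).
  rewrite big_ord_recl addr0 addrAC subrr add0r; apply: eq_bigr => i _.
  by congr f; rewrite lift0; lia.
rewrite E -natr1; have := hf (t + s%:Z + Y%:Z); have := hf (t + s%:Z).
rewrite !ler_norml => /andP[a1 a2] /andP[a3 a4].
by move: IH; rewrite !ler_norml => /andP[a5 a6]; apply/andP; split; lra.
Qed.

Lemma shift_sumZ f (K : R) (t : int) Y : (forall i, `|f i| <= K) ->
  `|\sum_(n < Y) f (n%:Z + t) - \sum_(n < Y) f n%:Z| <= 2 * K * `|t|%N%:R.
Proof.
move=> hf; case: (lerP 0 t) => ht.
  have := shift_sumR 0 `|t|%N Y hf.
  have -> : \sum_(n < Y) f (0 + `|t|%N%:Z + n%:Z) = \sum_(n < Y) f (n%:Z + t).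
    by apply: eq_bigr => i _; congr f; lia.
  by have -> : \sum_(n < Y) f (0 + n%:Z) = \sum_(n < Y) f n%:Z
    by apply: eq_bigr => i _; congr f; lia.
have := shift_sumR t `|t|%N Y hf; rewrite distrC.
have -> : \sum_(n < Y) f (t + `|t|%N%:Z + n%:Z) = \sum_(n < Y) f n%:Z.
  by apply: eq_bigr => i _; congr f; lia.
by have -> : \sum_(n < Y) f (t + n%:Z) = \sum_(n < Y) f (n%:Z + t)
  by apply: eq_bigr => i _; congr f; lia.
Qed.

(** Unnormalised Fejer mean at [i]: the value [f (i + d)] has weight L - |d|, with total weight
    L^2. *)
Definition fej f L (i : int) : R :=
  \sum_(r < L) \sum_(r' < L) f (i + r%:Z - r'%:Z).

Definition sym f Y : R := \sum_(n < Y) (f n%:Z + f (- n%:Z)).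

(** Enlarging the window adds the symmetric partial sum, in which [f 0] is counted twice. Thus a
    linear bound on [sym f] sums up to a quadratic bound on [fej f L 0]. *)
Lemma fej_rec f L : fej f L.+1 0 = fej f L 0 + sym f L.+1 - f 0.
Proof.
rewrite /fej big_ord_recr /=.
have -> : \sum_(r < L) \sum_(r' < L.+1) f (0 + r%:Z - r'%:Z) =
  \sum_(r < L) \sum_(r' < L) f (0 + r%:Z - r'%:Z) + \sum_(r < L) f (- r.+1%:Z).
  rewrite [X in _ = _ + X](reindex_inj rev_ord_inj) -big_split /=.
  apply: eq_bigr => r _; rewrite big_ord_recr /=; congr (_ + f _).
  by have := ltn_ord r; lia.
have -> : \sum_(r' < L.+1) f (0 + L%:Z - r'%:Z) = \sum_(n < L.+1) f n%:Z.
  rewrite (reindex_inj rev_ord_inj) /=; apply: eq_bigr => r _; congr f.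
  by have := ltn_ord r; lia.
rewrite /sym big_split /= [\sum_(n < L.+1) f (- n%:Z)]big_ord_recl /= oppr0.
have -> : \sum_(i < L) f (- (lift ord0 i)%:Z) = \sum_(r < L) f (- r.+1%:Z).
  by apply: eq_bigr => i _; rewrite lift0.
ring.
Qed.

Lemma fej_bound f K L i : (forall j, `|f j| <= K) -> `|fej f L i| <= K * L%:R ^+ 2.
Proof.
move=> hf; apply: le_trans (ler_norm_sum _ _ _) _.
apply: (@le_trans _ _ (\sum_(r < L) \sum_(r' < L) K)).
  apply: ler_sum => r _; apply: le_trans (ler_norm_sum _ _ _) _.
  by apply: ler_sum => r' _.
by rewrite !sumr_const card_ord -mulrnA -[_ *+ (_ * _)]mulr_natr natrM expr2.
Qed.

Lemma fej_opp f L i : fej f L (- i) = fej (fun j => f (- j)) L i.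
Proof.
rewrite /fej exchange_big; apply: eq_bigr => r _; apply: eq_bigr => r' _.
by congr f; lia.
Qed.

Lemma fej_sum f K L Y : (forall j, `|f j| <= K) ->
  `|\sum_(n < Y) fej f L n%:Z - L%:R ^+ 2 * \sum_(n < Y) f n%:Z| <=
  2 * K * L%:R * L%:R ^+ 2.
Proof.
move=> hf; have K0 : 0 <= K := le_trans (normr_ge0 _) (hf 0).
have -> : \sum_(n < Y) fej f L n%:Z - L%:R ^+ 2 * \sum_(n < Y) f n%:Z =
  \sum_(r < L) \sum_(r' < L) (\sum_(n < Y) f (n%:Z + (r%:Z - r'%:Z)) -
     \sum_(n < Y) f n%:Z).
  under [RHS]eq_bigr do rewrite sumrB sumr_const card_ord.
  rewrite sumrB sumr_const card_ord -mulrnA -[_ *+ (_ * _)]mulr_natl natrM -expr2.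
  congr (_ - _); rewrite exchange_big; apply: eq_bigr => r _.
  rewrite exchange_big; apply: eq_bigr => r' _; apply: eq_bigr => n _.
  by rewrite addrA.
apply: le_trans (ler_norm_sum _ _ _) _.
apply: (@le_trans _ _ (\sum_(r < L) \sum_(r' < L) (2 * K * L%:R))).
  apply: ler_sum => r _; apply: le_trans (ler_norm_sum _ _ _) _.
  apply: ler_sum => r' _; apply: le_trans (shift_sumZ _ _ hf) _.
  rewrite ler_wpM2l ?mulr_ge0 // ler_nat.
  by have := ltn_ord r; have := ltn_ord r'; lia.
by rewrite !sumr_const card_ord -mulrnA -[_ *+ (_ * _)]mulr_natr natrM expr2.
Qed.

(* The Fejer means at 0 are averages of the far ones, which are smaller by kappa:
   passing to a larger window decreases them by a fixed amount forever. *)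
Lemma fejer_absurd f (K kappa c1 : R) : (forall j, `|f j| <= K) -> 0 < kappa ->
  (forall L : nat, exists n0 : nat, forall n : nat, (n0 <= n)%N ->
    2 * (kappa * L%:R ^+ 2) - c1 * L%:R <=
    2 * fej f L 0 - fej f L n%:Z - fej f L (- n%:Z)) -> False.
Proof.
move=> hf kp hyp.
have K0 : 0 <= K := le_trans (normr_ge0 _) (hf 0).
have hfo j : `|f (- j)| <= K by [].
(* The hypothesis summed over [n < Y]. Indices below [n0] cost [M] each, and by [fej_sum] the sums
   of Fejer means are [L ^ 2] times sums of [f] up to a constant. *)
have stepA L : exists c : R, forall Y : nat, L%:R ^+ 2 * sym f Y <=
    Y%:R * (2 * fej f L 0 - (2 * (kappa * L%:R ^+ 2) - c1 * L%:R)) + c.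
  have [n0 hn0] := hyp L.
  set T := 2 * (kappa * _) - _ in hn0 *.
  set M := `|T| + 4 * (K * L%:R ^+ 2).
  have M0 : 0 <= M.
    by rewrite addr_ge0 // mulr_ge0 // mulr_ge0 // sqr_ge0.
  have hs (Y : nat) : Y%:R * T <=
     \sum_(n < Y) (2 * fej f L 0 - fej f L n%:Z - fej f L (- n%:Z)) + n0%:R * M.
    apply: (@le_trans _ _ (\sum_(n < Y) (2 * fej f L 0 - fej f L n%:Z -
        fej f L (- n%:Z)) + (minn Y n0)%:R * M)); last first.
      by rewrite lerD2l ler_wpM2r // ler_nat geq_minr.
    elim: Y => [|Y IH]; first by rewrite big_ord0 min0n !mul0r add0r.
    rewrite big_ord_recr /= -[Y.+1%:R]natr1 [(_ + 1) * T]mulrDl mul1r.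
    case: (leqP n0 Y) => hY.
      have -> : minn Y.+1 n0 = minn Y n0 by lia.
      have := hn0 _ hY; lra.
    have -> : minn Y.+1 n0 = (minn Y n0).+1 by lia.
    have := fej_bound L 0 hf; have := fej_bound L Y%:Z hf.
    have := fej_bound L (- Y%:Z) hf; rewrite !ler_norml => /andP[a1 a2].
    move=> /andP[a3 a4] /andP[a5 a6]; have := ler_norm T.
    have hM : `|T| + 4 * (K * L%:R ^+ 2) <= M by [].
    rewrite -[(minn Y n0).+1%:R]natr1 [(_ + 1) * M]mulrDl mul1r.
    by clearbody M; lra.
  exists (n0%:R * M + 4 * K * L%:R * L%:R ^+ 2) => Y.
  have := hs Y; have := fej_sum L Y hf; have := fej_sum L Y hfo.
  rewrite !sumrB sumr_const card_ord -mulr_natl /sym big_split /=.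
  rewrite (eq_bigr (fun n : 'I_Y => fej f L (- n%:Z))); last first.
    by move=> n _; rewrite fej_opp.
  rewrite !ler_norml => /andP[a1 a2] /andP[a3 a4]; lra.
(* From [L0] on, [c1 * L] uses up at most half of the gain [2 * kappa * L ^ 2]. *)
set L0 := (Num.bound (`|c1| / kappa)).+1.
have hL0 L : (L0 <= L)%N -> c1 * L%:R <= kappa * L%:R ^+ 2.
  move=> hL; rewrite expr2 mulrA ler_wpM2r //.
  have := archi_boundP (divr_ge0 (normr_ge0 c1) (ltW kp)) => h.
  have h2 : `|c1| / kappa <= L%:R.
    by rewrite (le_trans (ltW h)) // ler_nat; apply: leq_trans hL.
  move: h2; rewrite ler_pdivrMr // mulrC; have := ler_norm c1; lra.
have stepB L : (L0 <= L)%N -> exists c : R, forall Y : nat,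
    sym f Y <= Y%:R * (2 * (fej f L 0 / L%:R ^+ 2) - kappa) + c.
  move=> hL; have [c hc] := stepA L.
  have L2 : 0 < L%:R ^+ 2 :> R.
    by rewrite exprn_gt0 // ltr0n; apply: leq_trans hL.
  exists (c / L%:R ^+ 2) => Y; rewrite -(ler_pM2l L2).
  have -> : L%:R ^+ 2 * (Y%:R * (2 * (fej f L 0 / L%:R ^+ 2) - kappa) +
      c / L%:R ^+ 2) = Y%:R * (2 * fej f L 0 - kappa * L%:R ^+ 2) + c.
    by field; rewrite -sqrf_eq0 lt0r_neq0.
  apply: le_trans (hc Y) _; rewrite lerD2r ler_wpM2l //.
  by have := hL0 _ hL; lra.
(* With [phi] the normalised mean at 0, [stepB] bounds [sym f] with slope [2 * phi - kappa], and
   summing [fej_rec] gives [fej f L' 0] the leading coefficient [phi - kappa / 2]. A large [L']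
   absorbs the linear terms in half of this gain. *)
have stepC L : (L0 <= L)%N -> exists2 L', (L0 <= L')%N &
    fej f L' 0 / L'%:R ^+ 2 <= fej f L 0 / L%:R ^+ 2 - kappa / 4.
  move=> hL; have [c hc] := stepB L hL.
  set phi := _ / _ in hc *; set m := 2 * phi - kappa in hc.
  have hF L' : fej f L' 0 <= L'%:R * (m * (L'%:R + 1) / 2 + `|c| + K).
    elim: L' => [|L' IH]; first by rewrite mul0r /fej big_ord0.
    rewrite fej_rec; have := hc L'.+1; have := ler_norm c.
    have := hf 0; rewrite ler_norml => /andP[a1 a2].
    by rewrite -[L'.+1%:R]natr1; lra.
  set c3 := `|m| / 2 + `|c| + K.
  have c30 : 0 <= c3 by rewrite !addr_ge0 // divr_ge0.
  set L' := maxn L0 (Num.bound (c3 / (kappa / 4))).+1.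
  have L'0 : 0 < L'%:R :> R by rewrite ltr0n /L' leq_max ltn0Sn.
  exists L'; first exact: leq_maxl.
  rewrite ler_pdivrMr ?exprn_gt0 //; apply: le_trans (hF L') _.
  rewrite expr2 mulrA mulrC ler_wpM2r //.
  have h4 : 0 < kappa / 4 by lra.
  have := archi_boundP (divr_ge0 c30 (ltW h4)) => h.
  have : c3 / (kappa / 4) <= L'%:R.
    by rewrite (le_trans (ltW h)) // ler_nat /L' leq_max leqnSn orbT.
  rewrite ler_pdivrMr // /c3 => h2; have := ler_norm m.
  have hm : phi * L'%:R = (m + kappa) / 2 * L'%:R by rewrite /m; field.
  by rewrite [(phi - _) * _]mulrBl hm; clearbody m; lra.
have iter m : exists2 L, (L0 <= L)%N & fej f L 0 / L%:R ^+ 2 <= K - m%:R * (kappa / 4).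
  elim: m => [|m [L hL IH]].
    exists L0 => //; rewrite mul0r subr0 ler_pdivrMr ?exprn_gt0 ?ltr0n //.
    by have := fej_bound L0 0 hf; rewrite ler_norml => /andP[].
  have [L' hL' h] := stepC L hL; exists L' => //.
  by apply: le_trans h _; rewrite -[m.+1%:R]natr1; lra.
have h4 : 0 < kappa / 4 by lra.
have K20 : 0 <= 2 * K by lra.
have := archi_boundP (divr_ge0 K20 (ltW h4)); set m := Num.bound _.
rewrite ltr_pdivrMr // => hm; have [L hL] := iter m.+1.
have L2 : 0 < L%:R ^+ 2 :> R by rewrite exprn_gt0 // ltr0n; apply: leq_trans hL.
rewrite ler_pdivrMr // => h5.
have := fej_bound L 0 hf; rewrite ler_norml => /andP[h6 _].
have : (- K) * L%:R ^+ 2 <= (K - m.+1%:R * (kappa / 4)) * L%:R ^+ 2.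
  by rewrite mulNr; apply: le_trans h6 h5.
by rewrite ler_pM2r // -[m.+1%:R]natr1; lra.
Qed.

End Fejer.

(** * Means of eta and the two halves of e *)

Section Key.
Context {R : realType}.
Local Notation C := R[i].
Implicit Types (p q Q D : {poly C}) (a b e eta : int -> C) (rho : C).

(** [p - p(1)] is divisible by z - 1, so the difference telescopes to two boundary terms, bounded
    uniformly in the sequence, the starting point and the length. *)
Lemma sum_act p : exists2 c : R, 0 <= c & forall a, (forall i, nc (a i) <= 1) ->
  forall (t : int) L, nc (\sum_(i < L) act p a (t + i%:Z) -
    p.[1] * \sum_(i < L) a (t + i%:Z)) <= c.
Proof.
have /factor_theorem[r hr] : root (p - p.[1]%:P) 1.
  by rewrite /root hornerD hornerN hornerC subrr.
exists (2 * nrm1 r) => [|a ha t L]; first by rewrite mulr_ge0 ?nrm1_ge0.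
have E i : act p a i - p.[1] * a i = act r a (i - 1) - act r a i.
  by rewrite -actC -actB hr mulrBr actB mulr1 mulrC actXM.
rewrite mulr_sumr -sumrB; under eq_bigr do rewrite E.
have -> : \sum_(i < L) (act r a (t + i%:Z - 1) - act r a (t + i%:Z)) =
    act r a (t - 1) - act r a (t + L%:Z - 1).
  elim: L => [|L IH]; first by rewrite big_ord0 addr0 subrr.
  rewrite big_ord_recr IH /= addrA subrK; congr (_ - act _ _ _); lia.
have := ncB (act r a (t - 1)) (act r a (t + L%:Z - 1)).
have := act_bound r (t - 1) ha; have := act_bound r (t + L%:Z - 1) ha; lra.
Qed.

Lemma sum_shift (t : int) : exists2 c : R, 0 <= c & forall a,
  (forall i, nc (a i) <= 1) -> forall L,
  nc (\sum_(i < L) a (t + i%:Z) - \sum_(i < L) a i%:Z) <= c.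
Proof.
have [c c0 hc] := sum_act 'X^`|t|%N; exists c => // a ha L.
case: (lerP 0 t) => ht.
  have := hc a ha t L; rewrite hornerXn expr1n mul1r ncBC.
  by have -> : \sum_(i < L) act 'X^`|t|%N a (t + i%:Z) = \sum_(i < L) a i%:Z
    by apply: eq_bigr => i _; rewrite actXn; congr a; lia.
have := hc a ha 0 L; rewrite hornerXn expr1n mul1r.
have -> : \sum_(i < L) act 'X^`|t|%N a (0 + i%:Z) = \sum_(i < L) a (t + i%:Z).
  by apply: eq_bigr => i _; rewrite actXn; congr a; lia.
by have -> : \sum_(i < L) a (0 + i%:Z) = \sum_(i < L) a i%:Z
  by apply: eq_bigr => i _; congr a; lia.
Qed.

Lemma act_near p a (beta : C) (B : R) (i0 : int) :
  (forall i, i0 <= i -> nc (a i - beta) <= B) ->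
  forall i, i0 + (size p)%:Z <= i -> nc (act p a i - p.[1] * beta) <= nrm1 p * B.
Proof.
move=> h i hi; rewrite horner_coef mulr_suml -sumrB.
apply: le_trans (nc_sum _ _ _) _; rewrite /nrm1 mulr_suml.
apply: ler_sum => j _; rewrite expr1n mulr1 -mulrBr ncM ler_wpM2l ?nc_ge0 //.
by apply: h; have := ltn_ord j; lia.
Qed.

Lemma nrm1_geo L : nrm1 (geo L : {poly C}) = L%:R.
Proof.
rewrite (nrm1_widen (size_geo L)) (eq_bigr (fun=> 1)) ?sumr_const ?card_ord //.
by move=> i _; rewrite coef_geo ltn_ord nc1.
Qed.

Lemma act_geo_rev L a (i : int) :
  act (geo L) a i = \sum_(r < L) a (i + 1 - L%:Z + r%:Z).
Proof.
rewrite act_geo (reindex_inj rev_ord_inj); apply: eq_bigr => r _ /=.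
by congr a; have := ltn_ord r; lia.
Qed.

(** Error bookkeeping for [halves_odd_mult]: [q] is [Q2(1)], [T] and [B] are the sums of [eta] and
    of [Q2 eta], [A1] and [A2] the sums of [Q2 e] over two blocks, [S1'] and [S2'] those of [e], and
    [S1], [S2] the latter after a bounded shift. *)
Lemma peak_combine (q alpha B A1 A2 T S1 S2 S1' S2' : C) (L : nat) (c0 c1 c2 : R) :
  q != 0 -> nc (T - L%:R * alpha) <= c0 -> nc (B - q * T) <= c1 ->
  nc (A1 - q * S1') <= c1 -> nc (A2 - q * S2') <= c1 ->
  nc (S1' - S1) <= c2 -> nc (S2' - S2) <= c2 ->
  2 * nc B <= complex.Re (A1 - A2) ->
  2 * L%:R * nc alpha - (2 * nc q * c0 + 2 * c1 + 2 * c1 + 2 * nc q * c2) / nc q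
  <= nc (S1 - S2).
Proof.
move=> q0 hT hB h1 h2 h3 h4 h; have kp : 0 < nc q by rewrite nc_gt0.
rewrite -(ler_pM2l kp) mulrBr [nc q * (_ / _)]mulrC divfK ?lt0r_neq0 // -ncM.
have hA := le_trans h (Re_le _).
have EA : A1 - A2 = q * (S1 - S2) + ((A1 - q * S1') - (A2 - q * S2')
   + (q * (S1' - S1) - q * (S2' - S2))) by ring.
have EB : B = (B - q * T) + (q * (T - L%:R * alpha) + L%:R * (q * alpha)) by ring.
have := ncDB (L%:R * (q * alpha)) ((B - q * T) + q * (T - L%:R * alpha)).
have -> : L%:R * (q * alpha) + ((B - q * T) + q * (T - L%:R * alpha)) = B by ring.
have := ncD (B - q * T) (q * (T - L%:R * alpha)).
have := ncD (q * (S1 - S2)) ((A1 - q * S1') - (A2 - q * S2')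
   + (q * (S1' - S1) - q * (S2' - S2))).
rewrite -EA.
have := ncD ((A1 - q * S1') - (A2 - q * S2')) (q * (S1' - S1) - q * (S2' - S2)).
have := ncB (A1 - q * S1') (A2 - q * S2').
have := ncB (q * (S1' - S1)) (q * (S2' - S2)).
have := ler_wpM2l (ltW kp) h3; have := ler_wpM2l (ltW kp) h4.
have := ler_wpM2l (ltW kp) hT.
rewrite -!ncM; have -> : nc (L%:R * (q * alpha)) = nc q * (L%:R * nc alpha).
  by rewrite !ncM nc_nat mulrCA.
lra.
Qed.

Section Abstract.
Variables (Q : {poly C}) (s : int) (e eta : int -> C) (alpha : C).
Hypothesis hP : Pos Q s e eta.
Hypothesis Q0 : Q != 0.
Hypothesis be : forall i, nc (e i) <= 1.
Hypothesis beta : forall i, nc (eta i) <= 1.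
Hypothesis eta_neg : forall i, i < 0 -> eta i = 0.
Variable c0 : R.
Hypothesis hT : forall L : nat, nc (\sum_(i < L) eta i%:Z - L%:R * alpha) <= c0.

(** For [D = geo L.+1] the remaining factor gives (1 - z) geo^2 = (1 - z^(L+1)) geo: two adjacent
    blocks of [e] are subtracted, while the low side sees a partial sum of [eta]. *)
Lemma halves_odd_mult j Q2 : Q = Q2 * (1 - 'X) * (('X - 1) * (1 - 'X)) ^+ j ->
  Q2.[1] != 0 -> exists2 c : R, 0 <= c & forall L : nat, 2 * L%:R * nc alpha - c <=
    nc (\sum_(n < L) e n%:Z - \sum_(n < L) e (- n.+1%:Z)).
Proof.
move=> hQ h1'; set kap := nc Q2.[1]; have kap0 : 0 < kap by rewrite nc_gt0.
have [c1 c10 hc1] := sum_act Q2.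
have [c2 c20 hc2] := sum_shift (s - j%:Z).
have c00 : 0 <= c0 := le_trans (nc_ge0 _) (hT 0).
set cc := 2 * kap * c0 + 2 * c1 + 2 * c1 + 2 * kap * c2.
have cc0 : 0 <= cc.
  by rewrite /cc !addr_ge0 // !mulr_ge0 // ltW.
exists (cc / kap) => [|[|L]]; first by rewrite divr_ge0 // ltW.
  by rewrite !big_ord0 subrr nc0 mulr0 mul0r sub0r oppr_le0 divr_ge0 // ltW.
have hD : (size (geo L.+1 : {poly C}) <= L.+1)%N := size_geo _.
have hY : Q2 * (1 - 'X) * geo L.+1 = (1 - 'X) * (Q2 * geo L.+1) by ring.
have := pos_quot L%:Z hP hQ be beta hD hY.
rewrite star_geo; have -> : Q2 * (1 - 'X) * geo L.+1 * geo L.+1 =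
    (1 - 'X^(L.+1)) * (geo L.+1 * Q2) by rewrite -geo_mul; ring.
rewrite !mulrBl !mul1r !actB !actXnM !(actM (geo _)) !act_geo_rev.
(* At index [L] the copy shifted by [L.+1] meets only negative indices, where [eta] is 0. *)
rewrite [X in nc (_ - X)]big1; last first.
  move=> r _; rewrite /act big1 // => k _; rewrite eta_neg ?mulr0 //.
  by have := ltn_ord r; lia.
rewrite subr0.
have -> : \sum_(r < L.+1) act Q2 eta (L%:Z + 1 - L.+1%:Z + r%:Z) =
    \sum_(r < L.+1) act Q2 eta (0 + r%:Z).
  by apply: eq_bigr => r _; congr act; lia.
have -> : \sum_(r < L.+1) act Q2 e (s - j%:Z + L%:Z + 1 - L.+1%:Z + r%:Z) =
    \sum_(r < L.+1) act Q2 e (s - j%:Z + r%:Z).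
  by apply: eq_bigr => r _; congr act; lia.
have -> : \sum_(r < L.+1) act Q2 e (s - j%:Z + L%:Z - L.+1%:Z + 1 - L.+1%:Z + r%:Z) =
    \sum_(r < L.+1) act Q2 (fun i => e (i - L.+1%:Z)) (s - j%:Z + r%:Z).
  by apply: eq_bigr => r _; rewrite act_shift; congr act; lia.
move: (hc1 eta beta 0 L.+1) (hT L.+1).
have -> : \sum_(i < L.+1) eta (0 + i%:Z) = \sum_(i < L.+1) eta i%:Z.
  by apply: eq_bigr => r _; rewrite add0r.
have be' i : nc (e (i - L.+1%:Z)) <= 1 by [].
move: (hc1 e be (s - j%:Z) L.+1) (hc1 _ be' (s - j%:Z) L.+1).
move: (hc2 e be L.+1) (hc2 _ be' L.+1).
have -> : \sum_(i < L.+1) e (i%:Z - L.+1%:Z) = \sum_(n < L.+1) e (- n.+1%:Z).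
  rewrite (reindex_inj rev_ord_inj) /=; apply: eq_bigr => r _; congr e.
  by have := ltn_ord r; lia.
move=> h4 h3 h2 h1 hB hT' h; exact: peak_combine h1' hT' hB h2 h1 h4 h3 h.
Qed.

(** The factor 1 - z^n times its star is 2 z^n - 1 - z^(2n), so the middle side is a second
    difference of Fejer means of Re(Q1 e). On the low side only the term -1 survives, and it is
    close to Q1(1) alpha L^2 in modulus. *)
Lemma mean0_even_mult j Q1 : Q = Q1 * (('X - 1) * (1 - 'X)) ^+ j ->
  Q1.[1] != 0 -> alpha = 0.
Proof.
move=> hQ h1; apply/eqP; apply: contraTT isT => alpha0.
pose f (i : int) : R := complex.Re (act Q1 e (s - j%:Z + i)).
have hf i : `|f i| <= nrm1 Q1.
  have := act_bound Q1 (s - j%:Z + i) be; rewrite mulr1 ler_norml => h.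
  have := Re_le (act Q1 e (s - j%:Z + i)).
  by have := nReLe (act Q1 e (s - j%:Z + i)); rewrite /f; lra.
have kp : 0 < nc (Q1.[1] * alpha) by rewrite nc_gt0 mulf_neq0.
case: (@fejer_absurd _ f (nrm1 Q1) _ (4 * nrm1 Q1 * c0) hf kp) => -[|L'].
  by exists 0%N => n _; rewrite /fej !big_ord0 expr0n /=; lra.
(* [l] lies beyond the support of [Q1 * geo L * geo L], so that the low side has reached its
   limiting size; [n > l] pushes the two shifted copies of [eta] past [l]. *)
set L := L'.+1; pose l := (2 * L + size Q1)%N; exists l.+1 => n hn.
have near0 (i : int) : L'%:Z <= i -> nc (act (geo L) eta i - L%:R * alpha) <= 2 * c0.
  move=> hi; have [m hm] : exists m : nat, i = (L' + m)%:Z by exists (`|i|%N - L')%N; lia.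
  have -> : act (geo L) eta i =
     \sum_(r < L + m) eta r%:Z - \sum_(r < m) eta r%:Z.
    rewrite act_geo_rev (addnC L m) big_split_ord /= [RHS]addrAC subrr add0r.
    by apply: eq_bigr => r _; congr eta; rewrite /= /L; lia.
  have -> : \sum_(r < L + m) eta r%:Z - \sum_(r < m) eta r%:Z - L%:R * alpha =
    (\sum_(r < L + m) eta r%:Z - (L + m)%:R * alpha) -
    (\sum_(r < m) eta r%:Z - m%:R * alpha) by rewrite natrD; ring.
  apply: le_trans (ncB _ _) _.
  by have := hT (L + m); have := hT m; lra.
have near1 (i : int) : L'%:Z + (size (geo L : {poly C}))%:Z <= i ->
    nc (act (geo L) (act (geo L) eta) i - L%:R * (L%:R * alpha)) <= L%:R * (2 * c0).
  by move=> hi; have := act_near near0 hi; rewrite geo1 nrm1_geo.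
have := size_geo L => /(_ R) sL.
have near2 : nc (act Q1 (act (geo L) (act (geo L) eta)) l%:Z -
    Q1.[1] * (L%:R * (L%:R * alpha))) <= nrm1 Q1 * (L%:R * (2 * c0)).
  by apply: act_near near1 _ _; rewrite /l /L in sL *; lia.
have hD : (size ((geo L : {poly C}) * (1 - 'X^n))%R <= (L' + n).+1)%N.
  have : (size (1 - 'X^n : {poly C})%R <= n.+1)%N.
    apply: leq_trans (size_polyD _ _) _; rewrite size_polyN size_polyXn.
    by rewrite geq_max leqnn andbT; apply: leq_trans (size_polyC_leq1 _) _.
  by have := size_polyMleq (geo L : {poly C}) (1 - 'X^n); rewrite /L in sL *; lia.
have hY : Q1 * ((geo L : {poly C}) * (1 - 'X^n)) = (1 - 'X) * (Q1 * geo L * geo n).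
  by rewrite -geo_mul; ring.
have := pos_quot l%:Z hP hQ be beta hD hY.
have -> : Q1 * ((geo L : {poly C}) * (1 - 'X^n)) *
    star (L' + n) ((geo L : {poly C}) * (1 - 'X^n)) =
   'X^n * (2%:P * (Q1 * (geo L * geo L))) - Q1 * (geo L * geo L)
    - 'X^(n + n) * (Q1 * (geo L * geo L)).
  rewrite starM //; last first.
    apply: leq_trans (size_polyD _ _) _; rewrite size_polyN size_polyXn.
    by rewrite geq_max leqnn andbT; apply: leq_trans (size_polyC_leq1 _) _.
  rewrite star_geo starB -[X in star n X - _]/('X^0) !starXn // subnn subn0.
  by rewrite expr0 exprD -[2%:P]/((1 + 1)%:P) polyCD; ring.
rewrite !actB !actXnM !mul_polyC !actZ.
have neg_act (p : {poly C}) (i : int) : i < 0 -> act p eta i = 0.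
  by move=> hi; rewrite /act big1 // => k _; rewrite eta_neg ?mulr0 //; lia.
rewrite !(neg_act _ (l%:Z - _)); try lia.
rewrite mulr0 add0r subr0 ncN !raddfB /=.
have fejE (t : int) : complex.Re (act (Q1 * (geo L * geo L)) e (s - j%:Z + L'%:Z + t)) =
    fej f L t.
  rewrite mulrC -mulrA actM act_geo raddf_sum (reindex_inj rev_ord_inj) /=.
  apply: eq_bigr => r _; rewrite actM act_geo raddf_sum /=.
  apply: eq_bigr => r' _; rewrite /f; congr (complex.Re (act _ _ _)).
  by have := ltn_ord r; rewrite /L; lia.
have := fejE 0; have := fejE n%:Z; have := fejE (- n%:Z).
have -> : s - j%:Z + (L' + n)%:Z - n%:Z = s - j%:Z + L'%:Z + 0 by lia.
have -> : s - j%:Z + (L' + n)%:Z = s - j%:Z + L'%:Z + n%:Z by lia.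
have -> : s - j%:Z + L'%:Z + n%:Z - (n + n)%:Z = s - j%:Z + L'%:Z - n%:Z by lia.
move=> <- <- <-.
have near2' : nc (act (Q1 * (geo L * geo L)) eta l%:Z -
    Q1.[1] * (L%:R * (L%:R * alpha))) <= nrm1 Q1 * (L%:R * (2 * c0)).
  move: near2; rewrite -!actM; congr (nc (act _ _ _ - _) <= _); ring.
have := ncBB (Q1.[1] * (L%:R * (L%:R * alpha))) (act (Q1 * (geo L * geo L)) eta l%:Z).
rewrite ncBC => h2 h3.
have E2 (z : C) : complex.Re (2 * z) = 2 * complex.Re z by case: z => x y /=; ring.
rewrite E2 in h3.
have E : nc (Q1.[1] * (L%:R * (L%:R * alpha))) = nc (Q1.[1] * alpha) * L%:R ^+ 2.
  by rewrite !ncM nc_nat expr2; ring.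
rewrite E in h2; lra.
Qed.

(* The factors 1 - z of Q are dropped in pairs by [pos_quot]. If one is left, test
   with D = geo L; if none is left, testing with geo L (1 - z^n) for large n
   contradicts [fejer_absurd] unless alpha = 0. *)
Lemma halves_at_1 : exists2 c : R, 0 <= c & forall L : nat, 2 * L%:R * nc alpha - c <=
  nc (\sum_(n < L) e n%:Z - \sum_(n < L) e (- n.+1%:Z)).
Proof.
have [m [Q' hQ' hQ]] := multiplicity_XsubC Q 1.
rewrite Q0 /= /root in hQ'.
have E : ('X - 1%:P : {poly C}) ^+ m = (- (1 - 'X)) ^+ odd m *
    ((-1) ^+ m./2 * (('X - 1) * (1 - 'X)) ^+ m./2).
  rewrite -{1}(odd_double_half m) exprD -muln2 mulnC exprM -exprMn.
  by congr (_ ^+ _ * _ ^+ _); rewrite -[1%:P]/(1 : {poly C}); ring.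
rewrite E in hQ.
have hs (q : {poly C}) k : q.[1] != 0 -> (q * (-1) ^+ k).[1] != 0.
  by move=> h; rewrite hornerM horner_exp hornerN hornerC mulf_neq0 ?signr_eq0.
case: (odd m) hQ => hQ.
  apply: (@halves_odd_mult m./2 (- (Q' * (-1) ^+ m./2))).
    by rewrite hQ expr1; ring.
  by rewrite hornerN oppr_eq0 hs.
have -> : alpha = 0.
  apply: (@mean0_even_mult m./2 (Q' * (-1) ^+ m./2)); last exact: hs.
  by rewrite hQ expr0; ring.
by exists 0 => // L; rewrite nc0 mulr0 subr0 nc_ge0.
Qed.

End Abstract.
End Key.

(** * Roots of unity, Parseval, averages and extremal walks *)

Section Fourier.
Context {R : realType}.
Local Notation C := R[i].
Implicit Types (p q Q D : {poly C}) (a b e eta : int -> C) (rho : C).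

Lemma prim_root_complex n : (n > 0)%N -> exists z : C, n.-primitive_root z.
Proof.
move=> n0; have [r Dr] := closed_field_poly_normal ('X^n - 1 : {poly C}).
rewrite (monicP _) ?monicXnsubC // scale1r in Dr.
have rn1 : all n.-unity_root r by apply/allP => z; rewrite -root_prod_XsubC -Dr.
have sr : (n < (size r).+1)%N by rewrite -(size_prod_XsubC r id) -Dr size_XnsubC.
have ur : uniq r.
  by rewrite -separable_prod_XsubC -Dr separable_Xn_sub_1 // pnatr_eq0 -lt0n.
by have /hasP[z] := has_prim_root n0 rn1 ur sr; exists z.
Qed.

Lemma unity_unim n (z : C) : (n > 0)%N -> z ^+ n = 1 -> nc z = 1.
Proof.
move=> n0 h; have := ncX z n; rewrite h nc1 => /esym/eqP.
by rewrite pexpr_eq1 ?nc_ge0 // => /eqP.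
Qed.

(** Sampling at the H-th roots of unity is exact because the degree is below H. The rotation [theta]
    is there for inequalities that hold only off finitely many points. *)
Lemma parseval H (omega theta : C) p : H.-primitive_root omega -> nc theta = 1 ->
  (size p <= H)%N ->
  \sum_(r < H) nc p.[theta * omega ^+ r] ^+ 2 = H%:R * \sum_(i < H) nc p`_i ^+ 2.
Proof.
move=> hom uth hp; have H0 := prim_order_gt0 hom.
have uom : nc omega = 1 := unity_unim H0 (prim_expr_order hom).
have om0 := unim_neq0 uom; have th0 := unim_neq0 uth.
apply/complexI; rewrite rmorphM !rmorph_sum rmorph_nat mulr_sumr /=.
under eq_bigr => r _ do rewrite -mulcj (horner_coef_wide _ hp) rmorph_sum mulr_suml.
rewrite exchange_big; apply: eq_bigr => i _ /=.
under eq_bigr => r _ do rewrite mulr_sumr.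
rewrite exchange_big (bigD1 i) //= [X in _ + X]big1 ?addr0 => [|j ji].
  under eq_bigr => r _ do rewrite /= mulcj ncM ncX ncM uth (unim_exp r uom) mulr1 expr1n mulr1.
  by rewrite sumr_const card_ord mulr_natl.
pose z := omega ^+ i / omega ^+ j.
have E r : p`_i * (theta * omega ^+ r) ^+ i * cj (p`_j * (theta * omega ^+ r) ^+ j) =
    p`_i * theta ^+ i * cj (p`_j * theta ^+ j) * z ^+ r.
  have -> : z ^+ r = (omega ^+ r) ^+ i * ((omega ^+ r) ^+ j)^-1.
    by rewrite /z expr_div_n -!exprM !(mulnC r).
  by rewrite !exprMn !rmorphM !rmorphXn /= (unim_cj uom) -!exprVn; ring.
under eq_bigr => r _ do rewrite E.
rewrite -mulr_sumr; have z1 : z != 1.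
  apply: contra ji => /eqP h; apply/eqP/val_inj/eqP => /=.
  have : omega ^+ i == omega ^+ j.
    by apply/eqP; rewrite -[LHS](divfK (expf_neq0 j om0)) -/z h mul1r.
  by rewrite (eq_prim_root_expr hom) !modn_small // eq_sym.
have zH : z ^+ H = 1.
  by rewrite /z expr_div_n -!exprM !(mulnC _ H) !exprM (prim_expr_order hom) !expr1n invr1 mulr1.
have : (z - 1) * \sum_(r < H) z ^+ r = 0 by rewrite -subrX1 zH subrr.
by move=> /eqP; rewrite mulf_eq0 subr_eq0 (negPf z1) => /eqP ->; rewrite mulr0.
Qed.

Lemma halves_at_unimodular Q (s : int) e eta rho (alpha : C) (c0 : R) : Pos Q s e eta -> Q != 0 ->
  (forall i, nc (e i) <= 1) -> (forall i, nc (eta i) <= 1) ->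
  (forall i, i < 0 -> eta i = 0) -> nc rho = 1 ->
  (forall L : nat, nc (\sum_(i < L) tw rho eta i%:Z - L%:R * alpha) <= c0) ->
  exists2 c : R, 0 <= c & forall L : nat, 2 * L%:R * nc alpha - c <=
  nc (\sum_(n < L) tw rho e n%:Z - \sum_(n < L) tw rho e (- n.+1%:Z)).
Proof.
move=> hP Q0 be beta hneg u hT.
apply: (halves_at_1 (pos_twist u hP) _ _ _ _ hT) => [|i|i|i hi].
- have r0 := unim_neq0 u; rewrite scaler_eq0 negb_or expfz_neq0 //=.
  apply: contra Q0 => /eqP h; apply/eqP; rewrite -(dilK Q (invr_neq0 r0)) invrK h.
  by rewrite /dil comp_poly0.
- by rewrite ncM unim_expz // mul1r.
- by rewrite ncM unim_expz // mul1r.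
by rewrite /tw hneg ?mulr0.
Qed.

(** The discrepancy of the partial sums is itself X-periodic from [a] on, hence bounded by its
    values up to [a + X]. *)
Lemma periodic_avg (b : nat -> C) (X a : nat) : (X > 0)%N -> (forall i, nc (b i) <= 1) ->
  (forall n, (a <= n)%N -> b (n + X)%N = b n) ->
  exists c : R, forall L : nat,
    nc (\sum_(i < L) b i - L%:R * (X%:R^-1 * \sum_(i < X) b (a + i)%N)) <= c.
Proof.
move=> X0 hb per; set al := _ * _.
have sX m : (a <= m)%N -> \sum_(i < X) b (m + i)%N = \sum_(i < X) b (a + i)%N.
  elim: m => [|m IH]; first by rewrite leqn0 => /eqP ->.
  rewrite leq_eqVlt => /orP[/eqP -> //|]; rewrite ltnS => hm; rewrite -IH //.
  have X1 : X = X.-1.+1 by rewrite prednK.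
  rewrite [in LHS]X1 [in RHS]X1 big_ord_recr big_ord_recl /= addrC; congr (_ + _).
    by rewrite addn0 -[RHS]per //; congr b; rewrite /=; lia.
  by apply: eq_bigr => i _; congr b; rewrite /= /bump ?leq0n; lia.
have XC : X%:R != 0 :> C by rewrite pnatr_eq0 -lt0n.
pose g L := \sum_(i < L) b i - L%:R * al.
have gper L : (a <= L)%N -> g (L + X)%N = g L.
  move=> hL; rewrite /g big_split_ord /= sX // natrD mulrDl {2}/al.
  by rewrite (mulrA X%:R) divff // mul1r; ring.
have bal : nc al <= 1.
  rewrite /al ncM ncV nc_nat mulrC ler_pdivrMr ?ltr0n // mul1r.
  apply: le_trans (nc_sum _ _ _) _; apply: le_trans (ler_sum _ (fun i _ => hb _)) _.
  by rewrite sumr_const card_ord.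
have gsm L : nc (g L) <= 2 * L%:R.
  apply: le_trans (ncB _ _) _; rewrite ncM nc_nat.
  have h1 : nc (\sum_(i < L) b i) <= L%:R.
    apply: le_trans (nc_sum _ _ _) _; apply: le_trans (ler_sum _ (fun i _ => hb _)) _.
    by rewrite sumr_const card_ord.
  have h2 : L%:R * nc al <= L%:R * 1 by rewrite ler_wpM2l.
  by lra.
exists (2 * (a + X)%:R) => L; rewrite -/(g L).
elim/ltn_ind: L => L IH; case: (leqP L (a + X)) => hL.
  by apply: le_trans (gsm L) _; rewrite ler_wpM2l // ler_nat.
have -> : L = (L - X + X)%N by lia.
by rewrite gper; [apply: IH|]; lia.
Qed.

Lemma eventually_zero (d : nat -> R) (c : R) : (forall t, d t = 0 \/ 1 <= d t) ->
  (forall m : nat, \sum_(t < m) d t <= c) -> exists t0, forall t, (t0 <= t)%N -> d t = 0.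
Proof.
move=> hd hc; apply: contrapT => /forallNP h.
have h1 t0 : exists2 t, (t0 <= t)%N & 1 <= d t.
  have /existsNP[t /not_implyP[ht hn]] := h t0; exists t => //.
  by case: (hd t).
have h2 k : exists m : nat, k%:R <= \sum_(t < m) d t.
  elim: k => [|k [m hm]]; first by exists 0%N; rewrite big_ord0.
  have [t ht h3] := h1 m; exists t.+1; rewrite big_ord_recr /= -[k.+1%:R]natr1.
  apply: lerD => //; apply: le_trans hm _; rewrite -(subnKC ht) big_split_ord /=.
  rewrite lerDl sumr_ge0 // => i _; case: (hd (m + i)%N) => [-> //|].
  by apply: le_trans.
have [m hm] := h2 (Num.bound `|c|); have := archi_boundP (normr_ge0 c).
by have := hc m; have := ler_norm c; lra.
Qed.

(** For one of the two signs the walk is near its extreme 2m for infinitely many m. The deficits for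
    that sign are 0 or at least 1 and have bounded partial sums, so they vanish from some point
    on. *)
Lemma walk_sign (y : nat -> R) (c : R) :
  (forall t, [\/ y t = 2, y t = 0 | y t = - 2]) ->
  (forall m : nat, 2 * m%:R - c <= `|\sum_(t < m) y t|) ->
  exists (t0 : nat) (sg : R), (sg = 1 \/ sg = -1) /\
    forall t, (t0 <= t)%N -> y t = 2 * sg.
Proof.
move=> hy hs.
have main (sg : R) : (sg = 1 \/ sg = -1) ->
    (forall m0 : nat, exists2 m : nat, (m0 <= m)%N & 2 * m%:R - c <= sg * \sum_(t < m) y t) ->
    exists t0 : nat, forall t, (t0 <= t)%N -> y t = 2 * sg.
  move=> hsg hinf.
  have hd t : 2 - sg * y t = 0 \/ 1 <= 2 - sg * y t.
    by case: hsg => ->; case: (hy t) => ->; [left|right|right|right|right|left]; lra.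
  case: (@eventually_zero (fun t => 2 - sg * y t) c hd) => [m0|t0 ht0]; last first.
    exists t0 => t /ht0; case: hsg => ->; lra.
  have [m hm h] := hinf m0.
  apply: (@le_trans _ _ (\sum_(t < m) (2 - sg * y t))); last first.
    by rewrite sumrB sumr_const card_ord -mulr_sumr -mulr_natr; lra.
  rewrite -(subnKC hm) big_split_ord /= lerDl sumr_ge0 // => i _.
  by case: (hd (m0 + i)%N) => [-> //|]; apply: le_trans.
have [h1|/existsNP[m1 h1]] := pselect (forall m0 : nat, exists2 m : nat, (m0 <= m)%N &
    2 * m%:R - c <= 1 * \sum_(t < m) y t).
  by have [t0 h] := main 1 (or_introl erefl) h1; exists t0, 1; split; [left|].
have [t0 h] : exists t0 : nat, forall t, (t0 <= t)%N -> y t = 2 * (-1).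
  apply: main; first by right.
  move=> m0; exists (maxn m0 m1); first exact: leq_maxl.
  have := hs (maxn m0 m1).
  case: (lerP 0 (\sum_(t < maxn m0 m1) y t)) => hh.
    rewrite (ger0_norm hh) => h3; case: h1; exists (maxn m0 m1); first exact: leq_maxr.
    by rewrite mul1r.
  by rewrite (ltr0_norm hh) mulN1r.
by exists t0, (-1); split; [right|].
Qed.

Lemma sum_blocks (F : nat -> C) X L : \sum_(n < X * L) F n =
  \sum_(c < X) \sum_(t < L) F (c + X * t)%N.
Proof.
rewrite exchange_big; elim: L => [|L IH]; first by rewrite muln0 !big_ord0.
rewrite mulnS addnC big_split_ord big_ord_recr IH /=; congr (_ + _).
by apply: eq_bigr => i _; rewrite addnC.
Qed.

End Fourier.

(** * Antisymmetry of e *)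

Section Antisym.
Context {R : realType}.
Local Notation C := R[i].
Implicit Types (p q Q D : {poly C}) (a b e eta : int -> C) (rho : C).

Definition pm1 (x : C) : Prop := x = 1 \/ x = -1.

Lemma nc_pm1 x : pm1 x -> nc x = 1.
Proof. by case=> ->; rewrite ?ncN nc1. Qed.

Lemma unity_expz (z : C) (X c : nat) (k : int) : (X > 0)%N -> z ^+ X = 1 ->
  z ^ (c%:Z + X%:Z * k) = z ^+ c.
Proof.
move=> X0 h; have z0 : z != 0.
  by apply: contra_eq_neq h => ->; rewrite expr0n eqn0Ngt X0 /= eq_sym oner_eq0.
by rewrite expfzDr // -exprz_exp -!exprnP h exp1rz mulr1.
Qed.

(** The lower bound [2 * y * x - k] may be negative and cannot always be squared; when it is not
    positive, the left-hand side is already nonpositive. *)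
Lemma sq_lower (y x k c S : R) : 0 <= y -> 0 <= x -> x <= 1 -> 0 <= k -> k <= c ->
  0 <= S -> 2 * y * x - k <= S -> 4 * y ^+ 2 * x ^+ 2 - 4 * y * c <= S ^+ 2.
Proof.
move=> y0 x0 x1 k0 kc S0 h.
have xy0 : 0 <= y * x by rewrite mulr_ge0.
have xyk : y * x * k <= y * c.
  by rewrite -mulrA ler_wpM2l //; apply: le_trans kc; rewrite ler_piMl.
case: (lerP (2 * y * x) k) => h2.
  have h3 : (y * x) * (2 * y * x) <= y * x * k by rewrite ler_wpM2l.
  have h4 : y * x * k >= 0 by rewrite mulr_ge0.
  have := sqr_ge0 S.
  have -> : 4 * y ^+ 2 * x ^+ 2 = 2 * ((y * x) * (2 * y * x)) by ring.
  by lra.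
have h3 : 0 <= 2 * y * x - k by lra.
have := ler_pM h3 h3 h h; rewrite -!expr2.
have -> : (2 * y * x - k) ^+ 2 = 4 * y ^+ 2 * x ^+ 2 - 4 * (y * x * k) + k ^+ 2 by ring.
by have := sqr_ge0 k; lra.
Qed.

Section Data.
Variables (Q : {poly C}) (s : int) (e eta : int -> C) (X a : nat).
Hypothesis hP : Pos Q s e eta.
Hypothesis Q0 : Q != 0.
Hypothesis he : forall i, pm1 (e i).
Hypothesis heta : forall n : nat, pm1 (eta n%:Z).
Hypothesis eta_neg : forall i, i < 0 -> eta i = 0.
Hypothesis X0 : (X > 0)%N.
Hypothesis eta_per : forall n : nat, (a <= n)%N -> eta (n + X)%:Z = eta n%:Z.

Lemma nc_e i : nc (e i) <= 1. Proof. by rewrite nc_pm1. Qed.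

Lemma nc_eta i : nc (eta i) <= 1.
Proof.
by case: i => n; [rewrite nc_pm1|rewrite eta_neg // nc0].
Qed.

(** Grouping by residue classes modulo [X]: at an X-th root of unity, the twisted difference of the
    two halves of [e] is the value of the polynomial with these coefficients, ready for Parseval. *)
Definition class_sum L (c : nat) : C :=
  \sum_(t < L) (e (c%:Z + X%:Z * t%:Z) - e (c%:Z - X%:Z * t.+1%:Z)).

Lemma class_sum_eq (z : C) L : z ^+ X = 1 ->
  \sum_(n < X * L) tw z e n%:Z - \sum_(n < X * L) tw z e (- n.+1%:Z) =
  (\poly_(c < X) class_sum L c).[z].
Proof.
move=> h; rewrite horner_poly.
rewrite (@sum_blocks _ (fun n => tw z e n%:Z)) (@sum_blocks _ (fun n => tw z e (- n.+1%:Z))).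
rewrite [X in _ - X](reindex_inj rev_ord_inj) -sumrB; apply: eq_bigr => c _ /=.
rewrite -sumrB mulr_suml; apply: eq_bigr => t _; rewrite mulrBl; congr (_ - _).
  by rewrite /tw PoszD PoszM unity_expz // mulrC.
have -> : - (X - c.+1 + X * t).+1%:Z = c%:Z + X%:Z * - t.+1%:Z.
  by have := ltn_ord c; lia.
by rewrite /tw unity_expz // mulrC mulrN.
Qed.

(** One period of [eta] consists of signs, so its squared twisted means sum to 1; the tests at all
    X-th roots of unity then give a total of at least 4 X L^2 - O(L) for the squared class sums.
    Each is at most 4 L^2, so none falls short by more than O(L). *)
Lemma class_sum_large : exists c : R, forall (i : 'I_X) (L : nat),
  2 * L%:R - c <= nc (class_sum L i).
Proof.
have [om hom] := @prim_root_complex R X X0.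
have uom : nc om = 1 := unity_unim X0 (prim_expr_order hom).
have XR : 0 < X%:R :> R by rewrite ltr0n.
have hX r : (om ^+ r) ^+ X = 1 by rewrite -exprM mulnC exprM (prim_expr_order hom) expr1n.
pose b r n := tw (om ^+ r) eta n%:Z.
pose al r : C := X%:R^-1 * \sum_(i < X) b r (a + i)%N.
have hb r i : nc (b r i) <= 1.
  by rewrite /b /tw ncM unim_expz ?unim_exp // mul1r nc_eta.
have hper r n : (a <= n)%N -> b r (n + X)%N = b r n.
  move=> hn; rewrite /b /tw eta_per //.
  by rewrite -[X in (n + X)%N]muln1 PoszD PoszM unity_expz // -exprnP.
have hsum : \sum_(r < X) nc (al r) ^+ 2 = 1.
  pose p := \poly_(i < X) eta (a + i)%:Z.
  have E r : nc (al r) = X%:R^-1 * nc p.[1 * om ^+ r].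
    rewrite /al ncM ncV nc_nat mul1r horner_poly; congr (_ * _).
    rewrite -[LHS]mul1r -(unim_exp a (unim_exp r uom)) -[RHS]mul1r.
    have -> : \sum_(i < X) b r (a + i)%N =
        (om ^+ r) ^+ a * \sum_(i < X) eta (a + i)%:Z * (om ^+ r) ^+ i.
      rewrite mulr_sumr; apply: eq_bigr => i _.
      by rewrite /b /tw -exprnP exprD; ring.
    by rewrite ncM !(unim_exp _ (unim_exp r uom)) !mul1r.
  under eq_bigr => r _ do rewrite E exprMn.
  rewrite -mulr_sumr (parseval hom (nc1 : nc 1 = 1)) ?size_poly //.
  under [X in _ * (_ * X)]eq_bigr => i _.
    rewrite coef_poly ltn_ord nc_pm1 ?expr1n; last exact: heta.
    over.
  by rewrite sumr_const card_ord exprVn expr2; field; rewrite lt0r_neq0.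
have al1 r : (r < X)%N -> nc (al r) <= 1.
  move=> hr; rewrite -(@expr_le1 _ 2) ?nc_ge0 // -hsum.
  rewrite (bigD1 (Ordinal hr)) //= lerDl sumr_ge0 // => i _; exact: sqr_ge0.
have key (r : 'I_X) : exists2 c : R, 0 <= c & forall L : nat,
    2 * L%:R * nc (al r) - c <= nc (\sum_(n < L) tw (om ^+ r) e n%:Z -
      \sum_(n < L) tw (om ^+ r) e (- n.+1%:Z)).
  have [c0 hc0] := periodic_avg X0 (hb r) (hper r).
  exact: (halves_at_unimodular hP Q0 nc_e nc_eta eta_neg (unim_exp r uom) hc0).
have [cf cf0 hcf] := fin_all_exists2 key.
pose c := \sum_(r < X) cf r.
have hc r : cf r <= c.
  by rewrite /c (bigD1 r) //= lerDl sumr_ge0.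
have c0 : 0 <= c by rewrite sumr_ge0.
exists (2 * X%:R * c) => i L.
have [->|L0] := posnP L.
  by rewrite mulr0 sub0r; have := nc_ge0 (class_sum 0 i);
     have := mulr_ge0 (mulr_ge0 (ler0n R 2) (ltW XR)) c0; lra.
have LR : 0 < L%:R :> R by rewrite ltr0n.
have hle (k : nat) : nc (class_sum L k) <= 2 * L%:R.
  apply: le_trans (nc_sum _ _ _) _; apply: (@le_trans _ _ (\sum_(t < L) 2)).
    by apply: ler_sum => t _; apply: le_trans (ncB _ _) _; rewrite !nc_pm1.
  by rewrite sumr_const card_ord -[_ *+ L]mulr_natr.
have hS (r : 'I_X) : 4 * X%:R ^+ 2 * L%:R ^+ 2 * nc (al r) ^+ 2 - 4 * X%:R * L%:R * c <=
    nc (\poly_(c < X) class_sum L c).[1 * om ^+ r] ^+ 2.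
  have -> : 4 * X%:R ^+ 2 * L%:R ^+ 2 = 4 * (X%:R * L%:R) ^+ 2 :> R by ring.
  have -> : 4 * X%:R * L%:R * c = 4 * (X%:R * L%:R) * c :> R by ring.
  apply: (@sq_lower _ _ (cf r)) => //; rewrite ?nc_ge0 ?al1 //.
  by rewrite mul1r -class_sum_eq // -natrM; apply: hcf.
have hpars : X%:R * \sum_(k < X) nc (class_sum L k) ^+ 2 =
    \sum_(r < X) nc (\poly_(c < X) class_sum L c).[1 * om ^+ r] ^+ 2.
  rewrite (parseval hom (nc1 : nc 1 = 1)) ?size_poly //; congr (_ * _).
  by apply: eq_bigr => k _; rewrite coef_poly ltn_ord.
have hsumS : 4 * X%:R ^+ 2 * L%:R ^+ 2 - X%:R * (4 * X%:R * L%:R * c) <=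
    X%:R * \sum_(k < X) nc (class_sum L k) ^+ 2.
  rewrite hpars; apply: le_trans _ (ler_sum _ (fun r _ => hS r)).
  by rewrite sumrB sumr_const card_ord -mulr_sumr hsum mulr1 -[(_ * c) *+ X]mulr_natl.
have hone : 4 * L%:R ^+ 2 - nc (class_sum L i) ^+ 2 <= 4 * X%:R * L%:R * c.
  apply: (@le_trans _ _ (\sum_(k < X) (4 * L%:R ^+ 2 - nc (class_sum L k) ^+ 2))).
    rewrite (bigD1 i) //= lerDl sumr_ge0 // => k _; rewrite subr_ge0.
    have := ler_pM (nc_ge0 _) (nc_ge0 _) (hle k) (hle k); rewrite -!expr2.
    by rewrite exprMn; lra.
  rewrite sumrB sumr_const card_ord -[(4 * _) *+ X]mulr_natl -(ler_pM2l XR).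
  by move: hsumS; rewrite expr2; lra.
(* For a class sum of modulus S, 4 L^2 - S^2 is at least (2 L - S) 2 L: a deficit O(L) in the square
   is a bounded deficit in the sum. *)
have hA : (2 * L%:R - nc (class_sum L i)) * (2 * L%:R) <= 2 * X%:R * c * (2 * L%:R).
  have h1 : 0 <= (2 * L%:R - nc (class_sum L i)) * nc (class_sum L i).
    by rewrite mulr_ge0 ?nc_ge0 // subr_ge0.
  have -> : (2 * L%:R - nc (class_sum L i)) * (2 * L%:R) =
    4 * L%:R ^+ 2 - nc (class_sum L i) ^+ 2 -
    (2 * L%:R - nc (class_sum L i)) * nc (class_sum L i) by ring.
  by lra.
by rewrite ler_pM2r ?mulr_gt0 // in hA; lra.
Qed.

(* On each residue class mod X the two halves differ by at most 2 per term, while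
   Parseval over the X-th roots of unity makes the sum of their squares maximal. *)
Lemma antisym : exists n0 : nat, forall n n' : int, n0%:Z <= n -> n' <= - n0%:Z ->
  (exists k : int, n - n' = X%:Z * k) -> e n' = - e n.
Proof.
have [c hc] := class_sum_large.
have hreal i : e i = (complex.Re (e i))%:C%C.
  by case: (he i) => ->; apply/eqP; rewrite eq_complex /= ?oppr0 !eqxx.
have hR i : complex.Re (e i) = 1 \/ complex.Re (e i) = -1.
  by case: (he i) => ->; [left|right].
pose y (i : 'I_X) (t : nat) : R := complex.Re (e (i%:Z + X%:Z * t%:Z)) -
    complex.Re (e (i%:Z - X%:Z * t.+1%:Z)).
have hy i t : [\/ y i t = 2, y i t = 0 | y i t = - 2].
  rewrite /y; case: (hR (i%:Z + X%:Z * t%:Z)) => ->.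
    by case: (hR (i%:Z - X%:Z * t.+1%:Z)) => ->; [apply: Or32|apply: Or31]; ring.
  by case: (hR (i%:Z - X%:Z * t.+1%:Z)) => ->; [apply: Or33|apply: Or32]; ring.
have hys i m : 2 * m%:R - c <= `|\sum_(t < m) y i t|.
  have := hc i m; congr (_ <= _); rewrite -nc_real; congr nc.
  rewrite rmorph_sum; apply: eq_bigr => t _; rewrite /y rmorphB /=.
  by rewrite -!hreal.
have hsgn (i : 'I_X) : exists t0 : nat, forall t, (t0 <= t)%N ->
    exists sg : R, [/\ (forall t', (t0 <= t')%N ->
      complex.Re (e (i%:Z + X%:Z * t'%:Z)) = sg) &
      complex.Re (e (i%:Z - X%:Z * t.+1%:Z)) = - sg].
  have [t0 [sg [hsg h]]] := walk_sign (hy i) (hys i); exists t0 => t ht; exists sg.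
  have hh t' : (t0 <= t')%N -> complex.Re (e (i%:Z + X%:Z * t'%:Z)) = sg /\
      complex.Re (e (i%:Z - X%:Z * t'.+1%:Z)) = - sg.
    move=> /h; rewrite /y; case: hsg => ->;
    by case: (hR (i%:Z + X%:Z * t'%:Z)) => ->;
    case: (hR (i%:Z - X%:Z * t'.+1%:Z)) => ->; lra.
  by split=> [t' /hh[]|]; have [] := hh _ ht.
have [tf htf] := fin_all_exists hsgn.
pose T := (\max_(i < X) tf i)%N.
have hT i : (tf i <= T)%N by rewrite /T (bigD1 i) //= leq_maxl.
(* [T] dominates all thresholds [tf i]; the extra periods leave room for the remainders and for the
   left quotient being counted from [t'.+1]. *)
exists (X * T.+2)%N => n n' hn hn' [k hk].
have [i [t [ht En]]] : exists (i : 'I_X) (t : nat), (T <= t)%N /\ n = i%:Z + X%:Z * t%:Z.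
  have hmod : (`|n| %% X < X)%N by rewrite ltn_mod.
  exists (Ordinal hmod), (`|n| %/ X)%N; split.
    rewrite leq_divRL //; apply: (@leq_trans (X * T.+2)); last by lia.
    by rewrite [(T * X)%N]mulnC leq_pmul2l //; lia.
  have := divn_eq `|n| X; rewrite /= -PoszM -PoszD mulnC addnC => <-; lia.
have hkt : T%:Z + 1 <= k - t%:Z - 1.
  have : X%:Z * (T%:Z + 2) <= X%:Z * (k - t%:Z).
    have -> : X%:Z * (k - t%:Z) = i%:Z - n' by rewrite mulrBr -hk En; ring.
    have e2 : (X * T.+2)%:Z = X%:Z * (T%:Z + 2) by rewrite PoszM; congr (_ * _); lia.
    by move: hn'; rewrite e2; lia.
  by rewrite ler_pM2l; [lia | rewrite ltz_nat].
have [t' Et'] : exists t' : nat, k - t%:Z = t'.+1%:Z by exists (absz (k - t%:Z - 1)%R); lia.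
have En' : n' = i%:Z - X%:Z * t'.+1%:Z by rewrite -Et' mulrBr -hk En; ring.
have ht' : (tf i <= t')%N by have := hT i; lia.
have [sg [h1 h2]] := htf i _ ht'.
by rewrite En' hreal h2 En [e (_ + _)]hreal h1 ?rmorphN //; apply: leq_trans ht.
Qed.

End Data.
End Antisym.

(** * Equality of moduli on the unit circle *)

Section Circle.
Context {R : realType}.
Local Notation C := R[i].
Implicit Types (p q Q D : {poly C}) (a b e eta : int -> C) (rho : C).

Lemma circle_poly0 p : (forall z, nc z = 1 -> p.[z] = 0) -> p = 0.
Proof.
move=> h; apply/eqP/negPn/negP => p0.
have [om hom] := @prim_root_complex R (size p).+1 isT.
have hr : all (root p) [seq om ^+ i | i <- iota 0 (size p).+1].
  apply/allP => _ /mapP[i _ ->]; apply/eqP/h/unim_exp.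
  exact: unity_unim _ (prim_expr_order hom).
have := max_poly_roots p0 hr.
rewrite map_inj_in_uniq ?iota_uniq ?size_map ?size_iota ?ltnNge ?leqnSn //.
  by move=> /(_ isT).
move=> i j; rewrite !mem_iota !add0n => hi hj /eqP.
by rewrite (eq_prim_root_expr hom) !modn_small // => /eqP.
Qed.

(** On the circle [p p^* - 4 q q^*] encodes the difference of the squares, and its product with [G]
    is a polynomial vanishing on the whole circle. *)
Lemma circ_ext p q G : G != 0 ->
  (forall z, nc z = 1 -> G.[z] != 0 -> nc p.[z] = 2 * nc q.[z]) ->
  forall z, nc z = 1 -> nc p.[z] = 2 * nc q.[z].
Proof.
move=> G0 h; set H := maxn (size p) (size q).
have hp : (size p <= H.+1)%N by rewrite leqW ?leq_maxl.
have hq : (size q <= H.+1)%N by rewrite leqW ?leq_maxr.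
pose T := p * star H p - 4 *: (q * star H q).
have TE z : nc z = 1 -> T.[z] = z ^+ H * (nc p.[z] ^+ 2 - 4 * nc q.[z] ^+ 2)%:C%C.
  move=> u; rewrite hornerD hornerN hornerZ !hornerM !horner_star //.
  have -> (x y : R) : (x - 4 * y)%:C%C = x%:C%C - 4 * y%:C%C.
    by rewrite rmorphB mulr_natl rmorphMn /= mulr_natl.
  by rewrite -!mulcj; ring.
have T0 : T = 0.
  have : T * G = 0.
    apply: circle_poly0 => z u; rewrite hornerM TE //.
    have [->|g] := eqVneq G.[z] 0; first by rewrite mulr0.
    rewrite (h z u g).
    have -> : (2 * nc q.[z]) ^+ 2 - 4 * nc q.[z] ^+ 2 = 0 by ring.
    by rewrite mulr0 mul0r.
  by move=> /eqP; rewrite mulf_eq0 (negPf G0) orbF => /eqP.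
move=> z u; have := TE z u; rewrite T0 horner0 => /esym/eqP.
rewrite mulf_eq0 expf_eq0 (negPf (unim_neq0 u)) andbF /=.
rewrite (inj_eq (@complexI R) _ 0) subr_eq0.
have -> : 4 * nc q.[z] ^+ 2 = (2 * nc q.[z]) ^+ 2 by ring.
by rewrite eqrXn2 ?mulr_ge0 ?nc_ge0 // => /eqP.
Qed.

Lemma sum_lt_le L d : \sum_(r < L) (r < d)%N%:R <= d%:R :> R.
Proof.
apply: (@le_trans _ _ (minn L d)%:R); last by rewrite ler_nat geq_minr.
elim: L => [|L IH]; first by rewrite big_ord0 min0n.
rewrite big_ord_recr /=; case: (ltnP L d) => h.
  have -> : minn L.+1 d = (minn L d).+1 by lia.
  by rewrite -[_.+1%:R]natr1 lerD2r.
have -> : minn L.+1 d = minn L d by lia.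
by rewrite addr0.
Qed.

Lemma pseq_geo L (i : int) : pseq (geo L : {poly C}) i = ((0 <= i) && (i < L%:Z))%:R.
Proof.
by case: i => [n|n] //=; rewrite coef_geo.
Qed.

Lemma geo2_near L (d : int) :
  nc (pseq (geo L.+1 * geo L.+1 : {poly C}) (L%:Z + d) - L.+1%:R) <= (absz d)%:R.
Proof.
rewrite -act_pseq act_geo.
have -> : L.+1%:R = \sum_(r < L.+1) (1 : C) by rewrite sumr_const card_ord.
rewrite -sumrB; apply: le_trans (nc_sum _ _ _) _.
under eq_bigr => r _ do rewrite pseq_geo.
case: (lerP 0 d) => hd.
  apply: le_trans (sum_lt_le L.+1 `|d|%N); apply: ler_sum => r _.
  have := ltn_ord r => hr; case: ltnP => h.
    by case: andP => _; rewrite ?subrr ?nc0 // sub0r ncN nc1.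
  have -> : (0 <= L%:Z + d - r%:Z) && (L%:Z + d - r%:Z < L.+1%:Z) by lia.
  by rewrite subrr nc0.
rewrite (reindex_inj rev_ord_inj) /=.
apply: le_trans (sum_lt_le L.+1 `|d|%N); apply: ler_sum => r _.
have := ltn_ord r => hr; case: ltnP => h.
  by case: andP => _; rewrite ?subrr ?nc0 // sub0r ncN nc1.
have -> : (0 <= L%:Z + d - (L.+1 - r.+1)%:Z) && (L%:Z + d - (L.+1 - r.+1)%:Z < L.+1%:Z) by lia.
by rewrite subrr nc0.
Qed.

(** The coefficients of geo^2 form a triangle with apex L + 1 at index L, so near the apex the
    convolution with a fixed [p] is almost constant. In this way [Pos] yields information on values
    on the circle. *)
Lemma geo2_peak p (d : int) L :
  nc (pseq (p * (geo L.+1 * geo L.+1)) (L%:Z + d) - L.+1%:R * p.[1]) <=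
  nrm1 p * (absz d + size p)%:R.
Proof.
rewrite -act_pseq /act horner_coef [L.+1%:R * _]mulr_sumr -sumrB.
apply: le_trans (nc_sum _ _ _) _; rewrite /nrm1 [X in _ <= X]mulr_suml.
apply: ler_sum => j _; rewrite expr1n mulr1 [L.+1%:R * _]mulrC -mulrBr ncM.
rewrite ler_wpM2l ?nc_ge0 // -addrA; apply: le_trans (geo2_near _ _) _.
by rewrite ler_nat; have := ltn_ord j; lia.
Qed.

Lemma pseq_inj p q : pseq p =1 pseq q -> p = q.
Proof. by move=> h; apply/polyP => i; have := h i%:Z. Qed.

End Circle.

(** * Extremality: Q e is a Laurent polynomial *)

Section Rigid.
Context {R : realType}.
Local Notation C := R[i].
Implicit Types (p q D : {poly C}) (rho : C).

Variables (Q V : {poly C}) (s : int) (e eta : int -> C) (X a n0 : nat).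
Hypothesis hP : Pos Q s e eta.
Hypothesis Q0 : Q != 0.
Hypothesis he : forall i, pm1 (e i).
Hypothesis heta : forall n : nat, pm1 (eta n%:Z).
Hypothesis eta_neg : forall i, i < 0 -> eta i = 0.
Hypothesis X0 : (X > 0)%N.
Hypothesis eta_per : forall n : nat, (a <= n)%N -> eta (n + X)%:Z = eta n%:Z.
Hypothesis anti : forall n n' : int, n0%:Z <= n -> n' <= - n0%:Z ->
  (exists k : int, n - n' = X%:Z * k) -> e n' = - e n.
Hypothesis QV : act Q eta =1 pseq V.

(** [Y] is a multiple of the period exceeding both [a] and [2 * n0], so that [n] and [n - Y] can lie
    on opposite sides of the middle zone. *)
Let t0 : nat := (2 * n0 + a + 1)%N.
Let Y : nat := (X * t0)%N.

Lemma Y_large : (2 * n0 < Y)%N /\ (a <= Y)%N /\ (0 < Y)%N.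
Proof. by rewrite /Y /t0; nia. Qed.

(** Both indices are opposite to one and the same point far to the left. *)
Lemma e_per_pos (n : int) (k : nat) : n0%:Z <= n -> e (n + X%:Z * k%:Z) = e n.
Proof.
move=> hn; pose m : int := n - X%:Z * (absz n + n0)%:Z.
have hm : m <= - n0%:Z.
  have : (absz n + n0 <= X * (absz n + n0))%N by rewrite leq_pmull.
  by rewrite /m; lia.
have h1 := anti hn hm; have h2 : n0%:Z <= n + X%:Z * k%:Z.
  by have : (0 <= X * k)%N; [lia|]; rewrite -PoszM; lia.
have := anti h2 hm; rewrite h1; last by exists (absz n + n0)%:Z; rewrite /m; ring.
move=> h; apply: oppr_inj; rewrite -h //.
by exists (k%:Z + (absz n + n0)%:Z); rewrite /m; ring.
Qed.

Lemma e_per_neg (n : int) (k : nat) : n <= - n0%:Z -> e (n - X%:Z * k%:Z) = e n.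
Proof.
move=> hn; pose m : int := n + X%:Z * (absz n + n0)%:Z.
have hm : n0%:Z <= m.
  have : (absz n + n0 <= X * (absz n + n0))%N by rewrite leq_pmull.
  by rewrite /m; lia.
have h2 : n - X%:Z * k%:Z <= - n0%:Z.
  by have : (0 <= X * k)%N; [lia|]; rewrite -PoszM; lia.
rewrite (anti hm hn); last by exists (absz n + n0)%:Z; rewrite /m; ring.
rewrite (anti hm h2) //.
by exists (k%:Z + (absz n + n0)%:Z); rewrite /m; ring.
Qed.

Lemma eta_perY (n : nat) : (a <= n)%N -> eta (n + Y)%:Z = eta n%:Z.
Proof.
rewrite /Y; elim: t0 => [|t IH] hn; first by rewrite muln0 addn0.
by rewrite mulnS addnCA addnC eta_per ?IH // (leq_trans hn) // leq_addr.
Qed.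

(** The difference at lag [Y] removes the periodic tails: [dA] lives on [-n0, n0 + Y) and [dB] on
    [0, a + Y). This is why [pA] is stored shifted by [n0]. *)
Definition dA (i : int) : C := e i - e (i - Y%:Z).
Definition dB (i : int) : C := eta i - eta (i - Y%:Z).
Definition pA : {poly C} := \poly_(i < 2 * n0 + Y) dA (i%:Z - n0%:Z).
Definition pB : {poly C} := \poly_(i < a + Y) dB i%:Z.

Lemma dA_pA (i : int) : dA i = pseq pA (i + n0%:Z).
Proof.
case E : (i + n0%:Z) => [j|j] /=.
  rewrite coef_poly; case: ltnP => hj; first by congr dA; lia.
  rewrite /dA -[in X in X - _](subrK Y%:Z i) /Y PoszM e_per_pos ?subrr //.
  by rewrite -PoszM -/Y; have := Y_large; lia.
by rewrite /dA /Y PoszM e_per_neg ?subrr //; lia.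
Qed.

Lemma dB_pB : dB =1 pseq pB.
Proof.
move=> [j|j]; last first.
  by rewrite /dB !eta_neg ?subrr //=; have := Y_large; lia.
rewrite /= coef_poly; case: ltnP => // hj.
rewrite /dB; have [j' Ej] : exists j' : nat, j = (j' + Y)%N by exists (j - Y)%N; lia.
by rewrite Ej eta_perY; [rewrite PoszD addrK subrr|lia].
Qed.

Lemma act_cX (c : C) (b : int -> C) (i : int) :
  act (1 - c *: 'X^Y) b i = b i - c * b (i - Y%:Z).
Proof. by rewrite actB act1 actZ actXn. Qed.

Lemma QpB : Q * pB = (1 - 'X^Y) * V.
Proof.
apply: pseq_inj => i; rewrite -act_pseq -(eq_act _ _ dB_pB) act_seqB.
rewrite (act_shift Q eta (- Y%:Z)) -act_pseq -(eq_act _ _ QV) actB act1 actXn.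
by [].
Qed.

(** After the twist by [zeta], test with (1 - zeta^Y z^Y) geo. The first factor turns [e] and [eta]
    into [pA] and [pB], its star joins [Qz] in a factor [F] with F(1) nonzero, and geo^2 picks out
    the values at [zeta]. *)
Lemma pA_pB_point zeta : nc zeta = 1 -> Q.[zeta] != 0 -> zeta ^+ Y != 1 ->
  2 * nc pB.[zeta] <= nc pA.[zeta].
Proof.
move=> u hQ hY; have z0 := unim_neq0 u.
have hP' := pos_twist u hP; set Qz := _ *: dil zeta Q in hP'.
have Qz1 : nc Qz.[1] = nc Q.[zeta].
  by rewrite hornerZ dil_horner mulr1 ncM unim_expz // mul1r.
set c := zeta ^+ Y in hY.
have uc : nc c = 1 by rewrite unim_exp.
pose F := Qz * ('X^Y - (cj c)%:P).
have F1 : nc F.[1] = nc Q.[zeta] * nc (1 - c).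
  rewrite hornerM ncM Qz1 hornerD hornerN hornerXn hornerC expr1n.
  by congr (_ * _); rewrite -[RHS]nc_cj rmorphB rmorph1.
have F0 : 0 < nc F.[1].
  by rewrite F1 mulr_gt0 // nc_gt0 // subr_eq0 eq_sym.
have twA i : act (1 - c *: 'X^Y) (tw zeta e) i =
    zeta ^ (- n0%:Z) * pseq (dil zeta pA) (i + n0%:Z).
  rewrite act_cX /tw /c exprnP mulrA -expfzDr //.
  have -> : Y%:Z + (i - Y%:Z) = i by lia.
  rewrite -mulrBr -/(dA i) dA_pA; case E: (i + n0%:Z) => [j|j] /=; last by rewrite !mulr0.
  by rewrite coef_dil mulrA exprnP -expfzDr //; congr (zeta ^ _ * _); lia.
have twB i : act (1 - c *: 'X^Y) (tw zeta eta) i = pseq (dil zeta pB) i.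
  rewrite act_cX /tw /c exprnP mulrA -expfzDr //.
  have -> : Y%:Z + (i - Y%:Z) = i by lia.
  rewrite -mulrBr -/(dB i) dB_pB; case: i => j /=; last by rewrite !mulr0.
  by rewrite coef_dil exprnP.
set kA := nrm1 (F * dil zeta pA) * (absz (s + Y%:Z + n0%:Z)%R + size (F * dil zeta pA)%R)%:R.
set kB := nrm1 (F * dil zeta pB) * (0 + size (F * dil zeta pB)%R)%:R.
rewrite -(ler_pM2l F0); apply: (@le_arch _ _ _ (kA + 2 * kB)) => L.
pose D := (1 - c *: 'X^Y) * geo L.+1.
have sD : (size (1 - c *: 'X^Y : {poly C})%R <= Y.+1)%N.
  apply: leq_trans (size_polyD _ _) _; rewrite size_polyN geq_max.
  rewrite (leq_trans (size_polyC_leq1 _)) //=.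
  by apply: leq_trans (size_scale_leq _ _) _; rewrite size_polyXn.
have hD : (size D <= (Y + L).+1)%N.
  apply: leq_trans (size_polyMleq _ _) _; rewrite -subn1 leq_subLR.
  by apply: leq_trans (leq_add sD (size_geo _)) _; lia.
have := hP' D _ L%:Z hD.
have -> : Qz * D * star (Y + L) D = (F * (geo L.+1 * geo L.+1)) * (1 - c *: 'X^Y).
  rewrite /D starM ?size_geo // star_geo starB starZ -[X in star Y X - _]/('X^0).
  by rewrite !starXn // subn0 subnn expr0 /F alg_polyC; ring.
rewrite !(actM _ (1 - _)) (eq_act _ _ twB) (eq_act _ _ twA).
have -> : act (F * (geo L.+1 * geo L.+1))
    (fun i => zeta ^ (- n0%:Z) * pseq (dil zeta pA) (i + n0%:Z)) (s + (Y + L)%:Z) =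
    zeta ^ (- n0%:Z) * pseq (F * dil zeta pA * (geo L.+1 * geo L.+1))
       (L%:Z + (s + Y%:Z + n0%:Z)).
  have -> : F * dil zeta pA * (geo L.+1 * geo L.+1) =
     F * (geo L.+1 * geo L.+1) * dil zeta pA by ring.
  rewrite -act_pseq /act [RHS]mulr_sumr; apply: eq_bigr => j _; rewrite mulrCA.
  by congr (_ * (_ * pseq _ _)); lia.
rewrite act_pseq; have -> : F * (geo L.+1 * geo L.+1) * dil zeta pB =
  F * dil zeta pB * (geo L.+1 * geo L.+1) by ring.
have := geo2_peak (F * dil zeta pB) 0 L.
have := geo2_peak (F * dil zeta pA) (s + Y%:Z + n0%:Z) L.
rewrite addr0 -/kA -/kB; set sA := pseq _ (L%:Z + _); set sB := pseq _ _.
rewrite (hornerM F (dil zeta pA)) (hornerM F (dil zeta pB)) !dil_horner mulr1 => h1 h2 h3.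
have h4 := Re_le (zeta ^ (- n0%:Z) * sA).
rewrite ncM unim_expz // mul1r in h4.
have h5 := ncBB sA (L.+1%:R * (F.[1] * pA.[zeta])).
have h6 := ncBB (L.+1%:R * (F.[1] * pB.[zeta])) sB.
rewrite ncBC !ncM nc_nat in h6; rewrite !ncM nc_nat in h5.
have L0 : 0 < L.+1%:R :> R by rewrite ltr0n.
rewrite -(ler_pM2l L0) [L.+1%:R * (_ + _)]mulrDr [L.+1%:R * (_ / _)]mulrC.
rewrite divfK ?lt0r_neq0 //; lra.
Qed.

(** Every residue modulo [Y] contributes 4. Outside the middle zone the two signs in [dA] are
    opposite; an index below [2 * n0] is paired with its shift by [Y], where the outer two of the
    three values of [e] are opposite and the parallelogram law applies. *)
Lemma sum_pA : \sum_(i < 2 * n0 + Y) nc pA`_i ^+ 2 = 4 * Y%:R.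
Proof.
have [hY1 [hY2 hY3]] := Y_large.
pose f (i : nat) := nc (dA (i%:Z - n0%:Z)) ^+ 2.
have -> : \sum_(i < 2 * n0 + Y) nc pA`_i ^+ 2 =
    \sum_(0 <= i < 2 * n0 + Y) f i.
  by rewrite big_mkord; apply: eq_bigr => i _; rewrite coef_poly ltn_ord.
rewrite (@big_cat_nat _ _ _ (2 * n0)) //=; last lia.
rewrite (@big_cat_nat _ _ _ Y (2 * n0)) /=; [|lia|lia].
have -> : \sum_(Y <= i < 2 * n0 + Y) f i = \sum_(0 <= i < 2 * n0) f (i + Y)%N.
  by rewrite -{1}[Y]add0n big_addn addnK.
have -> : \sum_(2 * n0 <= i < Y) f i = \sum_(2 * n0 <= i < Y) 4.
  apply: eq_big_nat => i /andP[h1 h2]; rewrite /f /dA.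
  rewrite (anti (n := i%:Z - n0%:Z) (n' := i%:Z - n0%:Z - Y%:Z)); [|lia|lia|]; last first.
    by exists t0%:Z; rewrite -PoszM -/Y; lia.
  have E2 (x : C) : nc (x + x) = 2 * nc x by rewrite -mulr2n -[x *+ 2]mulr_natl ncM nc_nat.
  by rewrite opprK E2 nc_pm1 //; ring.
rewrite addrA addrAC -big_split /=.
have -> : \sum_(0 <= i < 2 * n0) (f i + f (i + Y)%N) = \sum_(0 <= i < 2 * n0) 4.
  apply: eq_big_nat => i /andP[_ h2]; rewrite /f /dA.
  have -> : (i + Y)%:Z - n0%:Z - Y%:Z = i%:Z - n0%:Z by lia.
  rewrite (anti (n := (i + Y)%:Z - n0%:Z) (n' := i%:Z - n0%:Z - Y%:Z)); [|lia|lia|]; last first.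
    by exists (t0%:Z * 2); rewrite mulrA -PoszM -/Y; lia.
  by rewrite opprK addrC ncBC nc_par !nc_pm1 //; ring.
rewrite !big_const_nat !iter_addr_0 -mulrnDr -[_ *+ _]mulr_natr; congr (_ * _%:R).
by lia.
Qed.

(** The first [Y] coefficients are those of [eta] itself. Four times this bound equals [sum_pA],
    which leaves no slack in the pointwise inequality. *)
Lemma sum_pB : Y%:R <= \sum_(i < a + Y) nc pB`_i ^+ 2.
Proof.
rewrite addnC big_split_ord /=; apply: (@le_trans _ _ (\sum_(i < Y) 1)).
  by rewrite sumr_const card_ord.
rewrite -[leLHS]addr0; apply: lerD; last first.
  by apply: sumr_ge0 => i _; apply: sqr_ge0.
apply: ler_sum => i _; rewrite coef_poly (leq_trans (ltn_ord i)) ?leq_addl //.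
rewrite /dB (eta_neg (i := _ - _)); last by have := ltn_ord i; lia.
by rewrite subr0 nc_pm1 // expr1n.
Qed.

(* pA and pB are (1 - z^Y) times e and eta; pointwise |pA| >= 2 |pB| off finitely
   many points, and the l2 norms force equality. *)
Lemma pA_pB zeta : nc zeta = 1 -> nc pA.[zeta] = 2 * nc pB.[zeta].
Proof.
have [hY1 [hY2 hY3]] := Y_large.
set H := (2 * n0 + a + Y)%N; have H0 : (0 < H)%N by rewrite /H; lia.
have [om hom] := @prim_root_complex R H H0.
have uom : nc om = 1 := unity_unim H0 (prim_expr_order hom).
pose G0 : {poly C} := Q * ('X^Y - 1).
have G00 : G0 != 0.
  by rewrite mulf_neq0 // monic_neq0 // monicXnsubC.
(* Parseval needs all [H] points of the coset of [z] to be good, so the zeros of every rotate of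
   [G0] are excluded; [circ_ext] recovers the excluded [z]. *)
pose G := \prod_(r < H) dil (om ^+ r) G0.
have G1 : G != 0.
  apply/prodf_neq0 => r _; apply: contra G00 => /eqP h; apply/eqP.
  have r0 : om ^+ r != 0 by rewrite expf_neq0 // unim_neq0.
  by rewrite -(dilK G0 (invr_neq0 r0)) invrK h /dil comp_poly0.
apply: (circ_ext G1) => z u; rewrite horner_prod => /prodf_neq0 hG.
have good (r : 'I_H) : 2 * nc pB.[z * om ^+ r] <= nc pA.[z * om ^+ r].
  have := hG r isT; rewrite dil_horner mulrC hornerM mulf_eq0 negb_or.
  rewrite hornerD hornerXn hornerN hornerC subr_eq0 => /andP[h1 h2].
  by apply: pA_pB_point => //; rewrite ncM u unim_exp ?mul1r.
have hA := parseval hom u (_ : (size pA <= H)%N).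
have hB := parseval hom u (_ : (size pB <= H)%N).
have {}hA := hA (leq_trans (size_poly _ _) _).
have {}hB := hB (leq_trans (size_poly _ _) _).
have E p n : (size p <= n)%N -> (n <= H)%N ->
    \sum_(i < H) nc p`_i ^+ 2 = \sum_(i < n) nc p`_i ^+ 2.
  move=> hs hn; rewrite -(subnKC hn) big_split_ord /= [X in _ + X]big1 ?addr0 //.
  by move=> i _; rewrite nth_default ?nc0 ?expr0n // (leq_trans hs) // leq_addr.
rewrite (E _ (2 * n0 + Y)%N) ?size_poly ?sum_pA // in hA; try (rewrite /H; lia).
rewrite (E _ (a + Y)%N) ?size_poly // in hB; try (rewrite /H; lia).
have hle : \sum_(r < H) (nc pA.[z * om ^+ r] ^+ 2 - 4 * nc pB.[z * om ^+ r] ^+ 2) <= 0.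
  rewrite sumrB -mulr_sumr hA; [|rewrite /H; lia].
  rewrite hB; [|rewrite /H; lia].
  have := ler_wpM2l (ler0n R H) sum_pB; lra.
have hge (r : 'I_H) : 0 <= nc pA.[z * om ^+ r] ^+ 2 - 4 * nc pB.[z * om ^+ r] ^+ 2.
  have h2 : 0 <= 2 * nc pB.[z * om ^+ r] by rewrite mulr_ge0 ?nc_ge0.
  by have := ler_pM h2 h2 (good r) (good r); rewrite -!expr2 exprMn; lra.
have := hle; rewrite (bigD1 (Ordinal H0)) //= mulr1.
have := hge (Ordinal H0); rewrite /= mulr1 => h1 h2.
have h3 : 0 <= \sum_(r < H | r != Ordinal H0)
   (nc pA.[z * om ^+ r] ^+ 2 - 4 * nc pB.[z * om ^+ r] ^+ 2) by apply: sumr_ge0.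
have : nc pA.[z] ^+ 2 = (2 * nc pB.[z]) ^+ 2 by rewrite exprMn; lra.
by move/eqP; rewrite eqrXn2 ?mulr_ge0 ?nc_ge0 // => /eqP.
Qed.

(** By [pA_pB], [Q pA] vanishes at the Y-th roots of unity because [Q pB = (1 - z^Y) V] does; the
    quotient is [mh]. The rest of [Q e] is Y-periodic and, by [anti], takes opposite values far left
    and far right, hence is 0. *)
Lemma mid_poly : exists2 mh : {poly C}, (forall i, act Q e i = pseq mh (i + n0%:Z)) &
  forall zeta, nc zeta = 1 -> nc mh.[zeta] = 2 * nc V.[zeta].
Proof.
have [hY1 [hY2 hY3]] := Y_large.
have [om hom] := @prim_root_complex R Y hY3.
have uom : nc om = 1 := unity_unim hY3 (prim_expr_order hom).
have hroot i : (Q * pA).[om ^+ i] = 0.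
  apply/eqP; rewrite -nc_eq0 hornerM ncM pA_pB ?unim_exp // mulrCA -ncM -hornerM.
  rewrite QpB hornerM hornerD hornerN hornerXn hornerC -exprM mulnC exprM.
  by rewrite (prim_expr_order hom) expr1n subrr mul0r nc0 mulr0.
have [m hm] : exists m, Q * pA = m * ('X^Y - 1).
  apply/dvdpP; rewrite -(factor_Xn_sub_1 hom).
  rewrite (eq_bigr (fun i => 'X - (om ^+ i)%:P)) //.
  rewrite -(big_map (fun i => om ^+ i) predT (fun z => 'X - z%:P)).
  apply: uniq_roots_dvdp.
    by apply/allP => _ /mapP[i _ ->]; apply/eqP.
  rewrite uniq_rootsE map_inj_in_uniq ?iota_uniq // => i j.
  rewrite !mem_index_iota => /andP[_ hi] /andP[_ hj] /eqP.
  by rewrite (eq_prim_root_expr hom) !modn_small // => /eqP.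
have [mh Em] : exists mh : {poly C}, Q * pA = (1 - 'X^Y) * mh.
  by exists (- m); rewrite hm; ring.
have hmE (i : int) : act Q dA i = pseq (Q * pA) (i + n0%:Z).
  rewrite -act_pseq -(act_shift Q (pseq pA)); apply: eq_act => j.
  exact: dA_pA.
pose f (i : int) := act Q e i - pseq mh (i + n0%:Z).
have fper (i : int) : f i = f (i - Y%:Z).
  apply/eqP; rewrite -subr_eq0 /f.
  have := hmE i; rewrite Em /dA act_seqB (act_shift Q e (- Y%:Z)) -act_pseq actB act1 actXn.
  have -> : i + n0%:Z - Y%:Z = i - Y%:Z + n0%:Z by lia.
  have AC (x y z w : C) : x - y - (z - w) = x - z - (y - w) by ring.
  by move=> h; rewrite AC h subrr.
have fperk (k : nat) (i : int) : f (i + Y%:Z * k%:Z) = f i.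
  elim: k => [|k IH]; first by rewrite mulr0 addr0.
  by rewrite fper -IH; congr f; lia.
have f0 i : f i = 0.
  pose K := (absz i + n0 + size Q + size mh)%N.
  have [Z EZ hZ] : exists2 Z : nat, Y%:Z * K%:Z = Z%:Z & (K <= Z)%N.
    by exists (Y * K)%N; rewrite ?PoszM ?leq_pmull.
  have hK : (absz i + n0 + size Q + size mh <= Z)%N := hZ.
  have fbig : f (i + Y%:Z * K%:Z) = act Q e (i + Y%:Z * K%:Z).
    rewrite /f [pseq _ _](_ : _ = 0) ?subr0 //.
    case E : (_ + n0%:Z) => [j|//] /=; rewrite nth_default //.
    by move: E; rewrite EZ; move: (size mh) (size Q) hK; clear; lia.
  have fsmall : f (i - Y%:Z * K%:Z) = act Q e (i - Y%:Z * K%:Z).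
    rewrite /f [pseq _ _](_ : _ = 0) ?subr0 //.
    case E : (_ + n0%:Z) => [j|//] /=; rewrite nth_default //.
    by move: E; rewrite EZ; move: (size mh) (size Q) hK; clear; lia.
  have fs : f (i - Y%:Z * K%:Z) = f i by rewrite -(fperk K) subrK.
  have E : act Q e (i - Y%:Z * K%:Z) = - act Q e (i + Y%:Z * K%:Z).
    rewrite /act -sumrN; apply: eq_bigr => j _; rewrite -[RHS]mulrN; congr (_ * _).
    have hj := ltn_ord j; apply: anti.
    - by rewrite EZ; move: (size mh) (size Q) (nat_of_ord j) hj hK; clear; lia.
    - by rewrite EZ; move: (size mh) (size Q) (nat_of_ord j) hj hK; clear; lia.
    - by exists (t0%:Z * K%:Z * 2); rewrite !mulrA -[X%:Z * t0%:Z]PoszM -/Y; ring.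
  have := fperk K i; rewrite fbig -fs fsmall E => /eqP.
  rewrite -subr_eq0 opprK -mulr2n -mulr_natl mulf_eq0 pnatr_eq0 /= => /eqP h.
  by rewrite h oppr0.
exists mh => [i|]; first by apply/eqP; rewrite -subr_eq0; apply/eqP/f0.
have G0 : ('X^Y - 1 : {poly C}) != 0 by rewrite monic_neq0 // monicXnsubC.
apply: (circ_ext G0) => z u hz.
have hz' : (1 - 'X^Y : {poly C}).[z] != 0 by rewrite -opprB hornerN oppr_eq0.
have hz0 : 0 < nc (1 - 'X^Y : {poly C}).[z] by rewrite nc_gt0.
apply: (mulfI (lt0r_neq0 hz0)); rewrite -ncM -hornerM -Em mulrCA -ncM -hornerM -QpB.
by rewrite !hornerM !ncM pA_pB // mulrCA.
Qed.

End Rigid.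

(** * Completing P to a square *)

Section Factor.
Context {R : realType}.
Local Notation C := R[i].
Implicit Types (P Q W p q : {poly C}) (rho : C).

(** The product of z - rho with its reversed conjugate: it carries the reflected pair rho,
    1/conj(rho), which is a double zero when rho is unimodular. *)
Definition rfac rho : {poly C} := ('X - rho%:P) * (1 - cj rho *: 'X).

Lemma size_XsubC2 rho : (size ('X - rho%:P : {poly C})%R <= 2)%N.
Proof. by rewrite size_XsubC. Qed.

Lemma star_XsubC rho : star 1 ('X - rho%:P) = 1 - cj rho *: 'X.
Proof.
rewrite starB -[X in star 1 X - _]/('X^1) starXn // subnn expr0; congr (_ - _).
by rewrite -[rho%:P]mulr1 mul_polyC starZ -[1]/('X^0) starXn // subn0 expr1.
Qed.

Lemma star_rfac rho : star 2 (rfac rho) = rfac rho.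
Proof.
have h : (size (1 - cj rho *: 'X : {poly C})%R <= 2)%N.
  by rewrite -star_XsubC size_star.
rewrite /rfac -[2%N]/(1 + 1)%N starM ?size_XsubC2 // star_XsubC.
by rewrite -[X in star 1 X]star_XsubC starK ?size_XsubC2 // mulrC.
Qed.

Lemma size_rfac rho : rho != 0 -> size (rfac rho) = 3%N.
Proof.
move=> r0; have cr : cj rho != 0 by rewrite -nc_gt0 nc_cj nc_gt0.
have E : 1 - cj rho *: 'X = - cj rho *: ('X - ((cj rho)^-1)%:P) :> {poly C}.
  by rewrite scaleNr scalerBr opprB -[cj rho *: _%:P]mul_polyC -polyCM divff.
rewrite /rfac E size_proper_mul ?size_XsubC ?size_scale ?oppr_eq0 ?size_XsubC //.
rewrite lead_coefZ !lead_coefXsubC mul1r mulr1 oppr_eq0 //.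
Qed.

Lemma dvd_sq_of_dup (rs : seq C) : ~~ uniq rs ->
  exists2 r, r \in rs & ('X - r%:P) ^+ 2 %| \prod_(z <- rs) ('X - z%:P).
Proof.
elim: rs => [//|x rs IH] /=; rewrite negb_and negbK big_cons.
case/orP => [hx|/IH[r hr hd]].
  exists x; first by rewrite mem_head.
  by rewrite expr2 dvdp_mul2l ?polyXsubC_eq0 // dvdp_XsubCl root_prod_XsubC.
by exists r; [rewrite in_cons hr orbT|rewrite dvdp_mull].
Qed.

(** Factors [rfac r] are split off by induction, each being of the form w w^* with w going into [W].
    If none divides [P], then all zeros are unimodular and simple, since the zeros of a
    self-reciprocal [P] off the circle come with their reflections; then [Q = W = P] works. *)
Lemma unimodular_factor_aux N P : size P = N.+1 -> star N P = P ->
  exists (Q W : {poly C}) (M : nat) (rs : seq C) (c : C),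
  [/\ P * Q = W * star M W, (size W <= M.+1)%N, (N + size rs = 2 * M)%N,
     uniq rs & [/\ c != 0, Q = c *: \prod_(z <- rs) ('X - z%:P) &
      forall z, z \in rs -> nc z = 1 /\ root P z]].
Proof.
elim/ltn_ind: N P => N IH P sP stP.
have P0 : P != 0 by rewrite -size_poly_gt0 sP.
have coef0 : P`_0 != 0.
  have : P`_0 = cj P`_N by rewrite -{1}stP coef_star // subn0.
  move=> ->; rewrite -nc_gt0 nc_cj nc_gt0.
  by rewrite -[N]/(N.+1.-1) -sP -lead_coefE lead_coef_eq0.
have rt0 r : root P r -> r != 0.
  by apply: contraL => /eqP ->; rewrite /root horner_coef0.
have [[r rr hd]|hno] := pselect (exists2 r, root P r & rfac r %| P).
  have r0 := rt0 _ rr.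
  have [P1 hP1] := dvdpP _ _ hd.
  have P10 : P1 != 0 by apply: contra P0 => /eqP h; rewrite hP1 h mul0r.
  have rf0 : rfac r != 0 by rewrite -size_poly_gt0 size_rfac.
  have sP1 : (size P1 + 3 = N.+2)%N.
    have := size_mul P10 rf0; rewrite -hP1 sP size_rfac //.
    have : (0 < size P1)%N by rewrite size_poly_gt0.
    by move: (size P1); clear; lia.
  have [N1 EN] : exists N1, N = (N1 + 2)%N.
    exists (N - 2)%N; have : (0 < size P1)%N by rewrite size_poly_gt0.
    by move: (size P1) sP1; clear; lia.
  have sP1' : size P1 = N1.+1 by lia.
  have st1 : star N1 P1 = P1.
    apply: (mulIf rf0); rewrite -[in LHS]star_rfac -starM ?sP1' ?size_rfac //.
    by rewrite -EN -hP1.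
  have [|Q [W [M [rs [c [h1 h2 h3 h4 [h5 h6 h7]]]]]]] := IH N1 _ P1 sP1' st1.
    by lia.
  exists Q, (('X - r%:P) * W), M.+1, rs, c; split=> //.
  - rewrite -add1n starM ?size_XsubC2 // star_XsubC hP1 /rfac.
    by rewrite mulrAC h1; ring.
  - apply: leq_trans (size_polyMleq _ _) _; rewrite size_XsubC; move: h2; clear; lia.
  - by move: h3; rewrite EN; clear; lia.
  split=> // z /h7[hz1 hz2]; split=> //.
  by rewrite hP1 rootM hz2.
have hun z : root P z -> nc z = 1.
  move=> rz; apply/eqP/negPn/negP => nz; apply: hno; exists z => //.
  have [P' hP'] := factor_theorem _ _ rz.
  rewrite /rfac Gauss_dvdp; last first.
    rewrite coprimep_sym coprimep_XsubC /root hornerD hornerN hornerZ hornerX hornerC mulrC.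
    rewrite mulcj -(rmorph1 (real_complex R)) -rmorphB.
    rewrite (inj_eq (@complexI R) _ 0) subr_eq0 eq_sym sqrf_eq1 negb_or nz /=.
    by apply/negP => /eqP h; have := nc_ge0 z; rewrite h; lra.
  apply/andP; split; first by rewrite dvdp_XsubCl.
  have P'0 : P' != 0 by apply: contra P0 => /eqP h; rewrite hP' h mul0r.
  have sP' : (size P' + 1 = N.+1)%N.
    have := size_mul P'0 (negbT (polyXsubC_eq0 z)); rewrite -hP' sP size_XsubC.
    by have : (0 < size P')%N; [rewrite size_poly_gt0|move: (size P'); clear; lia].
  have sP'0 : (0 < size P')%N by rewrite size_poly_gt0.
  have [N' EN sP''] : exists2 N' : nat, N = (N' + 1)%N & size P' = N'.+1.
    by exists N.-1; move: (size P') sP' sP'0; clear; lia.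
  rewrite -stP hP' EN starM ?size_XsubC2 ?sP'' //.
  by rewrite star_XsubC dvdp_mull.
have [rs hrs] := closed_field_poly_normal P.
have l0 : lead_coef P != 0 by rewrite lead_coef_eq0.
have hroot z : z \in rs -> root P z.
  by move=> hz; rewrite hrs rootZ // root_prod_XsubC.
have ur : uniq rs.
  apply/negPn/negP => /dvd_sq_of_dup[r hr hd]; apply: hno; exists r; first exact: hroot.
  have ur := hun _ (hroot _ hr); rewrite /rfac.
  have -> : 1 - cj r *: 'X = - cj r *: ('X - r%:P).
    rewrite scaleNr scalerBr opprB -[cj r *: r%:P]mul_polyC -polyCM mulrC.
    by rewrite mulcj ur expr1n (rmorph1 (real_complex R)) polyC1.
  rewrite -scalerAr dvdpZl ?oppr_eq0 -?expr2.
    by rewrite hrs dvdpZr.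
  by rewrite -nc_gt0 nc_cj ur ltr01.
have srs : size rs = N.
  by apply: succn_inj; rewrite -sP [in RHS]hrs size_scale // size_prod_XsubC.
exists P, P, N, rs, (lead_coef P); split=> //; rewrite ?stP ?sP ?srs //; first lia.
by split=> // z /hroot rz; split=> //; apply: hun.
Qed.

Lemma nrm1_prod (rs : seq C) : (forall z, z \in rs -> nc z = 1) ->
  nrm1 (\prod_(z <- rs) ('X - z%:P)) <= 2 ^+ size rs.
Proof.
elim: rs => [|x rs IH] h; first by rewrite big_nil nrm1_1.
rewrite big_cons /= exprS; apply: le_trans (nrm1M _ _) _.
apply: ler_pM; rewrite ?nrm1_ge0 //.
  apply: le_trans (nrm1B _ _) _; rewrite nrm1C h ?mem_head //.
  by rewrite -[X in nrm1 X]/('X^1) nrm1Xn; exact: lexx.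
by apply: IH => z hz; apply: h; rewrite in_cons hz orbT.
Qed.

(* Splitting off the zeros off the circle in pairs, and the unimodular ones up
   to parity, multiplies a self-reciprocal P into a "square" W W^*. *)
Lemma unimodular_factor N P : size P = N.+1 -> star N P = P ->
  exists (Q W : {poly C}) (M k : nat) (rs : seq C),
  [/\ P * Q = W * star M W /\ (size W <= M.+1)%N, (N + k = 2 * M)%N,
     [/\ size Q = k.+1, nc Q`_k = 1, nrm1 Q <= 2 ^+ k & star k Q = Q],
     uniq rs /\ size rs = k & forall z, z \in rs -> nc z = 1 /\ root P z].
Proof.
move=> sP stP; have P0 : P != 0 by rewrite -size_poly_gt0 sP.
have [Q [W [M [rs [c [h1 h2 h3 h4 [h5 h6 h7]]]]]]] := unimodular_factor_aux sP stP.
have c0 : 0 < nc c by rewrite nc_gt0.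
(* A positive scalar makes the leading coefficient of [Q] unimodular and keeps the factorisation:
   its square root goes into [W]. *)
pose kap : R := (nc c)^-1; have k0 : 0 < kap by rewrite invr_gt0.
pose Q' := kap%:C%C *: Q; pose W' := (Num.sqrt kap)%:C%C *: W.
have kc : kap%:C%C * c != 0 by rewrite -nc_gt0 ncM nc_real mulr_gt0 // gtr0_norm.
have knc : nc (kap%:C%C * c) = 1.
  by rewrite ncM nc_real gtr0_norm // /kap mulVf // lt0r_neq0.
have EQ : Q' = (kap%:C%C * c) *: \prod_(z <- rs) ('X - z%:P) by rewrite /Q' h6 scalerA.
have sQ : size Q' = (size rs).+1 by rewrite EQ size_scale // size_prod_XsubC.
have EPQ : P * Q' = W' * star M W'.
  rewrite /Q' /W' starZ conjc_real -scalerAr h1 -scalerAr -scalerAl scalerA.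
  by rewrite -rmorphM -expr2 sqr_sqrtr // ltW.
have sW : (size W' <= M.+1)%N by apply: leq_trans (size_scale_leq _ _) _.
exists Q', W', M, (size rs), rs; split=> //; split=> //.
- rewrite -[size rs]/((size rs).+1.-1) -sQ -lead_coefE EQ lead_coefZ.
  by rewrite (monicP (monic_prod_XsubC _ _ _)) mulr1.
- rewrite EQ nrm1Z knc mul1r; apply: nrm1_prod => z /h7[]//.
apply: (mulfI P0); rewrite -{1}stP -starM ?sP ?sQ // h3 EPQ mul2n -addnn starM ?size_star //.
by rewrite starK // mulrC.
Qed.

End Factor.

(** * Limits along an ultrafilter *)

Section Ulim.
Context {R : realType}.
Local Notation C := R[i].
Variable U : set_system nat.
Hypothesis hU : UltraFilter U.

Definition ev (P : nat -> Prop) : Prop := U [set N | P N]%classic.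

Lemma evW (P Q : nat -> Prop) : (forall N, P N -> Q N) -> ev P -> ev Q.
Proof. by move=> h; apply: filterS. Qed.

Lemma evI (P Q : nat -> Prop) : ev P -> ev Q -> ev (fun N => P N /\ Q N).
Proof. exact: filterI. Qed.

Lemma ev2 (P Q S : nat -> Prop) : (forall N, P N -> Q N -> S N) ->
  ev P -> ev Q -> ev S.
Proof. by move=> h hp hq; apply: evW (evI hp hq) => N []; apply: h. Qed.

Lemma evT (P : nat -> Prop) : (forall N, P N) -> ev P.
Proof. by move=> h; apply: (@filterS _ _ _ setT) => //; exact: filterT. Qed.

Lemma ev_ex (P : nat -> Prop) : ev P -> exists N, P N.
Proof. by move=> /filter_ex. Qed.

(** Ultrafilters are prime; this makes a sequence with finitely many values eventually constant. *)
Lemma ev_or (P Q : nat -> Prop) : ev (fun N => P N \/ Q N) -> ev P \/ ev Q.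
Proof.
move=> h; have [hp|hp] := in_ultra_setVsetC [set N | P N]%classic hU.
  by left.
by right; apply: ev2 h hp => N [].
Qed.

Lemma ev_ord (n : nat) (P : 'I_n -> nat -> Prop) :
  (forall i, ev (P i)) -> ev (fun N => forall i, P i N).
Proof.
move=> h; have : ev (fun N => forall m : nat, (m <= n)%N -> forall i : 'I_n, (i < m)%N -> P i N).
  suff H (m : nat) : ev (fun N => forall i : 'I_n, (i < m)%N -> P i N).
    by apply: evW (H n) => N hN m hm i hi; apply: hN; apply: leq_trans hi hm.
  elim: m => [|m IH]; first by apply: evT.
  have [hm|hm] := ltnP m n; last first.
    by apply: evW IH => N hN i _; apply: hN; apply: leq_trans hm.
  apply: ev2 IH (h (Ordinal hm)) => N h1 h2 i; rewrite ltnS leq_eqVlt.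
  by move=> /orP[/eqP e|/h1//]; rewrite (_ : i = Ordinal hm) //; apply: val_inj.
by apply: evW => N hN i; apply: (hN n).
Qed.

Definition ulim (x : nat -> C) (l : C) : Prop :=
  forall d : R, 0 < d -> ev (fun N => nc (x N - l) < d).

(** The limit is the supremum of the numbers eventually below [x]; the ultrafilter decides the
    opposite inequality. *)
Lemma ulim_exR (x : nat -> R) (B : R) : ev (fun N => `|x N| <= B) ->
  exists l : R, forall d : R, 0 < d -> ev (fun N => `|x N - l| < d).
Proof.
move=> hB; pose A : set R := [set y | ev (fun N => y <= x N)]%classic.
have A0 : A !=set0%classic.
  by exists (- B); apply: evW hB => N; rewrite ler_norml => /andP[].
have Aub : ubound A B.
  move=> y hy; have [N [h1 h2]] := ev_ex (evI hy hB).
  by apply: le_trans h1 _; move: h2; rewrite ler_norml => /andP[].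
have hs : has_sup A by split => //; exists B.
exists (sup A) => d d0.
have [y Ay hy] := sup_adherent d0 hs.
have h2 : ev (fun N => x N < sup A + d).
  have := @in_ultra_setVsetC _ _ [set N | sup A + d <= x N]%classic hU.
  case=> h; last by apply: evW h => N /negP; rewrite -ltNge.
  have := sup_upper_bound hs (h : A (sup A + d)); lra.
apply: ev2 Ay h2 => N h3 h4; rewrite ltr_norml; apply/andP; split; lra.
Qed.

Lemma nc_le_ReIm (z : C) : nc z <= `|complex.Re z| + `|complex.Im z|.
Proof.
rewrite -(@ler_pXn2r _ 2) ?nnegrE ?nc_ge0 ?addr_ge0 // nc_sq.
rewrite -(real_normK (num_real (complex.Re z))) -(real_normK (num_real (complex.Im z))).
have := mulr_ge0 (normr_ge0 (complex.Re z)) (normr_ge0 (complex.Im z)).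
by rewrite sqrrD; lra.
Qed.

Lemma ReIm_le_nc (z : C) : `|complex.Re z| <= nc z /\ `|complex.Im z| <= nc z.
Proof.
split; rewrite -(@ler_pXn2r _ 2) ?nnegrE ?nc_ge0 // nc_sq real_normK ?num_real //.
  by rewrite lerDl sqr_ge0.
by rewrite lerDr sqr_ge0.
Qed.

Lemma ulim_ex (x : nat -> C) (B : R) : ev (fun N => nc (x N) <= B) -> exists l, ulim x l.
Proof.
move=> hB.
have [a ha] : exists l : R, forall d : R, 0 < d -> ev (fun N => `|complex.Re (x N) - l| < d).
  apply: (@ulim_exR _ B); apply: evW hB => N h.
  by apply: le_trans h; have [] := ReIm_le_nc (x N).
have [b hb] : exists l : R, forall d : R, 0 < d -> ev (fun N => `|complex.Im (x N) - l| < d).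
  apply: (@ulim_exR _ B); apply: evW hB => N h.
  by apply: le_trans h; have [] := ReIm_le_nc (x N).
exists (Complex a b) => d d0; have d2 : 0 < d / 2 by lra.
apply: ev2 (ha _ d2) (hb _ d2) => N h1 h2.
apply: le_lt_trans (nc_le_ReIm _) _; case: (x N) h1 h2 => u v /=; lra.
Qed.

Lemma ulim_cst (l : C) : ulim (fun=> l) l.
Proof. by move=> d d0; apply: evT => N; rewrite subrr nc0. Qed.

Lemma ulim_eq (x y : nat -> C) l : ev (fun N => x N = y N) -> ulim x l -> ulim y l.
Proof. by move=> h hx d d0; apply: ev2 h (hx d d0) => N ->. Qed.

Lemma ulimD (x y : nat -> C) l m : ulim x l -> ulim y m -> ulim (fun N => x N + y N) (l + m).
Proof.
move=> hx hy d d0; have d2 : 0 < d / 2 by lra.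
apply: ev2 (hx _ d2) (hy _ d2) => N h1 h2.
have -> : x N + y N - (l + m) = (x N - l) + (y N - m) by ring.
by have := ncD (x N - l) (y N - m); lra.
Qed.

Lemma ulimM (x y : nat -> C) l m : ulim x l -> ulim y m -> ulim (fun N => x N * y N) (l * m).
Proof.
move=> hx hy d d0; set K := nc l + nc m + 1.
have K0 : 0 < K by rewrite /K; have := nc_ge0 l; have := nc_ge0 m; lra.
pose d1 := Num.min 1 (d / (2 * K)).
have dK : 0 < d / (2 * K) by rewrite divr_gt0 // mulr_gt0.
have d10 : 0 < d1 by rewrite lt_min ltr01.
apply: ev2 (hx _ d10) (hy _ d10) => N; rewrite !lt_min => /andP[h1 h2] /andP[h3 h4].
have -> : x N * y N - l * m = (x N - l) * (y N - m) + ((x N - l) * m + l * (y N - m)) by ring.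
apply: le_lt_trans (ncD _ _) _; apply: le_lt_trans (lerD (lexx _) (ncD _ _)) _.
rewrite !ncM; set a := nc (x N - l) in h1 h2 *; set b := nc (y N - m) in h3 h4 *.
have a0 : 0 <= a := nc_ge0 _; have b0 : 0 <= b := nc_ge0 _.
have e1 : a * b <= a by rewrite ler_piMr // ltW.
have e2 : a * nc m <= d / (2 * K) * nc m by rewrite ler_wpM2r ?nc_ge0 // ltW.
have e3 : nc l * b <= d / (2 * K) * nc l by rewrite mulrC ler_wpM2r ?nc_ge0 // ltW.
have e4 : d / (2 * K) * K = d / 2 by field; rewrite lt0r_neq0.
have : d / (2 * K) * nc m + d / (2 * K) * nc l + d / (2 * K) = d / 2.
  by rewrite -e4 /K; ring.
by lra.
Qed.

Lemma ulim_sum (n : nat) (x : 'I_n -> nat -> C) (l : 'I_n -> C) :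
  (forall i, ulim (x i) (l i)) -> ulim (fun N => \sum_(i < n) x i N) (\sum_(i < n) l i).
Proof.
elim: n x l => [|n IH] x l h.
  rewrite big_ord0; apply: ulim_eq (ulim_cst 0); apply: evT => N.
  by rewrite big_ord0.
rewrite big_ord_recl; have := ulimD (h ord0) (IH _ _ (fun i => h (lift ord0 i))).
by apply: ulim_eq; apply: evT => N; rewrite big_ord_recl.
Qed.

Lemma ulim_cj (x : nat -> C) l : ulim x l -> ulim (fun N => cj (x N)) (cj l).
Proof.
by move=> h d d0; apply: evW (h d d0) => N; rewrite -rmorphB nc_cj.
Qed.

Lemma ulim_uniq (x : nat -> C) l m : ulim x l -> ulim x m -> l = m.
Proof.
move=> hl hm; apply/eqP/negPn/negP => lm.
have d0 : 0 < nc (l - m) / 2 by rewrite divr_gt0 // nc_gt0 subr_eq0.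
have [N [h1 h2]] := ev_ex (evI (hl _ d0) (hm _ d0)).
have := ncD (l - x N) (x N - m); rewrite addrA subrK (ncBC l); lra.
Qed.

Lemma ulim_pos (x y : nat -> C) l m : ulim x l -> ulim y m ->
  ev (fun N => 2 * nc (y N) <= complex.Re (x N)) -> 2 * nc m <= complex.Re l.
Proof.
move=> hx hy h; apply/ler_addgt0Pr => d d0; have d3 : 0 < d / 3 by lra.
have [N [h0 [h1 h2]]] := ev_ex (evI h (evI (hx _ d3) (hy _ d3))).
have := Re_le (x N - l); rewrite raddfB /= => h3.
by have := ncBB m (y N); rewrite ncBC; lra.
Qed.

Lemma ulim_Re_le (x : nat -> C) l (B : R) : ulim x l ->
  ev (fun N => complex.Re (x N) <= B) -> complex.Re l <= B.
Proof.
move=> hx h; apply/ler_addgt0Pr => d d0.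
have [N [h0 h1]] := ev_ex (evI h (hx _ d0)).
have := Re_le (l - x N); rewrite raddfB /= ncBC => h3.
by lra.
Qed.

Lemma ulim_nc1 (x : nat -> C) l : ulim x l -> ev (fun N => nc (x N) = 1) -> nc l = 1.
Proof.
move=> hx h; apply/eqP; rewrite eq_le; apply/andP; split; apply/ler_addgt0Pr => d d0;
  have [N [h0 h1]] := ev_ex (evI h (hx _ d0)).
  by have := ncBB l (x N); rewrite ncBC; lra.
by have := ncBB (x N) l; lra.
Qed.

Lemma ulim_pm1 (x : nat -> C) : ev (fun N => pm1 (x N)) ->
  exists l, [/\ pm1 l, ulim x l & ev (fun N => x N = l)].
Proof.
case/ev_or => h; [exists 1|exists (-1)]; split=> //; try by [left|right].
  by apply: ulim_eq (ulim_cst 1); apply: evW h.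
by apply: ulim_eq (ulim_cst (-1)); apply: evW h.
Qed.

End Ulim.

(** * Tails of square-summable sequences and sums with finitely many values *)

Section Tail.
Context {R : realType}.
Local Notation C := R[i].

Lemma l2_tail (a : nat -> R) (B d : R) : (forall i, 0 <= a i) -> 0 < d ->
  (forall n : nat, \sum_(i < n) a i <= B) ->
  exists n1 : nat, forall n : nat, \sum_(n1 <= i < n) a i <= d.
Proof.
move=> a0 d0 hB; apply: contrapT => /forallNP h.
have h1 n1 : exists n : nat, d < \sum_(n1 <= i < n) a i.
  by have /existsNP[n /negP] := h n1; rewrite -ltNge; exists n.
have h2 k : exists m : nat, k%:R * d <= \sum_(i < m) a i.
  elim: k => [|k [m hm]]; first by exists 0%N; rewrite big_ord0 mul0r.
  have [n hn] := h1 m; exists n.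
  have mn : (m <= n)%N.
    rewrite leqNgt; apply/negP => nm; move: hn; rewrite big_geq ?(ltnW nm) //; lra.
  rewrite -(big_mkord predT a) (@big_cat_nat _ _ _ m) //= big_mkord.
  by rewrite -[k.+1%:R]natr1; lra.
have [m hm] := h2 (Num.bound (`|B| / d)).+1.
have := archi_boundP (divr_ge0 (normr_ge0 B) (ltW d0)); rewrite ltr_pdivrMr //.
by have := hB m; have := ler_norm B; move: hm; rewrite -[_.+1%:R]natr1; lra.
Qed.

(** In each product one index is large: for [i >= n1] the tail of [x] is small, for the others that
    of [y]. The AM-GM weight [tau] is such that the remaining factor contributes at most
    [tau * B <= eps / 2]. *)
Lemma conv_l2_vanish (x y : nat -> C) (B eps : R) : 0 < eps ->
  (forall n : nat, \sum_(i < n) nc (x i) ^+ 2 <= B) ->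
  (forall n : nat, \sum_(i < n) nc (y i) ^+ 2 <= B) ->
  exists n1 : nat, forall n, (n1 <= n)%N ->
    nc (\sum_(i < n.+1) x i * y (n - i)%N) <= eps.
Proof.
move=> e0 hx hy; have B0 : 0 <= B by have := hx 0%N; rewrite big_ord0.
pose tau := eps / (2 * (B + 1)).
have tau0 : 0 < tau by rewrite divr_gt0 //; lra.
have sq (n : nat) (z : nat -> C) : 0 <= nc (z n) ^+ 2 by exact: sqr_ge0.
have d0 : 0 < tau * eps / 2 by rewrite divr_gt0 // mulr_gt0.
have [n1 h1] := l2_tail (fun n => sq n x) d0 hx.
have [n2 h2] := l2_tail (fun n => sq n y) d0 hy.
have amgm (u v : R) : 2 * (u * v) <= u ^+ 2 / tau + tau * v ^+ 2.
  have := sqr_ge0 (u - tau * v).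
  have -> : u ^+ 2 / tau + tau * v ^+ 2 = (u ^+ 2 + (tau * v) ^+ 2) / tau.
    by rewrite exprMn; field; rewrite lt0r_neq0.
  by rewrite ler_pdivlMr // sqrrB; lra.
exists (n1 + n2)%N => n hn; apply: le_trans (nc_sum _ _ _) _.
rewrite -(big_mkord predT (fun i => nc (x i * y (n - i)%N))).
rewrite (@big_cat_nat _ _ _ n1) //=; last by lia.
have part1 : 2 * \sum_(0 <= i < n1) nc (x i * y (n - i)%N) <= tau * B + eps / 2.
  apply: (@le_trans _ _ (\sum_(0 <= i < n1) (nc (y (n - i)%N) ^+ 2 / tau + tau * nc (x i) ^+ 2))).
    by rewrite mulr_sumr; apply: ler_sum => i _; rewrite ncM [nc (x i) * _]mulrC amgm.
  rewrite big_split /= -mulr_suml -mulr_sumr addrC lerD //.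
    by rewrite (ler_wpM2l (ltW tau0)) // big_mkord.
  rewrite ler_pdivrMr //; have -> : eps / 2 * tau = tau * eps / 2 by ring.
  apply: le_trans (h2 n.+1).
  have -> : \sum_(0 <= i < n1) nc (y (n - i)%N) ^+ 2 =
     \sum_(n.+1 - n1 <= i < n.+1) nc (y i) ^+ 2.
    rewrite [LHS]big_nat_rev /= add0n -[in RHS](add0n (n.+1 - n1)%N) [RHS]big_addn.
    have -> : (n.+1 - (n.+1 - n1) = n1)%N by lia.
    by apply: eq_big_nat => i /andP[_ hi]; congr (nc (y _) ^+ 2); lia.
  rewrite [leRHS](@big_cat_nat _ _ _ (n.+1 - n1)) /=; [|lia|lia].
  by rewrite lerDr sumr_ge0.
have part2 : 2 * \sum_(n1 <= i < n.+1) nc (x i * y (n - i)%N) <= eps / 2 + tau * B.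
  apply: (@le_trans _ _ (\sum_(n1 <= i < n.+1) (nc (x i) ^+ 2 / tau + tau * nc (y (n - i)%N) ^+ 2))).
    by rewrite mulr_sumr; apply: ler_sum => i _; rewrite ncM amgm.
  rewrite big_split /= -mulr_suml -mulr_sumr lerD //.
    by rewrite ler_pdivrMr //; have -> : eps / 2 * tau = tau * eps / 2 by ring.
  rewrite (ler_wpM2l (ltW tau0)) //; apply: le_trans (hy (n.+1 - n1)%N).
  rewrite -(add0n n1) big_addn -(big_mkord predT (fun i => nc (y i) ^+ 2)).
  rewrite [leRHS]big_nat_rev /= add0n ler_sum_nat // => i /andP[_ hi].
  by rewrite le_eqVlt; apply/orP; left; apply/eqP; congr (nc (y _) ^+ 2); lia.
have : tau * B <= eps / 2.
  rewrite /tau mulrAC ler_pdivrMr; last lra.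
  have := mulr_ge0 (ltW e0) B0; lra.
lra.
Qed.

Lemma finite_values_gap (T : finType) (f : T -> C) :
  exists2 d : R, 0 < d & forall t, f t = 0 \/ d <= nc (f t).
Proof.
pose d := \prod_(t | f t != 0) Num.min 1 (nc (f t)).
have hm t : f t != 0 -> 0 < Num.min 1 (nc (f t)) by move=> h; rewrite lt_min ltr01 nc_gt0.
exists d => [|t]; first by apply: prodr_gt0.
have [->|ft] := eqVneq (f t) 0; [by left|right].
rewrite /d (bigD1 t) //=; apply: (@le_trans _ _ (Num.min 1 (nc (f t)))).
  apply: ler_piMr; first by rewrite ltW ?hm.
  suff /andP[] : 0 <= \prod_(i | (f i != 0) && (i != t)) Num.min 1 (nc (f i)) <= 1 by [].
  apply: (big_ind (fun x : R => 0 <= x <= 1)); first by rewrite ler01 lexx.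
    by move=> u v /andP[u0 u1] /andP[v0 v1]; rewrite mulr_ge0 // mulr_ile1.
  by move=> t' /andP[h _]; rewrite ltW ?hm //= ge_min lexx.
by rewrite ge_min lexx orbT.
Qed.

(** There are finitely many sign patterns, so nonzero sums stay away from 0 uniformly in the signs.
    This turns small errors into exact zeros. *)
Lemma signed_gap (q : nat -> C) (k : nat) :
  exists2 d : R, 0 < d & forall t : nat -> C, (forall j, (j < k)%N -> pm1 (t j)) ->
    \sum_(j < k) q j * t j = 0 \/ d <= nc (\sum_(j < k) q j * t j).
Proof.
have [d d0 h] := finite_values_gap (fun t : {ffun 'I_k -> bool} =>
   \sum_(j < k) q j * (-1) ^+ t j).
exists d => // t ht; have := h [ffun j : 'I_k => t j == -1].
suff -> : \sum_(j < k) q j * (-1) ^+ [ffun j : 'I_k => t j == -1] j = \sum_(j < k) q j * t j by [].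
apply: eq_bigr => j _; rewrite ffunE; congr (_ * _).
case: (ht j (ltn_ord j)) => ->; last by rewrite eqxx expr1.
rewrite (_ : (1 == -1 :> C) = false) ?expr0 //.
by apply/negbTE; rewrite -subr_eq0 opprK -[1 + 1]/(2%:R) pnatr_eq0.
Qed.

(* Pigeonhole on the windows of k consecutive signs. *)
Lemma recurrence_periodic (q : nat -> C) (k n1 : nat) (b : nat -> C) : q 0%N != 0 ->
  (forall n, pm1 (b n)) ->
  (forall n, (n1 <= n)%N -> \sum_(j < k.+1) q j * b (n + k - j)%N = 0) ->
  exists X a : nat, (0 < X)%N /\ forall n, (a <= n)%N -> b (n + X)%N = b n.
Proof.
move=> q0 hb hrec.
have b1 : (1 == -1 :> C) = false.
  by apply/negbTE; rewrite -subr_eq0 opprK -[1 + 1]/(2%:R) pnatr_eq0.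
pose w (i : 'I_(2 ^ k).+1) := [ffun j : 'I_k => b (n1 + i + j)%N == 1].
have : ~~ injectiveb w.
  apply/negP => /injectiveP/leq_card; rewrite card_ffun !card_ord card_bool.
  by rewrite ltnn.
case/injectivePn => i [j ij wij].
wlog lij : i j ij wij / (i < j)%N.
  move=> H; have [h|h|/val_inj h] := ltngtP i j; [exact: (H i j)| |by rewrite h eqxx in ij].
  by apply: (H j i); rewrite // eq_sym.
have eqb (m : nat) : b (n1 + i + m)%N = b (n1 + j + m)%N.
  elim/ltn_ind: m => m IH; case: (ltnP m k) => hm.
    have := congr1 (fun f : {ffun 'I_k -> bool} => f (Ordinal hm)) wij.
    rewrite !ffunE /=; case: (hb (n1 + i + m)%N) => ->; case: (hb (n1 + j + m)%N) => -> //;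
    by rewrite ?eqxx eq_sym b1.
  have r1 := hrec (n1 + i + (m - k))%N; have r2 := hrec (n1 + j + (m - k))%N.
  have {}r1 := r1 (leq_trans (leq_addr _ _) (leq_addr _ _)).
  have {}r2 := r2 (leq_trans (leq_addr _ _) (leq_addr _ _)).
  move: r1 r2; rewrite !big_ord_recl !subn0 => r1 r2.
  apply: (mulfI q0).
  have e1 : (n1 + i + (m - k) + k = n1 + i + m)%N by lia.
  have e2 : (n1 + j + (m - k) + k = n1 + j + m)%N by lia.
  rewrite e1 in r1; rewrite e2 in r2.
  have E : \sum_(t < k) q (lift ord0 t) * b (n1 + i + m - lift ord0 t)%N =
           \sum_(t < k) q (lift ord0 t) * b (n1 + j + m - lift ord0 t)%N.
    apply: eq_bigr => t _; congr (_ * _); have ht := ltn_ord t; rewrite lift0.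
    have -> : (n1 + i + m - t.+1 = n1 + i + (m - t.+1))%N by lia.
    by rewrite IH; [congr b|]; lia.
  by apply: (addIr (\sum_(t < k) q (lift ord0 t) * b (n1 + i + m - lift ord0 t)%N));
     rewrite r1 E r2.
exists (j - i)%N, (n1 + i)%N; split; first by rewrite subn_gt0.
move=> n hn; have -> : (n = n1 + i + (n - (n1 + i)))%N by lia.
by rewrite eqb; congr b; lia.
Qed.

End Tail.

(** * Smallness of W in the middle *)

Section Window.
Context {R : realType}.
Local Notation C := R[i].
Implicit Types (p q D w : {poly C}) (zeta : C).

Lemma size_dil_eq zeta p : zeta != 0 -> size (dil zeta p) = size p.
Proof.
move=> z0; apply/eqP; rewrite eqn_leq size_dil /=.
by rewrite -{1}(dilK p (invr_neq0 z0)) invrK size_dil.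
Qed.

Lemma nrm1_dil zeta p : nc zeta = 1 -> nrm1 (dil zeta p) = nrm1 p.
Proof.
move=> u; rewrite /nrm1 size_dil_eq ?unim_neq0 //; apply: eq_bigr => i _.
by rewrite coef_dil ncM unim_exp ?mul1r.
Qed.

Lemma pseq_dil zeta p (i : int) : pseq (dil zeta p) i = zeta ^ i * pseq p i.
Proof. by case: i => n /=; rewrite ?mulr0 // coef_dil. Qed.

Lemma geo_dil zeta L : nc zeta = 1 ->
  dil zeta (geo L.+1) * star L (dil zeta (geo L.+1)) =
  zeta ^- L *: dil zeta (geo L.+1 * geo L.+1).
Proof.
move=> u; have z0 := unim_neq0 u.
have ui : nc zeta^-1 = 1 by rewrite ncV u invr1.
have := star_dil L (geo L.+1) ui; rewrite invrK star_geo => h.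
by rewrite -[star L _](dilK _ z0) h exprVn /dil comp_polyZ -scalerAr comp_polyM.
Qed.

Lemma pseqZ (c : C) p (i : int) : pseq (c *: p) i = c * pseq p i.
Proof. by case: i => n /=; rewrite ?mulr0 // coefZ. Qed.

(** [geo2_peak] for the rotated kernel, which singles out the point [zeta^-1] instead of 1. *)
Lemma twist_peak zeta p (d : int) L : nc zeta = 1 ->
  nc (pseq (p * (dil zeta (geo L.+1) * star L (dil zeta (geo L.+1)))) (L%:Z + d)
      - L.+1%:R * (zeta ^ d * p.[zeta^-1])) <= nrm1 p * (absz d + size p)%:R.
Proof.
move=> u; have z0 := unim_neq0 u.
have ui : nc zeta^-1 = 1 by rewrite ncV u invr1.
rewrite geo_dil // -[X in pseq (X * _)](dilK p z0) -scalerAr -dilM.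
have := geo2_peak (dil zeta^-1 p) d L; rewrite nrm1_dil // size_dil_eq ?invr_neq0 //.
rewrite dil_horner mulr1.
set g := dil zeta^-1 p * _; set x := p.[_].
have E : zeta ^- L * zeta ^ (L%:Z + d) = zeta ^ d.
  by rewrite exprnN -expfzDr //; congr (_ ^ _); lia.
rewrite pseqZ pseq_dil [zeta ^- L * _]mulrA E [L.+1%:R * (_ * _)]mulrCA -mulrBr ncM.
by rewrite unim_expz // mul1r.
Qed.

Lemma coef_mul_geo w zeta L i : (L <= i)%N ->
  (w * dil zeta (geo L.+1))`_i = (\poly_(r < L.+1) w`_(i - r)).[zeta].
Proof.
move=> hi; have -> : (w * dil zeta (geo L.+1))`_i = pseq (dil zeta (geo L.+1) * w) i%:Z.
  by rewrite mulrC.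
rewrite -act_pseq (act_widen _ _ (leq_trans (size_dil _ _) (size_geo _))) horner_poly.
apply: eq_bigr => r _; have hr : (r <= i)%N by have := ltn_ord r; lia.
rewrite coef_dil coef_geo ltn_ord mulr1 mulrC; congr (_ * _).
by have -> : i%:Z - r%:Z = (i - r)%N%:Z by lia.
Qed.

(** A coefficient of [w] times the twisted kernel is a twisted sum over a window of length L + 1. By
    Parseval its square averages over the roots of unity to the square sum of the window, and each
    [j] of the inner range lies in L + 1 windows. *)
Lemma avg_window w M L (B : R) : (L <= M)%N ->
  (forall zeta, zeta ^+ L.+1 = 1 ->
     \sum_(L.+1 <= i < M) nc (w * dil zeta (geo L.+1))`_i ^+ 2 <= B) ->
  L.+1%:R * \sum_(L.+1 <= j < M - L) nc w`_j ^+ 2 <= B.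
Proof.
move=> hLM hB; have [om hom] := @prim_root_complex R L.+1 isT.
have hs : \sum_(r < L.+1) \sum_(L.+1 <= i < M) nc (w * dil (om ^+ r) (geo L.+1))`_i ^+ 2
    <= \sum_(r < L.+1) B.
  apply: ler_sum => r _; apply: hB.
  by rewrite -exprM mulnC exprM (prim_expr_order hom) expr1n.
rewrite exchange_big /= sumr_const card_ord -[B *+ _]mulr_natl in hs.
have E : \sum_(L.+1 <= i < M) \sum_(r < L.+1) nc (w * dil (om ^+ r) (geo L.+1))`_i ^+ 2
  = L.+1%:R * \sum_(L.+1 <= i < M) \sum_(r < L.+1) nc w`_(i - r) ^+ 2.
  rewrite [RHS]mulr_sumr; apply: eq_big_nat => i /andP[hi _].
  under eq_bigr => r _ do rewrite coef_mul_geo ?(ltnW hi) // -[om ^+ r]mul1r.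
  rewrite (parseval hom nc1) ?size_poly //; congr (_ * _).
  by apply: eq_bigr => r _; rewrite coef_poly ltn_ord.
rewrite E ler_pM2l ?ltr0n // in hs; apply: le_trans hs.
rewrite [leRHS]exchange_big /=.
have -> : L.+1%:R * \sum_(L.+1 <= j < M - L) nc w`_j ^+ 2 =
    \sum_(r < L.+1) \sum_(L.+1 <= j < M - L) nc w`_j ^+ 2.
  by rewrite sumr_const card_ord mulr_natl.
apply: ler_sum => r _; have hr := ltn_ord r.
have [hm|hm] := leqP (M - L) L.+1.
  by rewrite [leLHS]big_geq //; apply: sumr_ge0 => i _; exact: sqr_ge0.
rewrite [leRHS](@big_cat_nat _ _ _ (L.+1 + r)) ?leq_addr /=; [|by []|]; last first.
  by move: hm hr; lia.
apply: ler_wpDl; first by apply: sumr_ge0 => i _; exact: sqr_ge0.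
rewrite big_addn [leRHS](@big_cat_nat _ _ _ (M - L)) /=; [|exact: ltnW|]; last first.
  by move: hm hr; lia.
apply: ler_wpDr; first by apply: sumr_ge0 => i _; exact: sqr_ge0.
by apply: ler_sum => i _; rewrite addnK.
Qed.

(* A product w_i conj(w_j) in the n-th coefficient always has i or j in the window. *)
Lemma mid_conv w M L n (B eps tau : R) : (size w <= M.+1)%N -> 0 < tau ->
  \sum_(i < M.+1) nc w`_i ^+ 2 <= B ->
  \sum_(L.+1 <= j < M - L) nc w`_j ^+ 2 <= eps ->
  (2 * L < n)%N -> (n + L < M)%N ->
  nc (w * star M w)`_n <= 2 * (tau * B + tau^-1 * eps).
Proof.
move=> hw t0 hB he h1 h2.
pose x i := nc w`_i ^+ 2; have x0 i : 0 <= x i by exact: sqr_ge0.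
pose mid i := (L.+1 <= i < M - L)%N; pose y i := (mid i)%:R * x i.
have y0 i : 0 <= y i by rewrite mulr_ge0 ?ler0n.
have shift a (f : nat -> R) : (a + n <= M)%N -> (forall i, 0 <= f i) ->
    \sum_(i < n.+1) f (a + i)%N <= \sum_(i < M.+1) f i.
  move=> ha f0; rewrite -(big_mkord predT (fun i => f (a + i)%N)) -(big_mkord predT f) /=.
  rewrite [leRHS](@big_cat_nat _ _ _ a) //=; last by lia.
  apply: ler_wpDl; first by apply: sumr_ge0.
  have -> : \sum_(a <= i < M.+1) f i = \sum_(0 <= i < M.+1 - a) f (i + a)%N.
    by rewrite -{1}[a]add0n big_addn.
  rewrite [leRHS](@big_cat_nat _ _ _ n.+1) //=; last by lia.
  apply: ler_wpDr; first by apply: sumr_ge0.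
  by apply: ler_sum => i _; rewrite addnC.
have hyE : \sum_(i < M.+1) y i <= eps.
  apply: le_trans he; rewrite -(big_mkord predT y) /=.
  rewrite (@big_cat_nat _ _ _ L.+1) //=; last by lia.
  rewrite [X in X + _]big_nat [X in X + _]big1 ?add0r => [|i hi]; last first.
    by rewrite /y (_ : mid i = false) ?mul0r //; move: hi; rewrite /mid; lia.
  rewrite (@big_cat_nat _ _ _ (M - L)) /=; [|lia|lia].
  rewrite [X in _ + X]big_nat [X in _ + X]big1 ?addr0 => [|i hi]; last first.
    by rewrite /y (_ : mid i = false) ?mul0r //; move: hi; rewrite /mid; lia.
  by apply: ler_sum => i _; rewrite /y ler_piMl //; case: (mid i).
have ht : 0 <= tau^-1 by rewrite invr_ge0 ltW.
rewrite coefM; apply: le_trans (nc_sum _ _ _) _.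
pose m := (M - n)%N.
have term (i : 'I_n.+1) : nc (w`_i * (star M w)`_(n - i)) <=
   tau * (x (0 + i)%N + x (m + i)%N) + tau^-1 * (y (0 + i)%N + y (m + i)%N).
  have hi := ltn_ord i; rewrite coef_star; last by lia.
  have -> : (M - (n - i))%N = (m + i)%N by rewrite /m; lia.
  rewrite ncM nc_cj add0n.
  have AG (u v : R) : u * v <= tau * v ^+ 2 + tau^-1 * u ^+ 2.
    have h3 : tau * tau^-1 = 1 by rewrite divff ?lt0r_neq0.
    have h4 : 0 <= tau^-1 * (tau * v - u) ^+ 2 by rewrite mulr_ge0 ?sqr_ge0.
    have h5 : tau^-1 * (tau * v - u) ^+ 2 = (tau * tau^-1) * (tau * v ^+ 2 - 2 * (u * v)) + tau^-1 * u ^+ 2.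
      by ring.
    rewrite h5 h3 mul1r in h4.
    have := mulr_ge0 ht (sqr_ge0 u); have := mulr_ge0 (ltW t0) (sqr_ge0 v); lra.
  have [hm|hm] := boolP (mid i).
    have -> : y i = x i by rewrite /y hm mul1r.
    apply: le_trans (AG _ _) _; rewrite -/(x i) -/(x _) !mulrDr.
    by have := mulr_ge0 (ltW t0) (x0 i); have := mulr_ge0 ht (y0 (m + i)%N); lra.
  have -> : y (m + i)%N = x (m + i)%N.
    by rewrite /y (_ : mid _ = true) ?mul1r //; move: hm; rewrite /mid /m; lia.
  rewrite mulrC; apply: le_trans (AG _ _) _; rewrite -/(x i) -/(x _) !mulrDr.
  by have := mulr_ge0 (ltW t0) (x0 (m + i)%N); have := mulr_ge0 ht (y0 i); lra.
apply: le_trans (ler_sum _ (fun i _ => term i)) _.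
rewrite big_split /= -!mulr_sumr !big_split /=.
have s1 := shift 0%N x; have s2 := shift m x; have s3 := shift 0%N y; have s4 := shift m y.
have hm : (m + n <= M)%N by rewrite /m; move: h2; clear; lia.
have hn : (0 + n <= M)%N by move: h2; clear; lia.
have {}s1 := le_trans (s1 hn x0) hB; have {}s2 := le_trans (s2 hm x0) hB.
have {}s3 := le_trans (s3 hn y0) hyE; have {}s4 := le_trans (s4 hm y0) hyE.
have := ler_wpM2l (ltW t0) (lerD s1 s2); have := ler_wpM2l ht (lerD s3 s4).
lra.
Qed.

End Window.

(** * Unimodular points with a prescribed argument *)

Section Arcs.
Context {R : realType}.
Local Notation C := R[i].
Implicit Types (p q V : {poly C}).

Definition cis (t : R) : C := Complex (cos t) (sin t).

Lemma cisD a b : cis (a + b) = cis a * cis b.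
Proof. by rewrite /cis cosD sinD; apply/eqP; rewrite eq_complex /= addrC !eqxx addrC eqxx. Qed.

Lemma cis0 : cis 0 = 1.
Proof. by rewrite /cis cos0 sin0. Qed.

Lemma nc_cis t : nc (cis t) = 1.
Proof.
apply/eqP; rewrite -(@eqrXn2 _ 2) ?nc_ge0 // nc_sq /= cos2Dsin2 expr1n //.
Qed.

Lemma cisMn t n : cis (t *+ n) = cis t ^+ n.
Proof.
by elim: n => [|n IH]; rewrite ?mulr0n ?cis0 // mulrS cisD IH exprS.
Qed.

Lemma cis_pi : cis pi = -1.
Proof. by rewrite /cis cospi sinpi; apply/eqP; rewrite eq_complex /= oppr0 !eqxx. Qed.

Lemma cis_polar (z : C) : nc z = 1 -> exists2 t, `|t| <= pi & cis t = z.
Proof.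
case: z => a b u.
have h : a ^+ 2 + b ^+ 2 = 1 by have := nc_sq (Complex a b); rewrite u expr1n.
have ha : -1 <= a <= 1.
  by rewrite -ler_norml -(@ler_pXn2r _ 2) ?nnegrE // real_normK ?num_real // expr1n -h lerDl sqr_ge0.
have c : cos (acos a) = a by rewrite acosK // in_itv.
have s : sin (acos a) = `|b|.
  by rewrite sin_acos // -h addrC addKr sqrtr_sqr.
have h0 := acos_ge0 ha; have hp := acos_lepi ha.
have [b0|b0] := lerP 0 b.
  exists (acos a); first by rewrite ger0_norm.
  by rewrite /cis c s ger0_norm.
exists (- acos a); first by rewrite normrN ger0_norm.
by rewrite /cis cosN sinN c s ltr0_norm ?opprK.
Qed.

Lemma cont_cis p : continuous (fun t => complex.Re p.[cis t]) /\
  continuous (fun t => complex.Im p.[cis t]).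
Proof.
elim/poly_ind: p => [|p c [IH1 IH2]].
  by split=> t; under eq_fun do rewrite horner0; exact: cvg_cst.
have ER t : complex.Re (p * 'X + c%:P).[cis t] =
    complex.Re p.[cis t] * cos t - complex.Im p.[cis t] * sin t + complex.Re c.
  by rewrite hornerMXaddC; case: (p.[_]) => x y; case: (c).
have EI t : complex.Im (p * 'X + c%:P).[cis t] =
    complex.Re p.[cis t] * sin t + complex.Im p.[cis t] * cos t + complex.Im c.
  by rewrite hornerMXaddC; case: (p.[_]) => x y; case: (c).
split=> t.
  rewrite (_ : (fun _ => _) = (fun t => complex.Re p.[cis t] * cos t - complex.Im p.[cis t] * sin t + complex.Re c)); last exact/funext.
  apply: cvgD; last exact: cvg_cst.
  apply: cvgB; apply: cvgM; [exact: IH1|exact: continuous_cos|exact: IH2|exact: continuous_sin].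
rewrite (_ : (fun _ => _) = (fun t => complex.Re p.[cis t] * sin t + complex.Im p.[cis t] * cos t + complex.Im c)); last exact/funext.
apply: cvgD; last exact: cvg_cst.
apply: cvgD; apply: cvgM; [exact: IH1|exact: continuous_sin|exact: IH2|exact: continuous_cos].
Qed.

Lemma near_cis p t0 (r : R) : 0 < r -> exists2 d : R, 0 < d &
  forall t, `|t - t0| < d -> nc (p.[cis t] - p.[cis t0]) < r.
Proof.
move=> r0; have r2 : 0 < r / 2 by lra.
have [hR hI] := cont_cis p.
have /cvgrPdist_lt /(_ _ r2) h1 := hR t0; have /cvgrPdist_lt /(_ _ r2) h2 := hI t0.
have [d /= d0 hd] := (nbhs_ballP _ _).1 (filterI h1 h2).
exists d => // t ht; have [] : _ /\ _ := hd t _.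
  by rewrite /ball /= distrC.
move=> /= h3 h4; apply: le_lt_trans (nc_le_ReIm _) _.
rewrite !raddfB /= distrC [`|complex.Im _ - _|]distrC; lra.
Qed.

Lemma cis_inj : {in `[0, pi] &, injective cis}.
Proof. by move=> a b ha hb [h _]; apply: cos_inj h. Qed.

Lemma cis_nonroot V : V != 0 -> exists2 t, 0 < t < pi & V.[cis t] != 0.
Proof.
move=> V0; apply: contrapT => h.
pose f (j : nat) : R := pi / j.+2%:R.
have hf j : 0 < f j < pi.
  rewrite divr_gt0 ?pi_gt0 ?ltr0n //= ltr_pdivrMr ?ltr0n // ltr_pMr ?pi_gt0 //.
  by rewrite ltr1n.
have hr : all (root V) [seq cis (f j) | j <- iota 0 (size V)].
  apply/allP => _ /mapP[j _ ->]; apply/eqP/eqP/negPn/negP => hj; apply: h.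
  by exists (f j).
have := max_poly_roots V0 hr; rewrite size_map size_iota ltnn => h2.
suff /h2 : uniq [seq cis (f j) | j <- iota 0 (size V)] by [].
rewrite map_inj_uniq ?iota_uniq // => i j /cis_inj.
have hin k : f k \in `[0, pi] by have /andP[h3 h4] := hf k; rewrite in_itv /= !ltW.
move=> /(_ (hin i) (hin j)) /(mulfI (lt0r_neq0 (pi_gt0 R))) /invr_inj /eqP.
by rewrite eqr_nat => /eqP [].
Qed.

(* Where V is nearly constant, conj(z^-M V(z)) runs through many full turns; the
   intermediate value theorem applies to its imaginary part on each left half-turn. *)
Lemma many_zeros V n : V != 0 -> exists M0, forall M, (M0 <= M)%N ->
  exists s : seq C, [/\ uniq s, size s = n &
    forall z, z \in s -> nc z = 1 /\ (star M V).[z] = - (nc V.[z])%:C%C].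
Proof.
move=> /cis_nonroot[t0 /andP[t00 t0pi] V0]; set v0 := V.[cis t0] in V0.
have pi0 := pi_gt0 R.
have r0 : 0 < nc v0 by rewrite nc_gt0.
have r2 : 0 < nc v0 / 2 by lra.
have [d d0 hd] := near_cis V t0 r2.
pose d1 := Num.min d (pi - t0).
have d10 : 0 < d1 by rewrite lt_min d0 subr_gt0.
have := archi_boundP (ltW (_ : 0 < pi * (2 * n + 6)%:R / d1)).
rewrite divr_gt0 ?mulr_gt0 ?ltr0n ?addn_gt0 ?orbT // => /(_ isT).
set M1 := Num.bound _ => hM1; exists (maxn M1 (size V)) => M.
rewrite geq_max => /andP[hM hV].
have M0 : 0 < M%:R :> R.
  apply: lt_le_trans (_ : M1%:R <= _); last by rewrite ler_nat.
  by apply: le_lt_trans hM1; rewrite divr_ge0 ?mulr_ge0 // ltW.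
have Mn0 : M%:R != 0 :> R by rewrite lt0r_neq0.
have dM : pi * (2 * n + 6)%:R < d1 * M%:R.
  rewrite -ltr_pdivrMl // mulrC; apply: lt_le_trans hM1 _; by rewrite ler_nat.
have rC : (nc v0)%:C%C != 0 :> C by rewrite (inj_eq (@complexI R) _ 0) lt0r_neq0.
have [phi hphi cphi] : exists2 t, `|t| <= pi & cis t = cis t0 ^+ M * cj v0 / (nc v0)%:C%C.
  apply: cis_polar; rewrite !ncM ncV nc_real ncX nc_cis expr1n mul1r nc_cj.
  by rewrite ger0_norm ?nc_ge0 // divff // lt0r_neq0.
move: hphi; rewrite ler_norml => /andP[phi1 phi2].
(* At angle [t0 + tau j y] the phase of z^M conj(v0) is (2j + 3) pi + y. The 3 keeps [tau] positive
   against |phi| <= pi and |y| <= pi/2, and the [2 * n + 6] in [M1] keeps it below [d1]. *)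
pose tau (j : nat) (y : R) := (pi * (2 * j + 3)%:R + y - phi) / M%:R.
have tauM j y : tau j y * M%:R = pi * (2 * j + 3)%:R + y - phi by rewrite divfK.
have tau_bound j y : (j < n)%N -> - (pi / 2) <= y <= pi / 2 -> 0 < tau j y < d1.
  move=> hj /andP[y1 y2]; rewrite -(ltr_pM2r M0 0) -(ltr_pM2r M0 _ d1) mul0r tauM.
  have e1 : (2 * j + 3)%:R = 2 * j%:R + 3 :> R by rewrite natrD natrM.
  have e2 : 0 <= j%:R :> R by rewrite ler0n.
  have e3 : j.+1%:R <= n%:R :> R by rewrite ler_nat.
  have e4 : (2 * n + 6)%:R = 2 * n%:R + 6 :> R by rewrite natrD natrM.
  rewrite -[j.+1%:R]natr1 in e3; rewrite e4 in dM; rewrite e1.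
  have := ler_wpM2l (ltW pi0) e3; have := mulr_ge0 (ltW pi0) e2.
  by move=> e5 e6; apply/andP; split; lra.
have key j y : (j < n)%N -> - (pi / 2) <= y <= pi / 2 ->
    nc ((star M V).[cis (t0 + tau j y)] + (nc v0)%:C%C * cis y) < nc v0 / 2.
  move=> hj hy; have /andP[b1 b2] := tau_bound j y hj hy.
  set z := cis _.
  have E : (nc v0)%:C%C * cis y = - (z ^+ M * cj v0).
    have -> : z ^+ M * cj v0 = cis phi * cis (tau j y *+ M) * (nc v0)%:C%C.
      by rewrite cphi /z cisD exprMn (cisMn (tau j y)); field.
    rewrite -cisD -[tau j y *+ M]mulr_natr tauM addrC subrK cisD.
    rewrite [pi * _]mulr_natr cisMn cis_pi -signr_odd oddD oddM /= expr1.
    by ring.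
  rewrite E horner_star ?nc_cis //; last by rewrite leqW.
  rewrite -mulrBr -rmorphB ncM nc_cj unim_exp ?nc_cis // mul1r.
  by apply: hd; rewrite addrAC subrr add0r gtr0_norm //; move: b2; rewrite lt_min => /andP[].
have hpi2 : - (pi / 2) <= pi / 2 :> R by lra.
have zero (j : nat) : exists y : R, (j < n)%N ->
    - (pi / 2) <= y <= pi / 2 /\
    (star M V).[cis (t0 + tau j y)] = - (nc V.[cis (t0 + tau j y)])%:C%C.
  have [hj|hj] := ltnP j n; last by exists 0.
  pose f y := complex.Im (star M V).[cis (t0 + tau j y)].
  have ImE y : - (pi / 2) <= y <= pi / 2 -> `|f y + nc v0 * sin y| < nc v0 / 2.
    move=> hy; apply: le_lt_trans (key j y hj hy).
    have [_] := ReIm_le_nc ((star M V).[cis (t0 + tau j y)] + (nc v0)%:C%C * cis y).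
    by rewrite raddfD /= !mul0r addr0.
  have fc : continuous f.
    have [_ hI] := cont_cis (star M V).
    move=> y; apply: (@continuous_comp R R R (fun y => t0 + tau j y)
      (fun t => complex.Im (star M V).[cis t])); last exact: hI.
    apply: cvgD; first exact: cvg_cst.
    apply: cvgMl; apply: cvgB; last exact: cvg_cst.
    by apply: cvgD; [exact: cvg_cst|exact: cvg_id].
  (* At both ends the approximation -|v0| cis y is purely imaginary of modulus |v0|, and the error
     is less than half of this. *)
  have f1 : f (pi / 2) <= 0.
    have := ImE (pi / 2); rewrite lexx hpi2 sin_pihalf mulr1 => /(_ isT).
    by rewrite ltr_norml => /andP[h1 h2]; lra.
  have f2 : 0 <= f (- (pi / 2)).
    have := ImE (- (pi / 2)); rewrite lexx hpi2 sinN sin_pihalf mulrN1 => /(_ isT).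
    by rewrite ltr_norml => /andP[h1 h2]; lra.
  have [|y] := IVT hpi2 (continuous_subspaceT fc) (v := 0).
    by rewrite ge_min f1 orbT le_max f2.
  rewrite in_itv /= => hy fy; exists y => _; split=> //.
  have hk := key j y hj hy; set u := (star M V).[_] in hk *.
  have uI : complex.Im u = 0 by [].
  have -> : nc V.[cis (t0 + tau j y)] = nc u.
    by rewrite /u horner_star ?nc_cis ?leqW // ncM nc_cj unim_exp ?nc_cis ?mul1r.
  have [x ux] : exists x, u = Complex x 0 by case: (u) uI => a b /= ->; exists a.
  rewrite ux in hk *.
  have c0 := cos_ge0_pihalf hy.
  (* A positive real number is at distance at least |v0| from -|v0| cis y, whose real part is
     nonpositive as cos y >= 0. *)
  have x0 : x <= 0.
    rewrite leNgt; apply/negP => x0.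
    have h1 : nc v0 ^+ 2 <= (nc v0 / 2) ^+ 2.
      apply: le_trans (_ : nc (Complex x 0 + (nc v0)%:C%C * cis y) ^+ 2 <= _); last first.
        by rewrite ler_pXn2r ?nnegrE ?nc_ge0 ?ltW.
      rewrite [leRHS]nc_sq /= !mul0r add0r addr0 subr0 -[leLHS]mulr1 -(cos2Dsin2 y).
      have := mulr_ge0 (ltW r0) c0; have := mulr_ge0 (ltW x0) (mulr_ge0 (ltW r0) c0).
      by have := sqr_ge0 x; lra.
    have : 0 < nc v0 ^+ 2 by rewrite exprn_gt0.
    by rewrite expr_div_n in h1; lra.
  apply/eqP; rewrite eq_complex /= oppr0 eqxx andbT.
  by rewrite expr0n addr0 sqrtr_sqr ler0_norm // opprK.
have [y hy] := choice zero.
exists [seq cis (t0 + tau j (y j)) | j <- iota 0 n]; split.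
- rewrite map_inj_in_uniq ?iota_uniq // => i j; rewrite !mem_iota !add0n /= => hi hj.
  have [hyi _] := hy i hi; have [hyj _] := hy j hj.
  have hin k : (k < n)%N -> - (pi / 2) <= y k <= pi / 2 -> t0 + tau k (y k) \in `[0, pi].
    move=> hk hyk; have := tau_bound k (y k) hk hyk; rewrite lt_min in_itv /=.
    move=> /andP[h1 /andP[_ h2]]; apply/andP; split.
      by move: t00 h1; clear; lra.
    by move: h2; clear; lra.
  move=> /(cis_inj (hin i hi hyi) (hin j hj hyj)) /addrI /(congr1 ( *%R^~ M%:R)).
  rewrite /= !tauM => E.
  (* Distinct turns are at least 2 pi apart, more than the variation pi of [y], so the angles
     differ. *)
  have far (a b : nat) : (a < b)%N -> pi * (2 * a + 3)%:R + pi *+ 2 <= pi * (2 * b + 3)%:R :> R.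
    move=> hab; have h1 : (2 * a + 3 + 2)%:R <= (2 * b + 3)%:R :> R.
      by rewrite ler_nat; move: hab; clear; lia.
    rewrite natrD in h1; have := ler_wpM2l (ltW pi0) h1.
    by rewrite mulrDr (mulr_natr pi 2).
  move: hyi hyj => /andP[a1 a2] /andP[b1 b2].
  by have [h|h|//] := ltngtP i j; exfalso; have := far _ _ h;
    rewrite mulr2n; move: E a1 a2 b1 b2 pi0; clear; lra.
- by rewrite size_map size_iota.
move=> z /mapP[j]; rewrite mem_iota add0n /= => hj ->.
by split; [exact: nc_cis|have [] := hy j hj].
Qed.

End Arcs.

(** * Limits of a sequence of counterexamples *)

Section Config.
Context {R : realType}.
Local Notation C := R[i].

(* Q is a product over unimodular zeros of P, and M = (N + k) / 2 is the middle
   degree of P Q. *)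
Record config (k N : nat) (P Q W : {poly C}) (M : nat) : Prop := Config {
  cfg_size : size P = N.+1;
  cfg_pm1 : forall n, (n <= N)%N -> pm1 P`_n;
  cfg_star : star N P = P;
  cfg_PQ : P * Q = W * star M W;
  cfg_W : (size W <= M.+1)%N;
  cfg_Q : size Q = k.+1;
  cfg_lead : nc Q`_k = 1;
  cfg_nrm : nrm1 Q <= 2 ^+ k;
  cfg_starQ : star k Q = Q;
  cfg_Nk : (N + k = 2 * M)%N }.

Variables (U : set_system nat) (P Q W : nat -> {poly C}) (M : nat -> nat) (k : nat).
Hypothesis hU : UltraFilter U.
Local Notation ev := (ev U).
Local Notation ulim := (ulim U).
Hypothesis hc : ev (fun N => config k N (P N) (Q N) (W N) (M N)).
Hypothesis hinf : forall n : nat, ev (fun N => (n <= N)%N).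

Lemma ulim_ev (x : nat -> C) l : ev (fun N => x N = l) -> ulim x l.
Proof.
by move=> hx; apply: (ulim_eq hU _ (ulim_cst hU l)); apply: evW hx => N ->.
Qed.

Lemma ev_large (n : nat) : ev (fun N => (n <= M N)%N).
Proof.
apply: ev2 hc (hinf (2 * n)) => N c hN.
by have := cfg_Nk c; lia.
Qed.

Lemma nc_pseq_P N i : config k N (P N) (Q N) (W N) (M N) ->
  nc (pseq (P N) i) <= 1.
Proof.
move=> c; case: i => [n|n]; rewrite /pseq; last by rewrite nc0 ler01.
have [hn|hn] := leqP n N; first by rewrite nc_pm1 //; exact: (cfg_pm1 c hn).
by rewrite nth_default ?nc0 ?ler01 // (cfg_size c).
Qed.

(** The l1 bound on [Q] makes every coefficient converge. The normalised leading coefficient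
    prevents a drop of degree in the limit, and self-reciprocity carries it to the constant
    coefficient. *)
Lemma exists_Ql : exists Ql : {poly C}, [/\ forall j, ulim (fun N => (Q N)`_j) Ql`_j,
  size Ql = k.+1, nc Ql`_k = 1, nc Ql`_0 = 1 & star k Ql = Ql].
Proof.
have ex j : exists l, ulim (fun N => (Q N)`_j) l.
  apply: (ulim_ex hU (B := 2 ^+ k)); apply: evW hc => N c.
  apply: le_trans (cfg_nrm c); have [hj|hj] := ltnP j (size (Q N)).
    by rewrite /nrm1 (bigD1 (Ordinal hj)) //= lerDl sumr_ge0 // => i _; rewrite nc_ge0.
  by rewrite nth_default // nc0 nrm1_ge0.
have [q hq] := choice ex.
have q0 j : (k < j)%N -> q j = 0.
  move=> hj; apply: (ulim_uniq hU (hq j)); apply: ulim_eq (ulim_cst hU 0) => //.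
  by apply: evW hc => N c; rewrite nth_default // (cfg_Q c).
pose Ql := \poly_(j < k.+1) q j.
have Qj j : Ql`_j = q j.
  by rewrite coef_poly; case: ltnP => // hj; rewrite q0.
have lead : nc Ql`_k = 1.
  by rewrite Qj; apply: (ulim_nc1 hU (hq k)); apply: evW hc => N; apply: cfg_lead.
have st : star k Ql = Ql.
  apply/polyP => i; rewrite coef_poly; case: ltnP => hi; last by rewrite Qj q0.
  rewrite !Qj; apply: (ulim_uniq hU (ulim_cj hU (hq (k - i)%N))).
  apply: ulim_eq (hq i) => //; apply: evW hc => N c.
  by rewrite -{1}(cfg_starQ c) coef_star.
exists Ql; split=> // [j||].
- by rewrite Qj.
- by rewrite size_poly_eq // -Qj -nc_gt0 lead ltr01.
by rewrite -st coef_star // nc_cj subn0.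
Qed.

Lemma exists_e : exists e : int -> C, (forall i, pm1 (e i)) /\
  forall i, ev (fun N => pseq (P N) ((M N)%:Z + i) = e i).
Proof.
have ex i : exists l, pm1 l /\ ev (fun N => pseq (P N) ((M N)%:Z + i) = l).
  have [|l [h1 _ h2]] := ulim_pm1 hU (x := fun N => pseq (P N) ((M N)%:Z + i)).
    apply: ev2 hc (ev_large (absz i + k)) => N c hN.
    have [n hn] : exists n : nat, (M N)%:Z + i = n%:Z by exists (absz ((M N)%:Z + i)%R); lia.
    by rewrite hn /=; apply: (cfg_pm1 c); have := cfg_Nk c; lia.
  by exists l.
have [e he] := choice ex.
by exists e; split=> i; have [] := he i.
Qed.

Lemma exists_eta : exists eta : int -> C, [/\ (forall n : nat, pm1 (eta n%:Z)),
  (forall i, i < 0 -> eta i = 0) &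
  forall i, ev (fun N => pseq (P N) i = eta i)].
Proof.
have ex (n : nat) : exists l, pm1 l /\ ev (fun N => (P N)`_n = l).
  have [|l [h1 _ h2]] := ulim_pm1 hU (x := fun N => (P N)`_n).
    by apply: ev2 hc (hinf n) => N c hN; exact: (cfg_pm1 c hN).
  by exists l.
have [b hb] := choice ex.
exists (fun i => if i is Posz n then b n else 0); split=> [n|[]//|[n|n]].
- by have [] := hb n.
- by have [] := hb n.
by apply: evT.
Qed.

Variables (Ql : {poly C}) (e eta : int -> C).
Hypothesis hQl : forall j, ulim (fun N => (Q N)`_j) Ql`_j.
Hypothesis sQl : size Ql = k.+1.
Hypothesis Ql0 : nc Ql`_0 = 1.
Hypothesis starQl : star k Ql = Ql.
Hypothesis he : forall i, pm1 (e i).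
Hypothesis hlime : forall i, ev (fun N => pseq (P N) ((M N)%:Z + i) = e i).
Hypothesis heta : forall n : nat, pm1 (eta n%:Z).
Hypothesis eta_neg : forall i, i < 0 -> eta i = 0.
Hypothesis hlimeta : forall i, ev (fun N => pseq (P N) i = eta i).

Lemma lim_mid i : ulim (fun N => pseq (P N * Q N) ((M N)%:Z + i)) (act Ql e (i)).
Proof.
rewrite (act_widen _ _ (_ : size Ql <= k.+1)%N) ?sQl //.
have hx (j : 'I_k.+1) : ulim (fun N => pseq (P N) ((M N)%:Z + (i - j%:Z)))
    (e (i - j%:Z)).
  apply: ulim_ev; apply: ev2 hc (hlime (i - j%:Z)) => N c <-.
  by congr (pseq _ _); lia.
have := ulim_sum hU (fun j : 'I_k.+1 => ulimM hU (hQl j) (hx j)).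
apply: ulim_eq => //; apply: evW hc => N c.
rewrite mulrC -act_pseq (act_widen _ _ (_ : size (Q N) <= k.+1)%N) ?(cfg_Q c) //.
by apply: eq_bigr => j _; congr (_ * pseq _ _); lia.
Qed.

Lemma lim_low i : ulim (fun N => pseq (P N * Q N) i) (act Ql eta i).
Proof.
rewrite (act_widen _ _ (_ : size Ql <= k.+1)%N) ?sQl //.
have hx (j : 'I_k.+1) : ulim (fun N => pseq (P N) (i - j%:Z)) (eta (i - j%:Z)).
  exact: ulim_ev (hlimeta _).
have := ulim_sum hU (fun j : 'I_k.+1 => ulimM hU (hQl j) (hx j)).
apply: ulim_eq => //; apply: evW hc => N c.
by rewrite mulrC -act_pseq (act_widen _ _ (_ : size (Q N) <= k.+1)%N) ?(cfg_Q c).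
Qed.

Lemma lim_mid_act F i :
  ulim (fun N => pseq (P N * Q N * F) ((M N)%:Z + i)) (act (Ql * F) e (i)).
Proof.
rewrite actMC [act F _ _]/act.
have := ulim_sum hU (fun j : 'I_(size F) =>
  ulimM hU (ulim_cst hU F`_j) (lim_mid (i - j%:Z))).
apply: (ulim_eq hU); apply: (evT hU) => N; rewrite [in RHS]mulrC -act_pseq [RHS]/act.
by apply: eq_bigr => j _; rewrite addrA.
Qed.

Lemma lim_low_act F i :
  ulim (fun N => pseq (P N * Q N * F) i) (act (Ql * F) eta i).
Proof.
rewrite actMC [act F _ _]/act.
have := ulim_sum hU (fun j : 'I_(size F) =>
  ulimM hU (ulim_cst hU F`_j) (lim_low (i - j%:Z))).
by apply: (ulim_eq hU); apply: (evT hU) => N; rewrite [in RHS]mulrC -act_pseq.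
Qed.

(** The square sum between the two ends is kept here: it is what later makes [W] small in the
    middle. *)
Lemma corr_config N (D : {poly C}) d l : config k N (P N) (Q N) (W N) (M N) ->
  (size D <= d.+1)%N -> (2 * l < M N + d)%N ->
  2 * nc (pseq (P N * Q N * (D * star d D)) l%:Z) +
  \sum_(l.+1 <= i < M N + d - l) nc (W N * D)`_i ^+ 2 <=
  complex.Re (pseq (P N * Q N * (D * star d D)) ((M N)%:Z + d%:Z))
  /\ complex.Re (pseq (P N * Q N * (D * star d D)) ((M N)%:Z + d%:Z)) =
     \sum_(i < (M N + d).+1) nc (W N * D)`_i ^+ 2.
Proof.
move=> c hD hl.
have hWD : (size (W N * D)%R <= (M N + d).+1)%N.
  apply: leq_trans (size_polyMleq _ _) _; rewrite -subn1 leq_subLR.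
  by apply: leq_trans (leq_add (cfg_W c) hD) _; lia.
have E : P N * Q N * (D * star d D) = (W N * D) * star (M N + d) (W N * D).
  by rewrite starM // ?(cfg_W c) // (cfg_PQ c); ring.
by rewrite E -PoszD /=; apply: star_corr.
Qed.

Lemma lim_Pos : Pos Ql 0 e eta.
Proof.
move=> D d l hD; rewrite -!mulrA.
have main (l' : nat) : 2 * nc (act (Ql * (D * star d D)) eta l'%:Z) <=
    complex.Re (act (Ql * (D * star d D)) e (d%:Z)).
  apply: (ulim_pos hU (lim_mid_act _ _) (lim_low_act _ _)).
  apply: ev2 hc (ev_large (2 * l' + 1)) => N c hN.
  have [|h1 _] := corr_config (l := l') c hD; first by lia.
  apply: le_trans h1; rewrite lerDl; apply: sumr_ge0 => i _; exact: sqr_ge0.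
case: l => l; first exact: main.
have -> : act (Ql * (D * star d D)) eta (Negz l) = 0.
  by rewrite /act big1 // => j _; rewrite eta_neg ?mulr0 //; lia.
by apply: le_trans (main 0); rewrite nc0 mulr0 mulr_ge0 ?nc_ge0.
Qed.

(** The squared l2 norm of [W] is the middle coefficient of [P Q], at most the l1 norm of [Q]
    because the coefficients of [P] are signs. *)
Lemma W_l2 : ev (fun N => \sum_(i < (M N).+1) nc (W N)`_i ^+ 2 <= 2 ^+ k).
Proof.
apply: ev2 hc (ev_large 1) => N c hN.
have h1s : (size (1%R : {poly C}) <= 1)%N by rewrite size_poly1.
have [|_] := corr_config (D := 1) (d := 0) (l := 0) c h1s; first by lia.
rewrite star1 !mulr1 addn0 addr0 => <-; apply: le_trans (Re_le _) _.
rewrite mulrC -act_pseq; apply: le_trans (act_bound _ _ (fun i => nc_pseq_P i c)) _.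
by rewrite mulr1; apply: cfg_nrm c.
Qed.

Lemma W_bound : ev (fun N => forall i, nc (W N)`_i <= 2 ^+ k).
Proof.
apply: ev2 hc W_l2 => N c hN i.
have k1 : 1 <= 2 ^+ k :> R by rewrite exprn_ege1 // ler1n.
have [hi|hi] := ltnP i (M N).+1; last first.
  by rewrite nth_default ?nc0 ?(le_trans ler01) // (leq_trans (cfg_W c)).
have h2 : nc (W N)`_i ^+ 2 <= 2 ^+ k.
  apply: le_trans hN; rewrite (bigD1 (Ordinal hi)) //= lerDl.
  by apply: sumr_ge0 => j _; exact: sqr_ge0.
have [h3|h3] := lerP (nc (W N)`_i) 1; first by apply: le_trans k1.
by apply: le_trans h2; rewrite expr2 ler_peMl ?nc_ge0 // ltW.
Qed.

(** Low coefficients of W W^* are a convolution of the low end of [W] with its conjugated high end,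
    and both ends have square-summable limits. *)
Lemma low_vanish (eps : R) : 0 < eps ->
  exists n1 : nat, forall n, (n1 <= n)%N -> nc (act Ql eta n%:Z) <= eps.
Proof.
move=> e0.
have exx (i : nat) : exists l, ulim (fun N => (W N)`_i) l.
  apply: (ulim_ex hU (B := 2 ^+ k)).
  by apply: evW W_bound => N.
have [x hx] := choice exx.
have exy (i : nat) : exists l, ulim (fun N => cj (W N)`_(M N - i)) l.
  apply: (ulim_ex hU (B := 2 ^+ k)).
  by apply: evW W_bound => N hN; rewrite nc_cj.
have [y hy] := choice exy.
have l2x (n : nat) : \sum_(i < n) nc (x i) ^+ 2 <= 2 ^+ k.
  have hs := ulim_sum hU (fun i : 'I_n => ulimM hU (hx i) (ulim_cj hU (hx i))).
  have := ulim_Re_le hU hs (B := 2 ^+ k); rewrite raddf_sum.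
  rewrite (eq_bigr (fun i : 'I_n => nc (x i) ^+ 2)); last first.
    by move=> i _; exact: Re_mulcj.
  apply; apply: ev2 W_l2 (ev_large n) => N h1 h2; rewrite raddf_sum.
  apply: le_trans h1; rewrite (eq_bigr (fun i : 'I_n => nc (W N)`_i ^+ 2)); last first.
    by move=> i _; exact: Re_mulcj.
  rewrite -!(big_mkord predT (fun i => nc (W N)`_i ^+ 2)).
  rewrite [leRHS](@big_cat_nat _ _ _ n) //=; last by rewrite leqW.
  by rewrite lerDl sumr_ge0 // => i _; exact: sqr_ge0.
have l2y (n : nat) : \sum_(i < n) nc (y i) ^+ 2 <= 2 ^+ k.
  have hs := ulim_sum hU (fun i : 'I_n => ulimM hU (hy i) (ulim_cj hU (hy i))).
  have := ulim_Re_le hU hs (B := 2 ^+ k); rewrite raddf_sum.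
  rewrite (eq_bigr (fun i : 'I_n => nc (y i) ^+ 2)); last first.
    by move=> i _; exact: Re_mulcj.
  apply; apply: ev2 W_l2 (ev_large n) => N h1 h2; rewrite raddf_sum.
  apply: le_trans h1; rewrite (eq_bigr (fun i : 'I_n => nc (W N)`_(M N - i) ^+ 2)); last first.
    by move=> i _; rewrite -[in RHS]nc_cj; exact: Re_mulcj.
  rewrite [leRHS](reindex_inj rev_ord_inj) /=.
  rewrite -(big_mkord predT (fun i => nc (W N)`_(M N - i) ^+ 2)).
  rewrite -(big_mkord predT (fun i => nc (W N)`_((M N).+1 - i.+1) ^+ 2)).
  rewrite [leRHS](@big_cat_nat _ _ _ n) //=; last by rewrite leqW.
  by rewrite lerDl sumr_ge0 // => i _; exact: sqr_ge0.
have [n1 h1] := conv_l2_vanish e0 l2x l2y.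
exists n1 => n hn; suff -> : act Ql eta n%:Z = \sum_(i < n.+1) x i * y (n - i)%N by apply: h1.
apply: (ulim_uniq hU (lim_low n%:Z)).
have := ulim_sum hU (fun i : 'I_n.+1 => ulimM hU (hx i) (hy (n - i)%N)).
apply: ulim_eq => //; apply: ev2 hc (ev_large n) => N c hN.
rewrite (cfg_PQ c) /= coefM; apply: eq_bigr => i _.
by rewrite coef_star //; have := ltn_ord i; lia.
Qed.

(** From index [k] on the coefficients of [Ql eta] are sums of signs with fixed weights; as they
    tend to 0, [signed_gap] makes them vanish. *)
Lemma low_poly : exists V : {poly C}, act Ql eta =1 pseq V.
Proof.
have [d d0 hd] := @signed_gap R (fun j => Ql`_j) k.+1.
have d2 : 0 < d / 2 by lra.
have [n1 hn1] := low_vanish d2.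
have v0 (n : nat) : (n1 + k <= n)%N -> act Ql eta n%:Z = 0.
  move=> hn; have := hn1 n (leq_trans (leq_addr _ _) hn).
  rewrite (act_widen _ _ (_ : size Ql <= k.+1)%N) ?sQl //.
  have [|->//|h1] := hd (fun j => eta (n%:Z - j%:Z)); last first.
    by move=> h3; exfalso; have := le_trans h1 h3; lra.
  move=> j hj; have -> : n%:Z - j%:Z = (n - j)%N%:Z by lia.
  exact: heta.
exists (\poly_(i < n1 + k) act Ql eta i%:Z) => -[n|n] /=.
  by rewrite coef_poly; case: ltnP => // hn; apply: v0.
by rewrite /act big1 // => j _; rewrite eta_neg ?mulr0 //; lia.
Qed.

Lemma eta_periodic (V : {poly C}) : act Ql eta =1 pseq V ->
  exists X a : nat, (0 < X)%N /\ forall n : nat, (a <= n)%N -> eta (n + X)%:Z = eta n%:Z.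
Proof.
move=> hV; apply: (@recurrence_periodic _ (fun j => Ql`_j) k (size V) (fun n => eta n%:Z)) => //.
  by rewrite -nc_gt0 Ql0.
move=> n hn; have := hV (n + k)%:Z; rewrite /= nth_default; last first.
  exact: leq_trans (leq_addr _ _).
rewrite (act_widen _ _ (_ : size Ql <= k.+1)%N) ?sQl // => hn0.
rewrite -[RHS]hn0; apply: eq_bigr => j _; congr (_ * eta _); have := ltn_ord j; lia.
Qed.

Variables (V mh : {poly C}) (n0 : nat).
Hypothesis hV : act Ql eta =1 pseq V.
Hypothesis hmh : forall i, act Ql e i = pseq mh (i + n0%:Z).
Hypothesis hmhV : forall z, nc z = 1 -> nc mh.[z] = 2 * nc V.[z].

Let c0 : int := n0%:Z.
Let cA : R := nrm1 mh * (absz c0 + size mh)%:R.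
Let cB : R := nrm1 V * (0 + size V)%:R.
Let fej zeta L : {poly C} := dil zeta (geo L.+1) * star L (dil zeta (geo L.+1)).

Lemma mid_peak zeta L : nc zeta = 1 ->
  nc (act (Ql * fej zeta L) e (L%:Z) - L.+1%:R * (zeta ^ c0 * mh.[zeta^-1])) <= cA.
Proof.
move=> u; rewrite actMC (eq_act _ _ hmh) (act_shift _ (pseq mh)) act_pseq mulrC.
have -> : L%:Z + n0%:Z = L%:Z + c0 by rewrite /c0; lia.
exact: twist_peak.
Qed.

Lemma low_peak zeta L : nc zeta = 1 ->
  nc (act (Ql * fej zeta L) eta L%:Z - L.+1%:R * V.[zeta^-1]) <= cB.
Proof.
move=> u; rewrite actMC (eq_act _ _ hV) act_pseq mulrC.
by have := twist_peak V 0 L u; rewrite addr0 expr0z mul1r.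
Qed.

(** [Pos], tested near [z], bounds the real part below by 2 |V|, which is also the modulus; so the
    number is real and nonnegative. *)
Lemma mid_pos z : nc z = 1 -> z ^ (- c0) * mh.[z] = (2 * nc V.[z])%:C%C.
Proof.
move=> u; have z0 := unim_neq0 u; have ui : nc z^-1 = 1 by rewrite ncV u invr1.
have h1 : 2 * nc V.[z] <= complex.Re (z ^ (- c0) * mh.[z]).
  apply: (@le_arch _ _ _ (cA + 2 * cB)) => L.
  have hs : (size (dil z^-1 (geo L.+1)) <= L.+1)%N.
    exact: leq_trans (size_dil _ _) (size_geo _).
  have := lim_Pos L%:Z hs; rewrite -!mulrA -/(fej z^-1 L).
  have := mid_peak L ui; have := low_peak L ui; rewrite invrK.
  set x := act _ eta _; set y := act _ e _.
  rewrite -exprz_inv; set r := _ * mh.[z] => h1 h2 h3.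
  have h4 := Re_le (y - L.+1%:R * r).
  have h5 := ncBB (L.+1%:R * V.[z]) x; rewrite ncBC ncM nc_nat in h5.
  have E : complex.Re (L.+1%:R * r) = L.+1%:R * complex.Re r.
    by rewrite [L.+1%:R * r]mulr_natl raddfMn [RHS]mulr_natl.
  rewrite raddfB /= E in h4.
  have L0 : 0 < L.+1%:R :> R by rewrite ltr0n.
  rewrite -(ler_pM2l L0) [L.+1%:R * (_ + _)]mulrDr [L.+1%:R * (_ / _)]mulrC.
  by rewrite divfK ?lt0r_neq0 //; lra.
have h2 : nc (z ^ (- c0) * mh.[z]) = 2 * nc V.[z].
  by rewrite ncM unim_expz // mul1r hmhV.
have := nc_sq (z ^ (- c0) * mh.[z]); rewrite -h2 in h1 *.
case: (_ * mh.[z]) h1 => a b; have n1 := nc_ge0 (Complex a b).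
move: n1; set n := nc _ => n1 /= h1 h3.
have ha : n ^+ 2 <= a ^+ 2 by rewrite ler_pXn2r ?nnegrE // (le_trans n1).
have b0 : b = 0.
  by apply/eqP; rewrite -sqrf_eq0 eq_le sqr_ge0 andbT; lra.
have : a ^+ 2 == n ^+ 2 by rewrite h3 b0 expr0n addr0.
by rewrite eqrXn2 // ?(le_trans n1) // => /eqP ->; rewrite b0.
Qed.

(** For the twisted kernel both sides of the correlation inequality are 2 |V| (L + 1) up to
    constants, so the square sum left in the middle is bounded independently of [L]; [avg_window]
    then gains the factor [L.+1]. The 3 is a tolerance 1 in the limits, once for the middle
    coefficient and twice for the low one. *)
Lemma window_l2 (L : nat) :
  ev (fun N => L.+1%:R * \sum_(L.+1 <= j < M N - L) nc (W N)`_j ^+ 2 <= cA + 2 * cB + 3).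
Proof.
have [om hom] := @prim_root_complex R L.+1 isT.
have h1 : ev (fun N => forall i : 'I_L.+1,
   \sum_(L.+1 <= j < M N) nc (W N * dil (om ^+ i) (geo L.+1))`_j ^+ 2 <= cA + 2 * cB + 3).
  apply: (ev_ord hU) => i; set zeta := om ^+ i.
  have u : nc zeta = 1 by rewrite unim_exp //; exact: unity_unim (prim_expr_order hom).
  have := lim_mid_act (fej zeta L) L%:Z; have := lim_low_act (fej zeta L) L%:Z.
  have := mid_peak L u; have := low_peak L u.
  set x := act _ eta _; set y := act _ e _ => h1 h2 h3 h4.
  apply: (ev2 hU _ hc (evI hU (ev_large L.+1) (evI hU (h3 1 ltr01) (h4 1 ltr01)))).
  move=> N c [hN [h5 h6]].
  have hs : (size (dil zeta (geo L.+1)) <= L.+1)%N.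
    exact: leq_trans (size_dil _ _) (size_geo _).
  have [|h7 _] := corr_config (l := L) c hs; first by lia.
  rewrite -/(fej zeta L) addnK in h7.
  have ui : nc zeta^-1 = 1 by rewrite ncV u invr1.
  have h8 := Re_le (pseq (P N * Q N * fej zeta L) ((M N)%:Z + L%:Z)).
  have h9 := ncBB (pseq (P N * Q N * fej zeta L) ((M N)%:Z + L%:Z)) y.
  have h10 := ncBB y (L.+1%:R * (zeta ^ c0 * mh.[zeta^-1])).
  rewrite !ncM nc_nat unim_expz // mul1r hmhV // in h10.
  have h11 := ncBB x (pseq (P N * Q N * fej zeta L) L%:Z); rewrite ncBC in h11.
  have h12 := ncBB (L.+1%:R * V.[zeta^-1]) x; rewrite ncBC ncM nc_nat in h12.
  lra.
apply: (ev2 hU _ h1 (ev_large L)) => N h2 hN.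
apply: avg_window => // zeta hz; have [i ->] := prim_rootP hom hz; exact: h2.
Qed.

Lemma Q_close (d : R) : 0 < d -> ev (fun N => nrm1 (Ql - Q N) < d).
Proof.
move=> d0; have d1 : 0 < d / k.+1%:R by rewrite divr_gt0 // ltr0n.
have hj := ev_ord hU (fun j : 'I_k.+1 => hQl j d1).
apply: (ev2 hU _ hc hj) => N c hN.
rewrite (@nrm1_widen _ _ k.+1); last first.
  apply: leq_trans (size_polyD _ _) _; rewrite size_polyN geq_max sQl (cfg_Q c).
  by rewrite leqnn.
have -> : d = \sum_(j < k.+1) d / k.+1%:R.
  by rewrite sumr_const card_ord -[(d / _) *+ _]mulr_natr divfK // pnatr_eq0.
apply: ltr_sum => [|j _]; first by apply/hasP; exists ord0; rewrite ?mem_index_enum.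
by rewrite coefB ncBC; exact: hN.
Qed.

(** In the window [P Q] is small by [mid_conv] and [Q] is close to [Ql], so a coefficient of [P Ql]
    stays below its gap [d], which does not depend on [N]. *)
Lemma window_zero : exists L1 : nat, forall L, (L1 <= L)%N ->
  ev (fun N => forall n, (2 * L < n)%N -> (n + L < M N)%N -> (P N * Ql)`_n = 0).
Proof.
have [d d0 hd] := @signed_gap R (fun j => Ql`_j) k.+1.
pose B : R := cA + 2 * cB + 3.
(* Chosen so that [mid_conv] gives at most 2 (d/16 + d/16) = d/4; with the d/4 from [Q_close] the
   total is d/2. *)
pose tau : R := d / (16 * 2 ^+ k).
have k0 : 0 < 2 ^+ k :> R by rewrite exprn_gt0.
have t0 : 0 < tau by rewrite divr_gt0 // mulr_gt0.
have tk : tau * 2 ^+ k = d / 16 by rewrite /tau; field; rewrite lt0r_neq0.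
have [L1 hL1] : exists L1 : nat, `|B| / (tau * (d / 16)) < L1%:R.
  by exists (Num.bound (`|B| / (tau * (d / 16)))); apply: archi_boundP; rewrite divr_ge0 // ltW // mulr_gt0 //; lra.
exists (maxn L1 k) => L; rewrite geq_max => /andP[hL hk].
have d4 : 0 < d / 4 by lra.
have hB : tau^-1 * (B / L.+1%:R) <= d / 16.
  have L0 : 0 < L.+1%:R :> R by rewrite ltr0n.
  rewrite mulrA ler_pdivrMr // mulrC -ler_pdivlMr ?invr_gt0 // invrK.
  apply: le_trans (ler_norm _) _; rewrite ltr_pdivrMr in hL1; last by rewrite mulr_gt0 //; lra.
  have h1 : L1%:R <= L.+1%:R :> R by rewrite ler_nat leqW.
  have h2 : 0 < tau * (d / 16) by rewrite mulr_gt0 //; lra.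
  by have := ler_wpM2r (ltW h2) h1; lra.
apply: (ev2 hU _ (evI hU hc W_l2) (evI hU (window_l2 L) (evI hU (Q_close d4) (ev_large (k + L))))).
move=> N [c h1] [h2 [h3 h4]] n hn hM.
have hNM : (n <= N)%N.
  by have := cfg_Nk c; move: (M N) h4 hM => m; clear; lia.
have E : (P N * Ql)`_n = \sum_(j < k.+1) Ql`_j * (P N)`_(n - j).
  have -> : (P N * Ql)`_n = pseq (Ql * P N) n%:Z by rewrite mulrC.
  rewrite -act_pseq (act_widen _ _ (_ : size Ql <= k.+1)%N) ?sQl //.
  apply: eq_bigr => j _; rewrite subzn //.
  by have := ltn_ord j; move: (nat_of_ord j) hk hn; clear; lia.
have e1 : nc (P N * Q N)`_n <= d / 4.
  rewrite (cfg_PQ c).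
  have L0 : 0 < L.+1%:R :> R by rewrite ltr0n.
  have h6 : \sum_(L.+1 <= j < M N - L) nc (W N)`_j ^+ 2 <= B / L.+1%:R.
    by rewrite ler_pdivlMr // mulrC.
  have := mid_conv (cfg_W c) t0 h1 h6 hn hM; rewrite tk => h7; apply: le_trans h7 _.
  by move: hB; set y := tau^-1 * _ => hB; lra.
have e2 : nc (P N * (Ql - Q N))`_n <= d / 4.
  have -> : (P N * (Ql - Q N))`_n = pseq ((Ql - Q N) * P N) n%:Z by rewrite mulrC.
  rewrite -act_pseq; apply: le_trans (act_bound _ _ (fun i => nc_pseq_P i c)) _.
  by rewrite mulr1 ltW.
have [|h6|h6] := hd (fun j => (P N)`_(n - j)).
- by move=> j _; exact: (cfg_pm1 c (leq_trans (leq_subr _ _) hNM)).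
- by rewrite E.
exfalso; rewrite -E in h6.
have e3 : (P N * Ql)`_n = (P N * Q N)`_n + (P N * (Ql - Q N))`_n.
  by rewrite -coefD -mulrDr addrC subrK.
have := ncD (P N * Q N)`_n (P N * (Ql - Q N))`_n; rewrite -e3; lra.
Qed.

(** Finitely many signs at the low end and around [M] eventually agree with [eta] and [e]. Between
    these zones [window_zero] applies, and the upper half follows by self-reciprocity. *)
Lemma exact_shape : ev (fun N =>
  P N * Ql = V + 'X^(M N - n0) * mh + star (2 * M N) V).
Proof.
have [L1 hL1] := window_zero.
pose L := (L1 + k + n0 + size V + size mh + 1)%N.
have hz := hL1 L; rewrite {1}/L -!addnA leq_addr in hz; have {}hz := hz isT.
have hlow : ev (fun N => forall n : 'I_(2 * L).+1, pseq (P N) n%:Z = eta n%:Z).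
  by apply: (ev_ord hU) => n; exact: hlimeta.
pose j0 (i : nat) : int := i%:Z - (L + k)%:Z.
have hmid : ev (fun N => forall i : 'I_(4 * L), pseq (P N) ((M N)%:Z + j0 i) = e (j0 i)).
  by apply: (ev_ord hU) => n; exact: hlime.
apply: (ev2 hU _ (evI hU hc hz) (evI hU hlow (evI hU hmid (ev_large (10 * L))))).
move=> N [c hzN] [hlowN [hmidN hM]].
have {hz}hL : (L1 + k + n0 + size V + size mh < L)%N by rewrite /L addn1.
move: (M N) L hL hM hzN c @j0 hlowN hmidN hlow hmid => m L hL hM hzN c j0 hlowN hmidN _ _.
have hNk := cfg_Nk c.
have TE n : (P N * Ql)`_n = \sum_(j < k.+1) Ql`_j * pseq (P N) (n%:Z - j%:Z).
  have -> : (P N * Ql)`_n = pseq (Ql * P N) n%:Z by rewrite mulrC.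
  by rewrite -act_pseq (act_widen _ _ (_ : size Ql <= k.+1)%N) ?sQl.
have T_low n : (n <= 2 * L)%N -> (P N * Ql)`_n = V`_n.
  move=> hn; rewrite TE -[V`_n]/(pseq V n%:Z) -hV.
  rewrite (act_widen _ _ (_ : size Ql <= k.+1)%N) ?sQl //.
  apply: eq_bigr => j _; congr (_ * _); case E : (n%:Z - j%:Z) => [i|i].
    have hi : (i < (2 * L).+1)%N by lia.
    exact: (hlowN (Ordinal hi)).
  by rewrite eta_neg.
have T_mid n : (m <= n + L)%N -> (n <= m + L)%N ->
    (P N * Ql)`_n = pseq mh (n%:Z - m%:Z + n0%:Z).
  move=> hn1 hn2; rewrite TE -hmh (act_widen _ _ (_ : size Ql <= k.+1)%N) ?sQl //.
  apply: eq_bigr => j _; congr (_ * _); have hj := ltn_ord j.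
  pose t := absz (n%:Z - m%:Z - j%:Z + (L + k)%:Z)%R.
  have ht : (t < 4 * L)%N by rewrite /t; lia.
  have := hmidN (Ordinal ht); have -> : j0 (Ordinal ht) = n%:Z - m%:Z - j%:Z.
    by rewrite /j0 /= /t; lia.
  by move=> <-; congr (pseq _ _); lia.
have T_sym n : (n <= 2 * m)%N -> (P N * Ql)`_n = cj (P N * Ql)`_(2 * m - n).
  move=> hn; rewrite -coef_star // -hNk starM ?sQl ?(cfg_size c) // (cfg_star c).
  by rewrite starQl.
have sV : (size V <= L)%N by lia.
have smh : (size mh + n0 < L)%N by lia.
have V0' i : (L <= i)%N -> V`_i = 0 by move=> hi; rewrite nth_default // (leq_trans sV).
have T_left n : (n + L < m)%N -> (P N * Ql)`_n = V`_n.
  move=> hn; have [h1|h1] := leqP n (2 * L); first exact: T_low.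
  by rewrite hzN // V0' //; move: h1; clear; lia.
have sT : (size (P N * Ql)%R <= (2 * m).+1)%N.
  by apply: leq_trans (size_polyMleq _ _) _; rewrite sQl (cfg_size c); lia.
apply/polyP => n; rewrite !coefD coefXnM.
have starV i : (L <= 2 * m - i)%N || (2 * m < i)%N -> (star (2 * m) V)`_i = 0.
  move=> hi2; rewrite coef_poly; case: ltnP => // hi.
  by rewrite V0' ?rmorph0 //; move: hi hi2; clear; lia.
have [h1|h1] := ltnP (n + L) m.
  rewrite T_left // starV ?addr0; last by lia.
  by case: ltnP => h2; rewrite ?addr0 //; lia.
have [h2|h2] := leqP n (m + L).
  rewrite T_mid // V0' ?add0r; last by lia.
  rewrite starV ?addr0; last by lia.
  case: ltnP => h3.
    by case E: (_ + n0%:Z) => [i|i] //; lia.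
  by have -> : n%:Z - m%:Z + n0%:Z = (n - (m - n0))%N%:Z by lia.
rewrite V0' ?add0r; last by lia.
have -> : (n < m - n0)%N = false by lia.
rewrite [mh`__]nth_default ?add0r; last first.
  by move: (size mh) smh h2; clear; lia.
have [h3|h3] := leqP n (2 * m).
  by rewrite T_sym // coef_star // T_left //; lia.
by rewrite starV ?h3 ?orbT // nth_default // (leq_trans sT).
Qed.

Hypothesis V0 : V != 0.

Lemma many_roots (K : nat) : ev (fun N => exists t : seq C, [/\ uniq t, size t = K &
  forall z, z \in t -> nc z = 1 /\ root (P N) z]).
Proof.
(* The extra [k] points pay for the zeros of [Ql], which has degree [k]. *)
have [m0 hm0] := many_zeros (K + k) V0.
apply: (ev2 hU _ (evI hU hc exact_shape) (ev_large (m0 + n0 + size V))).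
move=> N [c hT] hM.
have [|t [ut st ht]] := hm0 (M N); first by lia.
have hroot z : z \in t -> nc z = 1 /\ root (P N * Ql) z.
  move=> /ht[u hz]; split=> //; have z0 := unim_neq0 u; apply/rootP.
  have sV : (size V <= M N)%N by lia.
  have zM : z ^+ M N * cj V.[z] = - (nc V.[z])%:C%C.
    by rewrite -hz horner_star // leqW.
  have e1 : V.[z] = - (z ^+ M N * (nc V.[z])%:C%C).
    have e0 : cj V.[z] = - (z ^- M N * (nc V.[z])%:C%C).
      by rewrite -mulrN -zM mulrA mulVf ?expf_neq0 // mul1r.
    rewrite -[LHS]conjcK e0 rmorphN rmorphM fmorphV rmorphXn /= (unim_cj u).
    by rewrite exprVn invrK oppr0.
  (* Up to the factor z^M, the three pieces of [exact_shape] are -|V|, 2 |V| and -|V|. *)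
  rewrite hT !hornerD hornerM hornerXn horner_star //; last by lia.
  have -> : z ^+ (2 * M N) * cj V.[z] = z ^+ M N * (z ^+ M N * cj V.[z]).
    by rewrite mulrA -exprD addnn -mul2n.
  have -> : z ^+ (M N - n0) = z ^+ M N * z ^ (- c0).
    by rewrite !exprnP -expfzDr //; congr (_ ^ _); rewrite /c0; lia.
  rewrite -mulrA mid_pos // zM {1}e1.
  have -> : (2 * nc V.[z])%:C%C = (nc V.[z])%:C%C + (nc V.[z])%:C%C :> C.
    by rewrite -rmorphD /=; congr (_%:C)%C; ring.
  by ring.
have hsz : (size [seq z <- t | ~~ root (P N) z] <= k)%N.
  rewrite -ltnS -sQl; apply: max_poly_roots; last exact: filter_uniq.
    by rewrite -size_poly_eq0 sQl.
  apply/allP => z; rewrite mem_filter => /andP[h1 /hroot[_]].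
  by rewrite rootM (negPf h1).
exists (take K [seq z <- t | root (P N) z]); split.
- by rewrite take_uniq // filter_uniq.
- rewrite size_takel // -(leq_add2r k) -st -(count_predC (root (P N)) t) size_filter.
  by rewrite leq_add2l -size_filter.
by move=> z /mem_take; rewrite mem_filter => /andP[h1 /hroot[u _]].
Qed.

End Config.

(** * Conclusion along an ultrafilter of counterexamples *)

Section Final.
Context {R : realType}.
Local Notation C := R[i].

Lemma config_many_roots (U : set_system nat) (P Q W : nat -> {poly C}) (M : nat -> nat) (k K : nat) :
  UltraFilter U -> ev U (fun N => config k N (P N) (Q N) (W N) (M N)) ->
  (forall n : nat, ev U (fun N => (n <= N)%N)) ->
  ev U (fun N => exists t : seq C, [/\ uniq t, size t = K &
    forall z, z \in t -> nc z = 1 /\ root (P N) z]).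
Proof.
move=> hU hc hinf.
have [Ql [hQl sQl lead Ql0 starQl]] := exists_Ql hU hc.
have [e [he hlime]] := exists_e hU hc hinf.
have [eta [heta eta_neg hlimeta]] := exists_eta hU hc hinf.
have hP := lim_Pos hU hc hinf hQl sQl hlime eta_neg hlimeta.
have [V hV] := low_poly hU hc hinf hQl sQl heta eta_neg hlimeta.
have [X [a [X0 per]]] := eta_periodic sQl Ql0 heta hV.
have Qn0 : Ql != 0 by rewrite -size_poly_eq0 sQl.
have [n0 anti] := antisym hP Qn0 he heta eta_neg X0 per.
have [mh hmh hmhV] := mid_poly hP Qn0 he heta eta_neg X0 per anti hV.
(* The constant coefficient of [V] is that of [Ql] times [eta 0], of modulus 1. *)
have V0 : V != 0.
  apply/eqP => V0; have := hV 0; rewrite V0 /= coef0.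
  rewrite (act_widen _ _ (_ : size Ql <= k.+1)%N) ?sQl // big_ord_recl big1 => [|j _].
    rewrite addr0 subr0 => /eqP; rewrite mulf_eq0 -!nc_eq0 Ql0 oner_eq0 /=.
    by rewrite (nc_pm1 (heta 0%N)) oner_eq0.
  by rewrite eta_neg ?mulr0 //= /bump /=; lia.
exact: (many_roots hU hc hinf hQl sQl starQl hlime eta_neg hlimeta hV hmh hmhV V0 K).
Qed.

Lemma uniq_roots_num (P : {poly C}) (t : seq C) : P != 0 -> uniq t ->
  (forall z, z \in t -> nc z = 1 /\ root P z) -> (size t <= num_unimodular_zeros P)%N.
Proof.
move=> P0 ut ht; apply: uniq_leq_size => // z /ht[u rz].
rewrite in_fset_set; last exact: finite_unimodular_zeros.
by rewrite inE; split; [rewrite ncE u|apply/rootP].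
Qed.

Lemma ev_bounded (U : set_system nat) (f : nat -> nat) (A : nat) : UltraFilter U ->
  ev U (fun N => (f N < A)%N) -> exists k, ev U (fun N => f N = k).
Proof.
move=> hU; elim: A => [|A IH] h.
  by have [N] := ev_ex hU h.
have : ev U (fun N => (f N < A)%N \/ f N = A).
  by apply: evW h => N; rewrite ltnS leq_eqVlt => /orP[/eqP|]; [right|left].
by move=> /(ev_or hU)[/IH//|h1]; exists A.
Qed.

Lemma littlewood_star N (P : {poly C}) : littlewood N P -> reciprocal N P -> star N P = P.
Proof.
move=> [sP cP] /reciprocal_coef; rewrite sP leqnn => /(_ isT) h.
apply/polyP => i; rewrite coef_poly ltnS; case: leqP => hi; last first.
  by rewrite nth_default // sP.
rewrite [RHS]h //; case: (cP (N - i)%N (leq_subr _ _)) => ->; first exact: rmorphN1.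
exact: rmorph1.
Qed.

End Final.

Theorem theorem2 (R : realType) : ZL R N @[N --> \oo] --> \oo.
Proof.
apply/cvgnyPge => A; apply: contrapT => hA.
(* If the limit fails, [S] meets every tail, so some ultrafilter contains [S] and all tails. *)
pose S := [set N | (ZL R N < A)%N].
have FS : ProperFilter (within S \oo).
  split; last exact: within_filter.
  move=> h; apply: hA; move: h; rewrite /within /=; apply: filterS => N hN.
  by rewrite leqNgt; apply/negP => /hN.
have [U [hU FU]] := ultraFilterLemma FS.
have evS : ev U (fun N => (ZL R N < A)%N).
  apply: (FU [set N | (ZL R N < A)%N]); by rewrite /within; apply: nearW.
have hinf (n : nat) : ev U (fun N => (n <= N)%N).
  by apply: (FU [set N | (n <= N)%N]); apply: filterS (nbhs_infty_ge n).
have hP N : exists P : {poly R[i]}, [/\ littlewood N P, reciprocal N P &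
    num_unimodular_zeros P = ZL R N].
  by rewrite /ZL; case: ex_minnP => m /asboolP.
have {hP}[P hP] := choice hP.
have sP N : size (P N) = N.+1 by have [[]] := hP N.
have P0 N : P N != 0 by rewrite -size_poly_eq0 sP.
have hcfg N : exists x : {poly R[i]} * {poly R[i]} * nat * nat,
    config x.2 N (P N) x.1.1.1 x.1.1.2 x.1.2 /\ (x.2 <= ZL R N)%N.
  have [lP rP <-] := hP N; have stP := littlewood_star lP rP.
  have [Q [W [M [k [rs [[h1 h2] h3 [h4 h5 h6 h7] [h8 h9] h10]]]]]] := unimodular_factor (sP N) stP.
  (* [k] counts distinct unimodular zeros of [P N], hence is at most the minimum. *)
  exists (Q, W, M, k); split; last by rewrite -h9; exact: uniq_roots_num.
  by split=> // n hn; have [_ cP] := lP; case: (cP n hn) => ->; [right|left].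
have [x hx] := choice hcfg.
(* The degree of [Q] varies with [N] but is below [A] along [U], so the ultrafilter fixes its
   value. *)
have [k hk] : exists k, ev U (fun N => (x N).2 = k).
  apply: (@ev_bounded _ _ A hU); apply: evW evS => N.
  by apply: leq_ltn_trans; have [] := hx N.
have hc : ev U (fun N => config k N (P N) (x N).1.1.1 (x N).1.1.2 (x N).1.2).
  by apply: evW hk => N <-; have [] := hx N.
have [N [h1 [t [ut st ht]]]] := ev_ex hU (evI hU evS (config_many_roots A hU hc hinf)).
have := uniq_roots_num (P0 N) ut ht; have [_ _ ->] := hP N.
by rewrite st leqNgt h1.
Qed.
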